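(* Let $\varphi$ be an entire function, $0<s<1$, $p\ge2$ and $\alpha>-1$, such that $p-2+s<\alpha<p-1$. Then $S_\varphi(Q_s)\subset\mathcal{D}^p_\alpha$ if and only if $\varphi$ is of order less than one, or of order one and type zero.
   Context: $\mathbb{D}=\{z\in\mathbb{C}:|z|<1\}$, $\mathcal{H}ol(\mathbb{D})$ is the space of analytic functions in $\mathbb{D}$, and $dA(z)=\frac1\pi\,dx\,dy$. Superposition operator: for an entire function $\varphi$, $S_\varphi(f)=\varphi\circ f$ for $f\in\mathcal{H}ol(\mathbb{D})$. For $X,Y\subset\mathcal{H}ol(\mathbb{D})$, $S_\varphi(X)\subset Y$ means $\varphi\circ f\in Y$ for every $f\in X$. Spaces: for $0<p<\infty$ and $\alpha>-1$, $\mathcal{D}^p_\alpha$ is the set of $f\in\mathcal{H}ol(\mathbb{D})$ with $\int_{\mathbb{D}}(1-|z|^2)^\alpha|f'(z)|^p\,dA(z)<\infty$. For $0\le s<\infty$, $Q_s$ is the set of $f\in\mathcal{H}ol(\mathbb{D})$ with $\sup_{a\in\mathbb{D}}\int_{\mathbb{D}}|f'(z)|^2g(z,a)^s\,dA(z)<\infty$, where $g(z,a)=\log\left|\frac{1-\overline{a}z}{z-a}\right|$. Order and type: with $M(r,\varphi)=\max_{|z|=r}|\varphi(z)|$, the order of a non-constant entire function $\varphi$ is $\rho=\limsup_{r\to\infty}\frac{\log\log M(r,\varphi)}{\log r}$, and if $0<\rho<\infty$ its type is $\tau=\limsup_{r\to\infty}\frac{\log M(r,\varphi)}{r^\rho}$.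 Constant functions are regarded as having order $0$. *)

(* Defs.v *)
From HB Require Import structures.
From mathcomp Require Import all_boot all_order all_algebra.
From mathcomp Require Import all_classical all_reals all_analysis.
From mathcomp.real_closed Require Import complex.
Import Order.TTheory GRing.Theory Num.Theory.
Import numFieldNormedType.Exports.

Set Implicit Arguments.
Unset Strict Implicit.
Unset Printing Implicit Defensive.

Local Open Scope classical_set_scope.
Local Open Scope ring_scope.
Local Open Scope complex_scope.

(* [R[i]] as a topological field and as a normed space over itself. *)
HB.instance Definition _ (R : rcfType) := GRing.ComAlgebra.copy R[i] R[i]^o.
HB.instance Definition _ (R : rcfType) := Vector.copy R[i] R[i]^o.
HB.instance Definition _ (R : rcfType) := NormedModule.copy R[i] R[i]^o.

Section Definitions.
Variable R : realType.
Implicit Types (f phi : R[i] -> R[i]) (a z : R[i]).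

(* The library's norm on [R[i]] is [R[i]]-valued; this is the same modulus as
   an element of [R]. *)
Definition cmod z : R := ComplexField.Normc.normc z.

Definition unit_disc : set R[i] := [set z | cmod z < 1].

(* Differentiation is over the scalar field [R[i]], so that [derivable _ z 1]
   is complex differentiability at [z] and [derive1 f] is the complex
   derivative.  An analytic function in an open set [U] is represented by a
   total function, whose values outside [U] are irrelevant. *)
Definition holomorphic_on (U : set R[i]) : set (R[i] -> R[i]) :=
  [set f | forall z, U z -> derivable f z 1].

Definition Hol_disc := holomorphic_on unit_disc.

Definition entire phi := holomorphic_on setT phi.

(* The integral over the unit disc with respect to dA = dx dy / pi. *)
Definition disc_integral (F : R[i] -> \bar R) : \bar R :=
  ((pi^-1)%:E * \int[lebesgue_measure \x lebesgue_measure]_(w in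
     [set w : R * R | unit_disc (w.1 +i* w.2)]) F (w.1 +i* w.2))%E.

Definition Dirichlet_space (p alpha : R) : set (R[i] -> R[i]) :=
  [set f | Hol_disc f /\
    (disc_integral (fun z =>
       ((1 - cmod z ^+ 2) `^ alpha * cmod (derive1 f z) `^ p)%:E) < +oo)%E].

(* On the disc [g] takes the junk value 0 at the single point [z = a]; this
   does not affect the integrals below. *)
Definition green z a : R := ln (cmod ((1 - a^* * z) / (z - a))).

Definition Q_space (s : R) : set (R[i] -> R[i]) :=
  [set f | Hol_disc f /\
    (ereal_sup [set disc_integral (fun z =>
       (cmod (derive1 f z) ^+ 2 * green z a `^ s)%:E) | a in unit_disc] < +oo)%E].

Definition superposition phi f := phi \o f.

(* The maximum is attained by compactness when [phi] is entire and
   [0 <= r]. *)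
Definition max_modulus phi (r : R) : R :=
  sup [set cmod (phi z) | z in [set z | cmod z = r]].

Definition constant_fun phi := exists c, forall z, phi z = c.

Definition entire_order phi : \bar R :=
  if `[< constant_fun phi >] then 0%E else
  limf_esup (fun r : R => (ln (ln (max_modulus phi r)) / ln r)%:E) +oo.

(* Meaningful when [0 < entire_order phi < +oo]. *)
Definition entire_type phi : \bar R :=
  limf_esup (fun r : R =>
    (ln (max_modulus phi r) / r `^ fine (entire_order phi))%:E) +oo.

End Definitions.

(* Main.v *)
(* The link between the two sides is the condition that, for every e > 0,
   |phi(z)| = O(exp(e|z|)), which is order < 1 or order 1 and type zero.

   If it holds then phi' satisfies it too, by Cauchy's estimate.  A function f
   in Q_s is a Bloch function, so |f(z)| grows at most like a multiple of
   log 1/(1-|z|) and |phi'(f(z))|^p is at most any small negative power of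
   1-|z|; since alpha > p-2+s, the Bloch bound on |f'|^(p-2) leaves the integral
   of (1-|z|^2)^s |f'|^2, which is finite.

   Conversely, F in D^p_alpha satisfies |F(z)| = O((1-|z|)^(-kappa)) with
   kappa = (alpha+2)/p - 1, and f_v(z) = sum_n v_n e_n/(1+e_n-z), e_n = 2^-n,
   is in Q_s for every bounded sequence v, because |f_v'(z)| = O(1/|1-z|).
   Baire's theorem on the space of sequences v with |v_n| <= c makes the growth
   of phi(f_v) at the points 1-e_N uniform over all v with given first L terms.
   Choosing the remaining terms constant up to n = N and zero afterwards,
   f_v(1-e_N) takes every value of modulus up to about cN/2, so |phi| is
   O(2^(kappa N)) there; and c is arbitrary. *)

Require Import Defs.
From mathcomp Require Import all_boot all_order all_algebra.
From mathcomp Require Import all_classical all_reals all_analysis.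
From mathcomp.real_closed Require Import complex.
From mathcomp Require Import measurable_realfun.
From mathcomp Require Import ring lra.
Import Order.TTheory GRing.Theory Num.Theory.
Import numFieldNormedType.Exports.

Set Implicit Arguments.
Unset Strict Implicit.
Unset Printing Implicit Defensive.

Local Open Scope classical_set_scope.
Local Open Scope ring_scope.
Local Open Scope complex_scope.

(** The inclusion gives each function [phi \o f] its own constant in the growth estimate, and
    superposition is not linear in [f], so no closed graph argument makes these constants uniform.
    Baire's theorem on the coefficients does so for sequences with a common prefix; the prefix
    shifts the values of f_v by a bounded amount only, which is harmless for an asymptotic
    statement. A single logarithm would control [phi] along one curve only; free complex
    coefficients make the values at one point of the disc cover a whole disc.

    The complex analysis is done on rectangles, with the contour integral of 1/w left unevaluated:
    modulus at least 1/4 is enough to solve Cauchy's formula for a derivative. Hence all numerical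
    constants are crude. Where subharmonicity of |F'|^p might be invoked, a bound by area integrals
    is derived from a contour chosen by Fubini's theorem. *)

Arguments cmod : simpl never.

(** * Complex differentiability *)

Section Modulus.
Variable R : realType.
Implicit Types (z w d : R[i]) (f g : R[i] -> R[i]).

Lemma cmodE z : cmod z = Num.sqrt (complex.Re z ^+ 2 + complex.Im z ^+ 2).
Proof. by case: z. Qed.

Lemma norm_cmod z : `|z| = (cmod z)%:C.
Proof. by []. Qed.

Lemma cmod_ge0 z : 0 <= cmod z.
Proof. by rewrite cmodE sqrtr_ge0. Qed.

Lemma sqr_cmod z : cmod z ^+ 2 = complex.Re z ^+ 2 + complex.Im z ^+ 2.
Proof. by rewrite cmodE sqr_sqrtr// addr_ge0 ?sqr_ge0. Qed.

Lemma cmodM z w : cmod (z * w) = cmod z * cmod w.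
Proof. exact: ComplexField.Normc.normcM. Qed.

Lemma cmodV z : cmod z^-1 = (cmod z)^-1.
Proof. exact: ComplexField.Normc.normcV. Qed.

Lemma cmodf z w : cmod (z / w) = cmod z / cmod w.
Proof. by rewrite cmodM cmodV. Qed.

Lemma cmodD z w : cmod (z + w) <= cmod z + cmod w.
Proof. by rewrite -lecR rmorphD /= -!norm_cmod ler_normD. Qed.

Lemma cmodN z : cmod (- z) = cmod z.
Proof. by apply: complexI; rewrite -!norm_cmod normrN. Qed.

Lemma cmodBC z w : cmod (z - w) = cmod (w - z).
Proof. by rewrite -cmodN opprB. Qed.

Lemma cmodB z w : cmod z - cmod w <= cmod (z - w).
Proof. by have := cmodD (z - w) w; rewrite subrK; lra. Qed.

Lemma cmod_eq0 z : (cmod z == 0) = (z == 0).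
Proof. by rewrite -[RHS]normr_eq0 norm_cmod -(inj_eq (@complexI R)). Qed.

Lemma cmod_gt0 z : (0 < cmod z) = (z != 0).
Proof. by rewrite lt_def cmod_ge0 andbT cmod_eq0. Qed.

Lemma cmod0 : cmod (0 : R[i]) = 0.
Proof. by apply/eqP; rewrite cmod_eq0. Qed.

Lemma cmod1 : cmod (1 : R[i]) = 1.
Proof. exact: ComplexField.Normc.normc1. Qed.

Lemma cmodR (x : R) : cmod x%:C = `|x|.
Proof. by rewrite cmodE /= expr0n addr0 sqrtr_sqr. Qed.

Lemma cmodi (x : R) : cmod (0 +i* x) = `|x|.
Proof. by rewrite cmodE /= expr0n add0r sqrtr_sqr. Qed.

Lemma cmodX z n : cmod (z ^+ n) = cmod z ^+ n.
Proof. by elim: n => [|n IH]; rewrite ?expr0 ?cmod1// !exprS cmodM IH. Qed.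

Lemma Re_le_cmod z : `|complex.Re z| <= cmod z.
Proof. by rewrite cmodE -sqrtr_sqr ler_wsqrtr// lerDl sqr_ge0. Qed.

Lemma Im_le_cmod z : `|complex.Im z| <= cmod z.
Proof. by rewrite cmodE -sqrtr_sqr ler_wsqrtr// lerDr sqr_ge0. Qed.

Lemma cmod_le_ReIm z : cmod z <= `|complex.Re z| + `|complex.Im z|.
Proof.
rewrite -[leRHS]ger0_norm ?addr_ge0// -sqrtr_sqr cmodE ler_wsqrtr//.
rewrite sqrrD !real_normK ?num_real// -addrA [X in _ <= _ + X]addrC.
by rewrite lerD2l lerDl mulrn_wge0// mulr_ge0.
Qed.

Lemma cReD z w : complex.Re (z + w) = complex.Re z + complex.Re w.
Proof. by case: z w => [? ?] []. Qed.
Lemma cImD z w : complex.Im (z + w) = complex.Im z + complex.Im w.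
Proof. by case: z w => [? ?] []. Qed.
Lemma cReN z : complex.Re (- z) = - complex.Re z.
Proof. by case: z. Qed.
Lemma cImN z : complex.Im (- z) = - complex.Im z.
Proof. by case: z. Qed.
Lemma cReM z w : complex.Re (z * w) =
  complex.Re z * complex.Re w - complex.Im z * complex.Im w.
Proof. by case: z w => [? ?] []. Qed.
Lemma cImM z w : complex.Im (z * w) =
  complex.Re z * complex.Im w + complex.Im z * complex.Re w.
Proof. by case: z w => [? ?] []. Qed.

Lemma cplxP z w : complex.Re z = complex.Re w -> complex.Im z = complex.Im w -> z = w.
Proof. by case: z w => [? ?] [? ?] /= -> ->. Qed.

(** Complex differentiability with real tolerances and without division by [h]: estimates stay in
    [R], and [h = 0] is no exception. *)
Definition cdiff (f : R[i] -> R[i]) z d := forall e, 0 < e ->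
  exists2 D, 0 < D & forall h, cmod h < D ->
    cmod (f (z + h) - f z - d * h) <= e * cmod h.

Lemma derivable_cdiff f z : derivable f z 1 -> cdiff f z (derive1 f z).
Proof.
move=> df e e0; rewrite derive1E; set d := 'D__ f z.
have /cvgrPdist_le /(_ e%:C) := df.
have e0' : (0 : R[i]) < e%:C by rewrite ltcR.
move=> /(_ e0') /=; rewrite near_withinE => /nbhs_norm0P[/= D D0 HD].
have DR : D = (complex.Re D)%:C.
  by case: D D0 {HD} => a b; rewrite ltcE /= => /andP[/eqP -> _].
exists (complex.Re D); first by move: D0; rewrite DR ltcR.
move=> h hD.
have [->|h0] := eqVneq h 0.
  by rewrite addr0 subrr mulr0 subrr cmod0 mulr0.
have /= := HD h; rewrite norm_cmod DR ltcR => /(_ hD h0).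
rewrite norm_cmod lecR [h%:A]mulr1 -[h^-1 *: _]/(h^-1 * _) => H.
have -> : f (z + h) - f z - d * h = h * (h^-1 * (f (h + z) - f z) - d).
  by rewrite mulrBr mulrA divff// mul1r [h * d]mulrC [h + z]addrC.
by rewrite cmodM mulrC ler_wpM2r ?cmod_ge0// cmodBC.
Qed.

Lemma cdiff_is_derive f z d : cdiff f z d -> is_derive z 1 f d.
Proof.
move=> df.
have H : h^-1 *: (f (h *: 1 + z) - f z) @[h --> 0^'] --> d.
  apply/cvgrPdist_le => /= e e0.
  have eR : e = (complex.Re e)%:C.
    by case: e e0 => a b; rewrite ltcE /= => /andP[/eqP -> _].
  have e0' : 0 < complex.Re e by move: e0; rewrite eR ltcR.
  have [D D0 HD] := df _ e0'.
  rewrite near_withinE; apply/nbhs_norm0P; exists D%:C; first by rewrite /= ltcR.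
  move=> h /=; rewrite norm_cmod ltcR => hD h0.
  rewrite norm_cmod eR lecR.
  rewrite [h%:A]mulr1 -[h^-1 *: _]/(h^-1 * _).
  have -> : d - h^-1 * (f (h + z) - f z) =
    - ((f (z + h) - f z - d * h) / h).
    by rewrite [h + z]addrC; field.
  by rewrite cmodN cmodf ler_pdivrMr ?cmod_gt0// HD.
split; first by apply/cvg_ex; exists d.
exact/cvg_lim.
Qed.

Lemma cdiff_derivable f z d : cdiff f z d -> derivable f z 1.
Proof. by move/cdiff_is_derive => []. Qed.

Lemma cdiff_derive1 f z d : cdiff f z d -> derive1 f z = d.
Proof. by move/cdiff_is_derive => [_ <-]; rewrite derive1E. Qed.

Lemma cdiff_cont f z d : cdiff f z d -> {for z, continuous f}.
Proof.
by move/cdiff_derivable/derivable1_diffP/differentiable_continuous.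
Qed.

Lemma ccontP f z : {for z, continuous f} <->
  forall e, 0 < e -> exists2 D, 0 < D & forall w, cmod (w - z) < D -> cmod (f w - f z) < e.
Proof.
split=> [cf e e0|H].
  have /cvgrPdist_lt /(_ e%:C) := cf; rewrite ltcR => /(_ e0).
  move=> /nbhs_normP[/= D D0 HD].
  have DR : D = (complex.Re D)%:C.
    by case: D D0 {HD} => a b; rewrite ltcE /= => /andP[/eqP -> _].
  exists (complex.Re D); first by move: D0; rewrite DR ltcR.
  move=> w wD; have /= := HD w.
  by rewrite !norm_cmod {1}DR !ltcR ![cmod (_ - w)]cmodBC ![cmod (_ - f w)]cmodBC => /(_ wD).
suff : f w @[w --> z] --> f z by [].
apply/(@cvgrPdist_lt _ _ _ (nbhs z) (nbhs_filter z)) => e e0.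
have eR : e = (complex.Re e)%:C.
  by case: e e0 => a b; rewrite ltcE /= => /andP[/eqP -> _].
have e0' : 0 < complex.Re e by move: e0; rewrite eR ltcR.
have [D D0 HD] := H _ e0'.
apply/nbhs_normP; exists D%:C; first by rewrite /= ltcR.
move=> w /=; rewrite !norm_cmod ltcR cmodBC => /HD.
by rewrite eR ltcR cmodBC.
Qed.

Lemma cdiff_eq_near f g z d r : 0 < r -> cdiff f z d ->
  (forall w, cmod (w - z) < r -> f w = g w) -> cdiff g z d.
Proof.
move=> r0 df fg e e0; have [D D0 HD] := df _ e0.
exists (Num.min D r); first by rewrite lt_min D0.
move=> h; rewrite lt_min => /andP[hD hr].
rewrite -!fg ?subrr ?cmod0//; first exact: HD.
by rewrite addrAC subrr add0r.
Qed.

Lemma cdiff_cst (c : R[i]) z : cdiff (fun=> c) z 0.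
Proof.
move=> e e0; exists 1 => // h _.
by rewrite subrr mul0r subr0 cmod0 mulr_ge0 ?cmod_ge0// ltW.
Qed.

Lemma cdiff_id z : cdiff id z 1.
Proof.
move=> e e0; exists 1 => // h _.
have -> : id (z + h) - id z - 1 * h = 0 by rewrite /=; ring.
by rewrite cmod0 mulr_ge0 ?cmod_ge0// ltW.
Qed.

Lemma is_derive_cdiff f z d : is_derive z 1 f d -> cdiff f z d.
Proof. by move=> [df <-]; have := derivable_cdiff df; rewrite derive1E. Qed.

Lemma cdiffD f g z d e : cdiff f z d -> cdiff g z e ->
  cdiff (fun w => f w + g w) z (d + e).
Proof.
by move=> /cdiff_is_derive df /cdiff_is_derive dg; apply: is_derive_cdiff; exact: is_deriveD.
Qed.

Lemma cdiffM f g z d e : cdiff f z d -> cdiff g z e ->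
  cdiff (fun w => f w * g w) z (d * g z + f z * e).
Proof.
move=> /cdiff_is_derive df /cdiff_is_derive dg; apply: is_derive_cdiff.
by rewrite addrC [d * _]mulrC; exact: is_deriveM.
Qed.

Lemma cdiff_comp f g z d e : cdiff f z d -> cdiff g (f z) e ->
  cdiff (g \o f) z (e * d).
Proof.
move=> df dg eps eps0 /=.
pose M := cmod d + 1; have M0 : 0 < M by rewrite ltr_pwDr// cmod_ge0.
pose K := cmod e + 1; have K0 : 0 < K by rewrite ltr_pwDr// cmod_ge0.
have [D1 D10 H1] := dg (eps / (2 * M)) (divr_gt0 eps0 (mulr_gt0 (ltr0Sn R 1) M0)).
(* The bound 1 gives [cmod k <= M * cmod h] for the inner increment [k]; the other bound makes the
   inner error, multiplied by [e], at most half of the allowance. *)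
have m0 : 0 < Num.min 1 (eps / (2 * K)).
  by rewrite lt_min ltr01/= divr_gt0// mulr_gt0.
have [D2 D20 H2] := df _ m0.
exists (Num.min D2 (D1 / M)); first by rewrite lt_min D20 divr_gt0.
move=> h; rewrite lt_min ltr_pdivlMr// => /andP[hD2 hD1].
have {}H2 := H2 _ hD2.
set k := f (z + h) - f z.
have kM : cmod k <= M * cmod h.
  have -> : k = (k - d * h) + d * h by ring.
  apply: le_trans (cmodD _ _) _; rewrite cmodM /M mulrDl mul1r addrC lerD2l.
  apply: le_trans H2 _; rewrite ler_piMl ?cmod_ge0// ge_min lexx//.
have -> : f (z + h) = f z + k by rewrite /k; ring.
have kD1 : cmod k < D1 by apply: le_lt_trans kM _; rewrite mulrC.
have {}H1 := H1 _ kD1.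
have -> : g (f z + k) - g (f z) - e * d * h =
  (g (f z + k) - g (f z) - e * k) + e * (k - d * h) by ring.
apply: le_trans (cmodD _ _) _.
have -> : eps * cmod h = eps / 2 * cmod h + eps / 2 * cmod h by field.
apply: lerD.
  apply: le_trans H1 _.
  have -> : eps / 2 * cmod h = eps / (2 * M) * (M * cmod h) by field; rewrite gt_eqF.
  by rewrite ler_wpM2l// divr_ge0 ?mulr_ge0// ltW.
rewrite cmodM.
have -> : eps / 2 * cmod h = K * (eps / (2 * K) * cmod h) by field; rewrite gt_eqF.
rewrite ler_pM ?cmod_ge0//; first by rewrite /K lerDl.
apply: le_trans H2 _; rewrite ler_wpM2r ?cmod_ge0// ge_min lexx orbT//.
Qed.

Lemma cdiff_inv z : z != 0 -> cdiff (fun w => w^-1) z (- z^-1 ^+ 2).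
Proof.
move=> z0 e e0; have cz : 0 < cmod z by rewrite cmod_gt0.
exists (Num.min (cmod z / 2) (e * cmod z ^+ 3 / 2)).
  by rewrite lt_min !divr_gt0// mulr_gt0// exprn_gt0.
move=> h; rewrite lt_min => /andP[h1 h2].
have zh : cmod z / 2 <= cmod (z + h).
  by have := cmodB z (- h); rewrite cmodN opprK; lra.
have zh0 : z + h != 0 by rewrite -cmod_gt0; lra.
have -> : (z + h)^-1 - z^-1 - - z^-1 ^+ 2 * h = h * h / (z ^+ 2 * (z + h)).
  by field; apply/andP; split.
rewrite cmodf !cmodM -expr2 ler_pdivrMr; last first.
  by rewrite !mulr_gt0//; lra.
rewrite mulrAC ler_wpM2r ?cmod_ge0//; apply: (le_trans (ltW h2)).
have -> : e * cmod z ^+ 3 / 2 = e * (cmod z * cmod z * (cmod z / 2)) by field.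
by rewrite ler_wpM2l ?(ltW e0)// ler_wpM2l ?mulr_ge0 ?cmod_ge0.
Qed.

Lemma cdiffV f z d : f z != 0 -> cdiff f z d ->
  cdiff (fun w => (f w)^-1) z (- (f z)^-1 ^+ 2 * d).
Proof. by move=> fz0 df; apply: (cdiff_comp df); exact: cdiff_inv. Qed.

Lemma cdiff_shift f z a d : cdiff f (a + z) d -> cdiff (fun w => f (a + w)) z d.
Proof.
by move=> df e e0; have [D D0 HD] := df _ e0; exists D => // h /HD; rewrite addrA.
Qed.

Lemma cdiff_slope f z d : cdiff f z d -> forall e, 0 < e ->
  exists2 D, 0 < D & forall w, w != z -> cmod (w - z) < D ->
    cmod ((f w - f z) / (w - z) - d) <= e.
Proof.
move=> df e e0; have [D D0 HD] := df _ e0; exists D => // w wz wD.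
have := HD _ wD; rewrite [z + _]addrC subrK => H.
have wz0 : w - z != 0 by rewrite subr_eq0.
have -> : (f w - f z) / (w - z) - d = (f w - f z - d * (w - z)) / (w - z) by field.
by rewrite cmodf ler_pdivrMr// cmod_gt0.
Qed.

End Modulus.

(** * Curves in the plane and the mean value inequality *)

Section Paths.
Variable R : realType.
Implicit Types (G g : R -> R[i]) (t a b : R).

Lemma cmod_phase (z : R[i]) : exists2 u, cmod u = 1 & u * z = (cmod z)%:C.
Proof.
have [->|z0] := eqVneq z 0; first by exists 1; rewrite ?cmod1// mulr0 cmod0.
exists ((cmod z)%:C / z).
  by rewrite cmodf cmodR ger0_norm ?cmod_ge0// divff// cmod_eq0.
by rewrite divfK.
Qed.

Definition rdiff G t (d : R[i]) := forall e, 0 < e ->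
  exists2 D, 0 < D & forall h : R, `|h| < D ->
    cmod (G (t + h) - G t - d * h%:C) <= e * `|h|.

Lemma cdiff_rdiff f (z u : R[i]) t d : cdiff f (z + u * t%:C) d ->
  rdiff (fun x => f (z + u * x%:C)) t (d * u).
Proof.
move=> df e e0; pose K := cmod u + 1.
have K0 : 0 < K by rewrite ltr_pwDr// cmod_ge0.
have [D D0 HD] := df _ (divr_gt0 e0 K0).
exists (D / K); first exact: divr_gt0.
move=> h; rewrite ltr_pdivlMr// => hD.
have uhK : cmod (u * h%:C) <= `|h| * K.
  by rewrite cmodM cmodR mulrC ler_wpM2l// /K lerDl.
have := HD (u * h%:C) (le_lt_trans uhK hD).
have -> : z + u * (t + h)%:C = z + u * t%:C + u * h%:C by rewrite rmorphD /=; ring.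
rewrite -mulrA => /le_trans; apply.
rewrite mulrAC ler_pdivrMr// -mulrA ler_wpM2l ?(ltW e0)//.
Qed.

Lemma rdiff_Re G t d (c : R[i]) : rdiff G t d ->
  is_derive t 1 (fun x => complex.Re (c * G x)) (complex.Re (c * d)).
Proof.
move=> dG; pose K := cmod c + 1.
have K0 : 0 < K by rewrite ltr_pwDr// cmod_ge0.
set F := fun x => _.
have H : h^-1 *: (F (h *: 1 + t) - F t) @[h --> 0^'] --> complex.Re (c * d).
  apply/cvgrPdist_le => /= e e0.
  have [D D0 HD] := dG _ (divr_gt0 e0 K0).
  rewrite near_withinE; apply/nbhs_ballP; exists D => //= h.
  rewrite /ball /= sub0r normrN => hD h0.
  rewrite [h%:A]mulr1 -[h^-1 *: _]/(h^-1 * _) [h + t]addrC.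
  have -> : complex.Re (c * d) - h^-1 * (F (t + h) - F t) =
    - (complex.Re (c * (G (t + h) - G t - d * h%:C)) / h).
    rewrite /F !(cReM, cImM, cReD, cImD, cReN, cImN) /=; field => //.
  rewrite normrN normf_div ler_pdivrMr ?normr_gt0//.
  apply: le_trans (Re_le_cmod _) _; rewrite cmodM.
  apply: (@le_trans _ _ (K * (e / K * `|h|))).
    by apply: ler_pM; rewrite ?cmod_ge0// ?HD// /K lerDl.
  by rewrite mulrA mulrCA divff ?mulr1// gt_eqF.
split; first by apply/cvg_ex; exists (complex.Re (c * d)).
exact/cvg_lim.
Qed.

(** The mean value theorem fails for complex values, so the increment of [G] is rotated onto the
    nonnegative real axis by a unit [u], and the real theorem is applied to the real part of [u * G]
    minus [psi]. *)
Lemma rdiff_le G (dG : R -> R[i]) (psi dpsi : R -> R) a b : a <= b ->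
  (forall t, a <= t <= b -> rdiff G t (dG t)) ->
  (forall t, a <= t <= b -> is_derive t 1 psi (dpsi t)) ->
  (forall t, a <= t <= b -> cmod (dG t) <= dpsi t) ->
  cmod (G b - G a) <= psi b - psi a.
Proof.
move=> ab HG Hp Hle.
have [u u1 uD] := cmod_phase (G b - G a).
pose F := (fun x => complex.Re (u * G x)) - psi.
have dF t : a <= t <= b -> is_derive t 1 F (complex.Re (u * dG t) - dpsi t).
  by move=> tab; apply: is_deriveB; [exact/rdiff_Re/HG|exact: Hp].
have cF : {within `[a, b], continuous F}.
  apply: derivable_within_continuous => x; rewrite in_itv/= => xab.
  by have [] := dF _ xab.
have dF' x : x \in `]a, b[ -> is_derive x 1 F (complex.Re (u * dG x) - dpsi x).
  by rewrite in_itv/= => /andP[ax xb]; apply: dF; rewrite !ltW.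
have [c cab E] := MVT_segment ab dF' cF.
have : F b - F a <= 0.
  rewrite E mulr_le0_ge0 ?subr_ge0// subr_le0.
  move: cab; rewrite in_itv/= => /Hle; apply: le_trans.
  by rewrite (le_trans (ler_norm _))// (le_trans (Re_le_cmod _))// cmodM u1 mul1r.
have -> : F b - F a = complex.Re (u * (G b - G a)) - (psi b - psi a).
  by rewrite /F !fctE mulrBr cReD cReN; ring.
by rewrite uD subr_le0.
Qed.

End Paths.

(** * Cauchy's theorem on rectangles *)

Section PathIntegral.
Variable R : realType.
Implicit Types (g : R -> R[i]) (t a b c : R).
Notation mu := (@lebesgue_measure R).

Lemma pcontP g t : {for t, continuous g} <->
  forall e, 0 < e -> exists2 D, 0 < D & forall s, `|s - t| < D -> cmod (g s - g t) < e.
Proof.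
split=> [cf e e0|H].
  have /cvgrPdist_lt /(_ e%:C) := cf; rewrite ltcR => /(_ e0).
  move=> /nbhs_ballP[/= D D0 HD]; exists D => // s sD.
  by have := HD s; rewrite /ball /= distrC norm_cmod ltcR cmodBC; apply.
apply/(@cvgrPdist_lt _ _ _ (nbhs t) (nbhs_filter t)) => e e0.
have eR : e = (complex.Re e)%:C.
  by case: e e0 => a b; rewrite ltcE /= => /andP[/eqP -> _].
have e0' : 0 < complex.Re e by move: e0; rewrite eR ltcR.
have [D D0 HD] := H _ e0'.
apply/nbhs_ballP; exists D => // w.
by rewrite /ball /= distrC norm_cmod => /HD; rewrite eR ltcR cmodBC.
Qed.

Lemma rcontP (T : pseudoMetricNormedZmodType R) (g : R -> T) t : {for t, continuous g} <->
  forall e, 0 < e -> exists2 D, 0 < D & forall s, `|s - t| < D -> `|g s - g t| < e.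
Proof.
split=> [cf e e0|H].
  have /cvgrPdist_lt /(_ e e0) := cf.
  move=> /nbhs_ballP[/= D D0 HD]; exists D => // s sD.
  by have := HD s; rewrite /ball /= distrC [`|g t - _|]distrC; apply.
apply/(@cvgrPdist_lt _ _ _ (nbhs t) (nbhs_filter t)) => e e0.
have [D D0 HD] := H _ e0.
apply/nbhs_ballP; exists D => // w.
by rewrite /ball /= distrC [`|g t - _|]distrC => /HD.
Qed.

Lemma cont_Re g t : {for t, continuous g} -> {for t, continuous (fun s => complex.Re (g s))}.
Proof.
move=> /pcontP H; apply/rcontP => e /H[D D0 HD]; exists D => // s /HD.
by apply: le_lt_trans; rewrite /= -cReN -cReD Re_le_cmod.
Qed.

Lemma cont_Im g t : {for t, continuous g} -> {for t, continuous (fun s => complex.Im (g s))}.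
Proof.
move=> /pcontP H; apply/rcontP => e /H[D D0 HD]; exists D => // s /HD.
by apply: le_lt_trans; rewrite /= -cImN -cImD Im_le_cmod.
Qed.

Lemma ler_cmodB (z w : R[i]) : `|cmod z - cmod w| <= cmod (z - w).
Proof.
by rewrite ler_norml cmodB andbT lerNl opprB (le_trans (cmodB _ _))// cmodBC.
Qed.

Lemma cont_cmod g t : {for t, continuous g} -> {for t, continuous (fun s => cmod (g s))}.
Proof.
move=> /pcontP H; apply/rcontP => e /H[D D0 HD]; exists D => // s /HD.
by apply: le_lt_trans; exact: ler_cmodB.
Qed.

Lemma pcont_affine (z u : R[i]) t : {for t, continuous (fun s : R => z + u * s%:C)}.
Proof.
apply/pcontP => e e0; have K0 : 0 < cmod u + 1 by rewrite ltr_pwDr// cmod_ge0.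
exists (e / (cmod u + 1)); first exact: divr_gt0.
move=> s; rewrite ltr_pdivlMr// => H; apply: le_lt_trans H.
have -> : z + u * s%:C - (z + u * t%:C) = u * (s - t)%:C by rewrite rmorphB /=; ring.
by rewrite cmodM cmodR mulrC ler_wpM2l// lerDl.
Qed.

Definition pcont a b g := forall t, a <= t <= b -> {for t, continuous g}.

Lemma pcontD a b g1 g2 : pcont a b g1 -> pcont a b g2 ->
  pcont a b (fun t => g1 t + g2 t).
Proof. by move=> H1 H2 t tab; apply: cvgD; [exact: H1|exact: H2]. Qed.

Lemma pcontB a b g1 g2 : pcont a b g1 -> pcont a b g2 ->
  pcont a b (fun t => g1 t - g2 t).
Proof. by move=> H1 H2 t tab; apply: cvgB; [exact: H1|exact: H2]. Qed.

Lemma pcontM a b g1 g2 : pcont a b g1 -> pcont a b g2 ->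
  pcont a b (fun t => g1 t * g2 t).
Proof. by move=> H1 H2 t tab; apply: cvgM; [exact: H1|exact: H2]. Qed.

Lemma pcont_cst a b (k : R[i]) : pcont a b (fun=> k).
Proof. by move=> t _; exact: cvg_cst. Qed.

Lemma rcont_integrable a b (g : R -> R) :
  (forall t, a <= t <= b -> {for t, continuous g}) ->
  mu.-integrable `[a, b] (EFin \o g).
Proof.
move=> cg; apply: continuous_compact_integrable; first exact: segment_compact.
by apply: continuous_in_subspaceT => t; rewrite inE /= in_itv /=; exact: cg.
Qed.

Definition cint a b g : R[i] :=
  (\int[mu]_(t in `[a, b]) complex.Re (g t))%R +i*
  (\int[mu]_(t in `[a, b]) complex.Im (g t))%R.

Lemma intRe a b g : pcont a b g -> mu.-integrable `[a, b] (EFin \o (fun s => complex.Re (g s))).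
Proof. by move=> H; apply: rcont_integrable => t /H /cont_Re. Qed.

Lemma intIm a b g : pcont a b g -> mu.-integrable `[a, b] (EFin \o (fun s => complex.Im (g s))).
Proof. by move=> H; apply: rcont_integrable => t /H /cont_Im. Qed.

Lemma eq_cint a b g1 g2 : (forall t, a <= t <= b -> g1 t = g2 t) ->
  cint a b g1 = cint a b g2.
Proof.
move=> H; rewrite /cint; congr (_ +i* _); apply: eq_Rintegral => t;
  by rewrite inE /= in_itv /= => /H ->.
Qed.

Lemma cintD a b g1 g2 : pcont a b g1 -> pcont a b g2 ->
  cint a b (fun t => g1 t + g2 t) = cint a b g1 + cint a b g2.
Proof.
move=> H1 H2; rewrite /cint; apply: cplxP => /=.
  rewrite -RintegralD//; [|exact: intRe|exact: intRe].
  by apply: eq_Rintegral => t _; rewrite cReD.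
rewrite -RintegralD//; [|exact: intIm|exact: intIm].
by apply: eq_Rintegral => t _; rewrite cImD.
Qed.

Lemma cintZ a b (k : R[i]) g : pcont a b g ->
  cint a b (fun t => k * g t) = k * cint a b g.
Proof.
move=> H; have iR := intRe H; have iI := intIm H.
have iZ r (f : R -> R) : mu.-integrable `[a, b] (EFin \o f) ->
    mu.-integrable `[a, b] (EFin \o (fun t => r * f t)).
  by move=> /(integrableZl _ r); exact.
rewrite /cint; apply: cplxP; rewrite ?(cReM, cImM) /=.
  rewrite -!RintegralZl// -RintegralB//; [|exact: iZ|exact: iZ].
  by apply: eq_Rintegral => t _; rewrite cReM.
rewrite -!RintegralZl// -RintegralD//; [|exact: iZ|exact: iZ].
by apply: eq_Rintegral => t _; rewrite cImM.
Qed.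

Lemma cintB a b g1 g2 : pcont a b g1 -> pcont a b g2 ->
  cint a b (fun t => g1 t - g2 t) = cint a b g1 - cint a b g2.
Proof.
move=> H1 H2.
have -> : cint a b (fun t => g1 t - g2 t) = cint a b (fun t => g1 t + -1 * g2 t).
  by apply: eq_cint => t _; rewrite mulN1r.
have ch : pcont a b (fun t => -1 * g2 t).
  by move=> t /H2 ch; apply: cvgM; [exact: cvg_cst|exact: ch].
by rewrite (cintD H1 ch) (cintZ _ H2) mulN1r.
Qed.

Lemma cint_cst a b (k : R[i]) : a <= b -> cint a b (fun=> k) = k * (b - a)%:C.
Proof.
move=> ab; case: k => k1 k2; rewrite /cint !Rintegral_cst//=.
rewrite lebesgue_measure_itv /= lte_fin.
apply: cplxP; rewrite ?(cReM, cImM) /=.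
  case: ltP => h /=; first by ring.
  have -> : b = a by lra.
  by ring.
case: ltP => h /=; first by ring.
have -> : b = a by lra.
by ring.
Qed.

Lemma Rint_split a b c (f : R -> R) : a <= b <= c ->
  mu.-integrable `[a, c] (EFin \o f) ->
  (\int[mu]_(t in `[a, c]) f t = \int[mu]_(t in `[a, b]) f t + \int[mu]_(t in `[b, c]) f t)%R.
Proof.
move=> /andP[ab bc] fi; have := Rintegral_itvB fi.
move=> /(_ b); rewrite !bnd_simp => /(_ ab bc) H.
rewrite -[in X in _ + X]Rintegral_itv_obnd_cbnd -?H; first by ring.
by apply: integrableS fi => //; apply: subset_itvr; rewrite bnd_simp.
Qed.

Lemma cint_split a b c g : a <= b <= c -> pcont a c g ->
  cint a c g = cint a b g + cint b c g.
Proof.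
move=> abc H; rewrite /cint.
rewrite (Rint_split abc (intRe H)) (Rint_split abc (intIm H)).
by apply: cplxP.
Qed.

Lemma Rint_norm_bound a b (f : R -> R) M : a <= b ->
  (forall t, a <= t <= b -> {for t, continuous f}) ->
  (forall t, a <= t <= b -> `|f t| <= M) ->
  `|(\int[mu]_(t in `[a, b]) f t)%R| <= M * (b - a).
Proof.
move=> ab cf Hf; have fi := rcont_integrable cf.
apply: le_trans (le_normr_Rintegral _ fi) _ => //.
have -> : M * (b - a) = \int[mu]_(t in `[a, b]) M.
  rewrite Rintegral_cst//= lebesgue_measure_itv /= lte_fin.
  case: ltP => //= h; have -> : b = a by lra.
  by rewrite subrr.
apply: le_Rintegral => //.
- exact: integrable_norm fi.
- by apply: rcont_integrable => t _; exact: cvg_cst.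
Qed.

(** The factor 2, here and in [cint_bound_int], comes from bounding real and imaginary parts
    separately. *)
Lemma cint_bound a b g M : a <= b -> pcont a b g ->
  (forall t, a <= t <= b -> cmod (g t) <= M) ->
  cmod (cint a b g) <= 2 * M * (b - a).
Proof.
move=> ab H Hg; apply: le_trans (cmod_le_ReIm _) _.
rewrite -mulrA mulr_natl mulr2n lerD//= Rint_norm_bound//.
- by move=> t /H /cont_Re.
- by move=> t /Hg; apply: le_trans (Re_le_cmod _).
- by move=> t /H /cont_Im.
- by move=> t /Hg; apply: le_trans (Im_le_cmod _).
Qed.

Lemma cint_bound_int a b g : a <= b -> pcont a b g ->
  cmod (cint a b g) <= 2 * (\int[mu]_(t in `[a, b]) cmod (g t))%R.
Proof.
move=> ab H; apply: le_trans (cmod_le_ReIm _) _.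
have ci : mu.-integrable `[a, b] (EFin \o (fun t => cmod (g t))).
  by apply: rcont_integrable => t /H /cont_cmod.
rewrite mulr_natl mulr2n lerD//=.
  apply: le_trans (le_normr_Rintegral _ (intRe H)) _ => //.
  apply: le_Rintegral => //; first exact: integrable_norm (intRe H).
  by move=> t _; exact: Re_le_cmod.
apply: le_trans (le_normr_Rintegral _ (intIm H)) _ => //.
apply: le_Rintegral => //; first exact: integrable_norm (intIm H).
by move=> t _; exact: Im_le_cmod.
Qed.

Lemma rFTC2 a b (F f : R -> R) : a <= b ->
  (forall t, a <= t <= b -> {for t, continuous f}) ->
  (forall t, a <= t <= b -> is_derive t 1 F (f t)) ->
  (\int[mu]_(t in `[a, b]) f t)%R = F b - F a.
Proof.
rewrite le_eqVlt => /predU1P[->|ab] cf dF.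
  by rewrite set_itv1 Rintegral_set1 subrr.
have dc t : a <= t <= b -> {for t, continuous F}.
  by move=> /dF[+ _] => /derivable1_diffP/differentiable_continuous.
rewrite /Rintegral (@continuous_FTC2 _ f F)//=.
- by apply: continuous_in_subspaceT => t; rewrite inE /= in_itv /=; exact: cf.
- split.
  + by move=> x; rewrite in_itv /= => /andP[h1 h2]; have [] := dF x; rewrite ?ltW.
  + by apply: cvg_at_right_filter; apply: dc; rewrite lexx ltW.
  + by apply: cvg_at_left_filter; apply: dc; rewrite lexx ltW.
- move=> x; rewrite in_itv /= => /andP[h1 h2].
  by have [|_] := dF x; rewrite ?ltW// derive1E.
Qed.

Lemma cFTC a b (G g : R -> R[i]) : a <= b -> pcont a b g ->
  (forall t, a <= t <= b -> rdiff G t (g t)) ->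
  cint a b g = G b - G a.
Proof.
move=> ab cg dG; rewrite /cint; apply: cplxP => /=.
  have -> : complex.Re (G b - G a) = complex.Re (G b) - complex.Re (G a).
    by rewrite cReD cReN.
  apply: (@rFTC2 a b (fun t => complex.Re (G t))) => //.
  - by move=> t /cg /cont_Re.
  - move=> t /dG/(@rdiff_Re _ _ _ _ 1); rewrite mul1r.
    by under eq_fun do rewrite mul1r.
have -> : complex.Im (G b - G a) = complex.Im (G b) - complex.Im (G a).
  by rewrite cImD cImN.
apply: (@rFTC2 a b (fun t => complex.Im (G t))) => //.
- by move=> t /cg /cont_Im.
- move=> t /dG/(@rdiff_Re _ _ _ _ (0 -i* 1)).
  have E (z : R[i]) : complex.Re ((0 -i* 1) * z) = complex.Im z.
    by rewrite cReM /=; ring.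
  by rewrite E; under eq_fun do rewrite E.
Qed.

End PathIntegral.
Arguments cint : simpl never.

(** * Bisection and contour integrals along rectangles *)

Section Rectangles.
Variable R : realType.
Implicit Types (g f : R[i] -> R[i]) (x y a b c d t : R).

Definition inrect x1 x2 y1 y2 (z : R[i]) :=
  x1 <= complex.Re z <= x2 /\ y1 <= complex.Im z <= y2.

(** Cousin's lemma by quadrisection: a failing rectangle has a failing quarter, and nested failing
    quarters shrink to a point, where the local hypothesis is contradicted. The exponent [n] records
    that the small rectangle is similar to the given one, which Goursat's theorem needs to compare
    perimeter and area. *)
Lemma halving_ind (P : R -> R -> R -> R -> Prop) x1 x2 y1 y2 :
  x1 <= x2 -> y1 <= y2 ->
  (forall a b c d, a <= b -> c <= d -> x1 <= a -> b <= x2 -> y1 <= c -> d <= y2 ->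
    P a ((a + b) / 2) c ((c + d) / 2) -> P ((a + b) / 2) b c ((c + d) / 2) ->
    P a ((a + b) / 2) ((c + d) / 2) d -> P ((a + b) / 2) b ((c + d) / 2) d ->
    P a b c d) ->
  (forall z, inrect x1 x2 y1 y2 z -> exists2 D, 0 < D & forall a b c d n,
    inrect a b c d z -> x1 <= a -> b <= x2 -> y1 <= c -> d <= y2 ->
    b - a = (x2 - x1) / 2 ^+ n -> d - c = (y2 - y1) / 2 ^+ n ->
    b - a < D -> d - c < D -> P a b c d) ->
  P x1 x2 y1 y2.
Proof.
move=> x12 y12 Hsplit Hloc; apply: contrapT => nP.
pose w n := (x2 - x1) / 2 ^+ n; pose h n := (y2 - y1) / 2 ^+ n.
have p2 n : 0 < (2 : R) ^+ n by rewrite exprn_gt0.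
have w0 n : 0 <= w n by rewrite divr_ge0 ?(ltW (p2 n))// subr_ge0.
have h0 n : 0 <= h n by rewrite divr_ge0 ?(ltW (p2 n))// subr_ge0.
have wS n : w n.+1 = w n / 2 by rewrite /w exprS; field; rewrite gt_eqF.
have hS n : h n.+1 = h n / 2 by rewrite /h exprS; field; rewrite gt_eqF.
pose good n (u : R * R) := [/\ x1 <= u.1, u.1 + w n <= x2, y1 <= u.2, u.2 + h n <= y2
  & ~ P u.1 (u.1 + w n) u.2 (u.2 + h n)].
have step n u : good n u -> exists v, good n.+1 v /\
    (u.1 <= v.1 <= u.1 + w n / 2) /\ (u.2 <= v.2 <= u.2 + h n / 2).
  move=> [u1 u2 u3 u4 nPu].
  have := w0 n; have := h0 n => hn wn.
  have [H|H] := pselect (exists v : R * R,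
    [/\ ~ P v.1 (v.1 + w n.+1) v.2 (v.2 + h n.+1),
      v.1 = u.1 \/ v.1 = u.1 + w n / 2 & v.2 = u.2 \/ v.2 = u.2 + h n / 2]).
    have [[v1 v2] [/= nPv v1E v2E]] := H; exists (v1, v2).
    rewrite /good /= wS hS in nPv *.
    by case: v1E => ?; case: v2E => ?; subst v1 v2; split; split=> //; lra.
  exfalso; apply: nPu.
  have {}H v1 v2 : v1 = u.1 \/ v1 = u.1 + w n / 2 -> v2 = u.2 \/ v2 = u.2 + h n / 2 ->
      P v1 (v1 + w n / 2) v2 (v2 + h n / 2).
    move=> v1E v2E; apply: contrapT => nPv; apply: H; exists (v1, v2).
    by rewrite /= wS hS.
  have E1 : (u.1 + (u.1 + w n)) / 2 = u.1 + w n / 2 by field.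
  have E2 : (u.2 + (u.2 + h n)) / 2 = u.2 + h n / 2 by field.
  have F1 : u.1 + w n = u.1 + w n / 2 + w n / 2 by field.
  have F2 : u.2 + h n = u.2 + h n / 2 + h n / 2 by field.
  apply: Hsplit; rewrite ?E1 ?E2 ?lerDl//.
  - by apply: H; left.
  - by rewrite F1; apply: H; [right|left].
  - by rewrite F2; apply: H; [left|right].
  - by rewrite F1 F2; apply: H; right.
(* The implication sits under the existential, so that [choice] yields a total step function. *)
have stepc nu : exists v, good nu.1 nu.2 -> good nu.1.+1 v /\
    (nu.2.1 <= v.1 <= nu.2.1 + w nu.1 / 2) /\ (nu.2.2 <= v.2 <= nu.2.2 + h nu.1 / 2).
  have [/step[v Hv]|H] := pselect (good nu.1 nu.2); first by exists v.
  by exists nu.2.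
have [nx Hnx] := choice stepc.
pose u := fix u n := if n is m.+1 then nx (m, u m) else (x1, y1).
have gu n : good n (u n).
  elim: n => [|n IH].
    rewrite /good /w /h !expr0 !divr1 /=.
    have E s s' : s + (s' - s) = s' :> R by ring.
    by rewrite !E.
  by have [] := Hnx (n, u n) IH.
have hu n : ((u n).1 <= (u n.+1).1 <= (u n).1 + w n / 2) /\
   ((u n).2 <= (u n.+1).2 <= (u n).2 + h n / 2).
  by have [_] := Hnx (n, u n) (gu n).
have mono n k : (u n).1 <= (u (n + k)%N).1 /\ (u (n + k)%N).1 + w (n + k)%N <= (u n).1 + w n
  /\ (u n).2 <= (u (n + k)%N).2 /\ (u (n + k)%N).2 + h (n + k)%N <= (u n).2 + h n.
  elim: k => [|k IH]; first by rewrite addn0 !lexx.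
  rewrite addnS wS hS; have := hu (n + k)%N; lra.
have key n m : (u m).1 <= (u n).1 + w n /\ (u m).2 <= (u n).2 + h n.
  have [mn|nm] := leqP m n.
    have := mono m (n - m)%N; rewrite subnKC//; have := w0 n; have := h0 n; lra.
  have := mono n (m - n)%N; rewrite subnKC ?(ltnW nm)//.
  by have := w0 m; have := h0 m; lra.
(* The coordinates of the common point of the nested rectangles are the suprema of those of their
   lower left corners. *)
pose A : set R := range (fun n => (u n).1); pose B : set R := range (fun n => (u n).2).
have hA : has_sup A.
  by split; [exists (u 0%N).1, 0%N|exists ((u 0%N).1 + w 0%N) => _ [m _ <-]; have [] := key 0%N m].
have hB : has_sup B.
  by split; [exists (u 0%N).2, 0%N|exists ((u 0%N).2 + h 0%N) => _ [m _ <-]; have [] := key 0%N m].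
have inz n : inrect (u n).1 ((u n).1 + w n) (u n).2 ((u n).2 + h n) (sup A +i* sup B).
  split=> /=; apply/andP; split.
  - by apply: ub_le_sup; [case: hA|exists n].
  - by apply: ge_sup; [case: hA|move=> _ [m _ <-]; have [] := key n m].
  - by apply: ub_le_sup; [case: hB|exists n].
  - by apply: ge_sup; [case: hB|move=> _ [m _ <-]; have [] := key n m].
have [|D D0 HD] := Hloc (sup A +i* sup B).
  have [/= E1 E2] := inz 0%N; have [/= G1 G2 G3 G4 _] := gu 0%N.
  by split=> /=; lra.
have [n Hn] : exists n, (x2 - x1 + (y2 - y1)) < D * 2 ^+ n.
  have M0 : 0 <= (x2 - x1 + (y2 - y1)) / D by apply: divr_ge0; [lra|exact: ltW].
  have /archi_boundP H := M0; exists (Num.bound ((x2 - x1 + (y2 - y1)) / D)).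
  rewrite mulrC -ltr_pdivrMr//; apply: lt_trans H _.
  by rewrite -natrX ltr_nat ltn_expl.
have [G1 G2 G3 G4] := gu n; apply.
have Ew : (u n).1 + w n - (u n).1 = w n by ring.
have Eh : (u n).2 + h n - (u n).2 = h n by ring.
apply: (HD _ _ _ _ n) => //; rewrite ?Ew ?Eh// /w /h ltr_pdivrMr//.
  by apply: le_lt_trans Hn; lra.
by apply: le_lt_trans Hn; lra.
Qed.

(* The counterclockwise integral along the boundary of a rectangle, with opposite
   sides combined. *)
Definition rint g x1 x2 y1 y2 : R[i] :=
  cint x1 x2 (fun x => g (x +i* y1) - g (x +i* y2)) +
  (0 +i* 1) * cint y1 y2 (fun y => g (x2 +i* y) - g (x1 +i* y)).

Arguments rint : simpl never.

Definition hcont g a b y := pcont a b (fun x => g (x +i* y)).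
Definition vcont g x a b := pcont a b (fun y => g (x +i* y)).

Definition bcont g x1 x2 y1 y2 :=
  [/\ hcont g x1 x2 y1, hcont g x1 x2 y2, vcont g x1 y1 y2 & vcont g x2 y1 y2].

Lemma hlineE x y : x +i* y = (0 +i* y) + 1 * x%:C :> R[i].
Proof. by apply: cplxP => /=; ring. Qed.

Lemma vlineE x y : x +i* y = x%:C + (0 +i* 1) * y%:C :> R[i].
Proof. by apply: cplxP => /=; ring. Qed.

Lemma cont_hline g x y : {for x +i* y, continuous g} ->
  {for x, continuous (fun s => g (s +i* y))}.
Proof.
move=> cg.
have -> : (fun s => g (s +i* y)) = (fun s : R => g ((0 +i* y) + 1 * s%:C)).
  by apply/funext => s; rewrite -hlineE.
by apply: (@continuous_comp _ _ _ (fun s : R => (0 +i* y) + 1 * s%:C) g);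
  [exact: pcont_affine|rewrite -hlineE].
Qed.

Lemma cont_vline g x y : {for x +i* y, continuous g} ->
  {for y, continuous (fun s => g (x +i* s))}.
Proof.
move=> cg.
have -> : (fun s => g (x +i* s)) = (fun s : R => g (x%:C + (0 +i* 1) * s%:C)).
  by apply/funext => s; rewrite -vlineE.
by apply: (@continuous_comp _ _ _ (fun s : R => x%:C + (0 +i* 1) * s%:C) g);
  [exact: pcont_affine|rewrite -vlineE].
Qed.

Lemma bcontP g x1 x2 y1 y2 : x1 <= x2 -> y1 <= y2 ->
  (forall x y, x1 <= x <= x2 -> y1 <= y <= y2 ->
    [\/ x = x1, x = x2, y = y1 | y = y2] -> {for x +i* y, continuous g}) ->
  bcont g x1 x2 y1 y2.
Proof.
move=> x12 y12 H; split=> t tab.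
- by apply: cont_hline; apply: H; rewrite ?lexx//; exact: Or43.
- by apply: cont_hline; apply: H; rewrite ?lexx ?y12//; exact: Or44.
- by apply: cont_vline; apply: H; rewrite ?lexx//; exact: Or41.
- by apply: cont_vline; apply: H; rewrite ?lexx ?x12//; exact: Or42.
Qed.

Lemma rintD g f x1 x2 y1 y2 : bcont g x1 x2 y1 y2 -> bcont f x1 x2 y1 y2 ->
  rint (fun z => g z + f z) x1 x2 y1 y2 = rint g x1 x2 y1 y2 + rint f x1 x2 y1 y2.
Proof.
move=> [g1 g2 g3 g4] [f1 f2 f3 f4]; rewrite /rint.
have -> : cint x1 x2 (fun x => g (x +i* y1) + f (x +i* y1) - (g (x +i* y2) + f (x +i* y2)))
   = cint x1 x2 (fun x => (g (x +i* y1) - g (x +i* y2)) + (f (x +i* y1) - f (x +i* y2))).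
  by apply: eq_cint => t _; ring.
have -> : cint y1 y2 (fun y => g (x2 +i* y) + f (x2 +i* y) - (g (x1 +i* y) + f (x1 +i* y)))
   = cint y1 y2 (fun y => (g (x2 +i* y) - g (x1 +i* y)) + (f (x2 +i* y) - f (x1 +i* y))).
  by apply: eq_cint => t _; ring.
rewrite (cintD (pcontB g1 g2) (pcontB f1 f2)) (cintD (pcontB g4 g3) (pcontB f4 f3)).
by ring.
Qed.

Lemma rintZ (k : R[i]) g x1 x2 y1 y2 : bcont g x1 x2 y1 y2 ->
  rint (fun z => k * g z) x1 x2 y1 y2 = k * rint g x1 x2 y1 y2.
Proof.
move=> [g1 g2 g3 g4]; rewrite /rint.
have -> : cint x1 x2 (fun x => k * g (x +i* y1) - k * g (x +i* y2))
   = cint x1 x2 (fun x => k * (g (x +i* y1) - g (x +i* y2))).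
  by apply: eq_cint => t _; ring.
have -> : cint y1 y2 (fun y => k * g (x2 +i* y) - k * g (x1 +i* y))
   = cint y1 y2 (fun y => k * (g (x2 +i* y) - g (x1 +i* y))).
  by apply: eq_cint => t _; ring.
rewrite (cintZ _ (pcontB g1 g2)) (cintZ _ (pcontB g4 g3)).
by ring.
Qed.

Lemma bcontD g f x1 x2 y1 y2 : bcont g x1 x2 y1 y2 -> bcont f x1 x2 y1 y2 ->
  bcont (fun z => g z + f z) x1 x2 y1 y2.
Proof.
move=> [g1 g2 g3 g4] [f1 f2 f3 f4]; split.
- exact: (pcontD g1 f1).
- exact: (pcontD g2 f2).
- exact: (pcontD g3 f3).
- exact: (pcontD g4 f4).
Qed.

Lemma bcontM g f x1 x2 y1 y2 : bcont g x1 x2 y1 y2 -> bcont f x1 x2 y1 y2 ->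
  bcont (fun z => g z * f z) x1 x2 y1 y2.
Proof.
move=> [g1 g2 g3 g4] [f1 f2 f3 f4]; split.
- exact: (pcontM g1 f1).
- exact: (pcontM g2 f2).
- exact: (pcontM g3 f3).
- exact: (pcontM g4 f4).
Qed.

Lemma bcont_cst (k : R[i]) x1 x2 y1 y2 : bcont (fun=> k) x1 x2 y1 y2.
Proof. by split; exact: pcont_cst. Qed.

Lemma rint_bound g x1 x2 y1 y2 M : x1 <= x2 -> y1 <= y2 -> bcont g x1 x2 y1 y2 ->
  (forall x y, x1 <= x <= x2 -> y1 <= y <= y2 ->
    [\/ x = x1, x = x2, y = y1 | y = y2] -> cmod (g (x +i* y)) <= M) ->
  cmod (rint g x1 x2 y1 y2) <= 4 * M * ((x2 - x1) + (y2 - y1)).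
Proof.
move=> x12 y12 [g1 g2 g3 g4] H; rewrite mulrDr; apply: le_trans (cmodD _ _) _.
have E : 4 * M = 2 * (M + M) by ring.
apply: lerD.
  rewrite E; apply: (cint_bound x12 (pcontB g1 g2)).
  move=> t tab; apply: le_trans (cmodD _ _) _; rewrite cmodN.
  by apply: lerD; apply: H; rewrite ?lexx ?y12//; [exact: Or43|exact: Or44].
rewrite cmodM cmodi normr1 mul1r E; apply: (cint_bound y12 (pcontB g4 g3)).
move=> t tab; apply: le_trans (cmodD _ _) _; rewrite cmodN.
by apply: lerD; apply: H; rewrite ?lexx ?x12//; [exact: Or42|exact: Or41].
Qed.

Lemma rint_affine (k l : R[i]) x1 x2 y1 y2 : x1 <= x2 -> y1 <= y2 ->
  rint (fun z => k + l * z) x1 x2 y1 y2 = 0.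
Proof.
move=> x12 y12; rewrite /rint.
have -> : cint x1 x2 (fun x => k + l * (x +i* y1) - (k + l * (x +i* y2))) =
   cint x1 x2 (fun=> l * (0 +i* (y1 - y2))).
  by apply: eq_cint => t _; apply: cplxP; rewrite !(cReD, cImD, cReN, cImN, cReM, cImM) /=; ring.
have -> : cint y1 y2 (fun y => k + l * (x2 +i* y) - (k + l * (x1 +i* y))) =
   cint y1 y2 (fun=> l * (x2 - x1)%:C).
  by apply: eq_cint => t _; apply: cplxP; rewrite !(cReD, cImD, cReN, cImN, cReM, cImM) /=; ring.
by rewrite !cint_cst//; apply: cplxP; rewrite !(cReD, cImD, cReN, cImN, cReM, cImM) /=; ring.
Qed.

Lemma rint_hsplit g x1 x2 x3 y1 y2 : x1 <= x2 <= x3 ->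
  bcont g x1 x3 y1 y2 -> vcont g x2 y1 y2 ->
  rint g x1 x3 y1 y2 = rint g x1 x2 y1 y2 + rint g x2 x3 y1 y2.
Proof.
move=> x123 [g1 g2 g3 g4] g5; rewrite /rint.
rewrite (cint_split x123 (pcontB g1 g2)).
rewrite (cintB g4 g3) (cintB g5 g3) (cintB g4 g5).
by ring.
Qed.

Lemma rint_vsplit g x1 x2 y1 y2 y3 : y1 <= y2 <= y3 ->
  bcont g x1 x2 y1 y3 -> hcont g x1 x2 y2 ->
  rint g x1 x2 y1 y3 = rint g x1 x2 y1 y2 + rint g x1 x2 y2 y3.
Proof.
move=> y123 [g1 g2 g3 g4] g5; rewrite /rint.
rewrite (cint_split y123 (pcontB g4 g3)).
rewrite (cintB g1 g2) (cintB g1 g5) (cintB g5 g2).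
by ring.
Qed.

End Rectangles.

(** * Goursat's theorem and Cauchy's formula at an interior point *)

Section Cauchy.
Variable R : realType.
Implicit Types (g f q : R[i] -> R[i]) (x y a b c d t : R).

Lemma bcont_cdiff g x1 x2 y1 y2 : x1 <= x2 -> y1 <= y2 ->
  (forall x y, x1 <= x <= x2 -> y1 <= y <= y2 ->
    [\/ x = x1, x = x2, y = y1 | y = y2] -> exists l, cdiff g (x +i* y) l) ->
  bcont g x1 x2 y1 y2.
Proof.
move=> x12 y12 H; apply: bcontP => // x y hx hy hxy.
by have [l /cdiff_cont] := H x y hx hy hxy.
Qed.

Lemma cdiff_affine (k l : R[i]) z : cdiff (fun w => k + l * w) z l.
Proof.
move=> e e0; exists 1 => // h _.
have -> : k + l * (z + h) - (k + l * z) - l * h = 0 by ring.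
by rewrite cmod0 mulr_ge0 ?cmod_ge0// ltW.
Qed.

(** The inequality proved by bisection, modulus of the integral at most [eps] times the area, passes
    from the quarters to the whole. Near a point [g] differs from an affine function, whose contour
    integral vanishes, by little compared with the diameter. *)
Lemma goursat g x1 x2 y1 y2 : x1 < x2 -> y1 < y2 ->
  (forall z, inrect x1 x2 y1 y2 z -> exists l, cdiff g z l) ->
  rint g x1 x2 y1 y2 = 0.
Proof.
move=> x12 y12 dg.
have bc a b c d : a <= b -> c <= d -> x1 <= a -> b <= x2 -> y1 <= c -> d <= y2 ->
    bcont g a b c d.
  move=> ab cd xa bx yc dy; apply: bcont_cdiff => // x y /andP[h1 h2] /andP[h3 h4] _.
  by apply: dg; split=> /=; lra.
have vc x c d : c <= d -> x1 <= x <= x2 -> y1 <= c -> d <= y2 -> vcont g x c d.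
  move=> cd /andP[xa xb] yc dy t /andP[h3 h4]; apply: cont_vline.
  have [|l /cdiff_cont//] := dg (x +i* t).
  by split=> /=; lra.
have hc a b y : a <= b -> x1 <= a -> b <= x2 -> y1 <= y <= y2 -> hcont g a b y.
  move=> ab xa xb /andP[yc dy] t /andP[h3 h4]; apply: cont_hline.
  have [|l /cdiff_cont//] := dg (t +i* y).
  by split=> /=; lra.
set W := x2 - x1; set H := y2 - y1.
have W0 : 0 < W by rewrite subr_gt0.
have H0 : 0 < H by rewrite subr_gt0.
suff Heps eps : 0 < eps -> cmod (rint g x1 x2 y1 y2) <= eps * (W * H).
  apply/eqP; rewrite -cmod_eq0; apply/eqP/le_anti; rewrite cmod_ge0 andbT.
  apply/ler_addgt0Pl => e e0; rewrite addr0.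
  have -> : e = e / (W * H) * (W * H) by rewrite divfK// mulf_neq0// gt_eqF.
  by apply: Heps; rewrite divr_gt0// mulr_gt0.
move=> eps0.
apply: (@halving_ind _ (fun a b c d => cmod (rint g a b c d) <= eps * ((b - a) * (d - c))));
  rewrite ?ltW//.
  move=> a b c d ab cd xa bx yc dy; set m := (a + b) / 2; set n := (c + d) / 2.
  have m1 : a <= m <= b by rewrite /m; lra.
  have n1 : c <= n <= d by rewrite /n; lra.
  move: (m1) (n1) => /andP[am mb] /andP[cn nd].
  move=> P1 P2 P3 P4.
  have xm : x1 <= m := le_trans xa am.
  have mx : m <= x2 := le_trans mb bx.
  have yn : y1 <= n := le_trans yc cn.
  have ny : n <= y2 := le_trans nd dy.
  have xmx : x1 <= m <= x2 by rewrite xm.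
  have yny : y1 <= n <= y2 by rewrite yn.
  rewrite (rint_hsplit m1 (bc _ _ _ _ ab cd xa bx yc dy) (vc _ _ _ cd xmx yc dy)).
  rewrite (rint_vsplit n1 (bc _ _ _ _ am cd xa mx yc dy) (hc _ _ _ am xa mx yny)).
  rewrite (rint_vsplit n1 (bc _ _ _ _ mb cd xm bx yc dy) (hc _ _ _ mb xm bx yny)).
  have -> : eps * ((b - a) * (d - c)) =
     (eps * ((m - a) * (n - c)) + eps * ((m - a) * (d - n))) +
     (eps * ((b - m) * (n - c)) + eps * ((b - m) * (d - n))) by ring.
  by do 2 (apply: le_trans (cmodD _ _) _; apply: lerD => //; try apply: le_trans (cmodD _ _) _; try apply: lerD => //).
move=> z zin; have [l dl] := dg z zin.
set S := W + H; have S0 : 0 < S by rewrite addr_gt0.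
(* At level [n] the error is at most [e * s] with [s = S / 2 ^+ n], and [rint_bound] turns it into
   [4 * e * s ^+ 2], which is exactly [eps] times the area [W * H / 4 ^+ n]. *)
pose e := eps * (W * H) / (4 * S ^+ 2).
have e0 : 0 < e by rewrite /e divr_gt0// ?mulr_gt0// exprn_gt0.
have [D D0 HD] := dl e e0.
exists (D / 2); first by rewrite divr_gt0.
move=> a b c d n [/= zab zcd] xa bx yc dy Eab Ecd abD cdD /=.
have ab : a <= b by lra.
have cd : c <= d by lra.
pose err w := g w - g z - l * (w - z).
pose aff w := (g z - l * z) + l * w.
have gE : g = (fun w => aff w + err w) by apply/funext => w; rewrite /aff /err; ring.
have bcg : bcont g a b c d by apply: bc.
have baff : bcont aff a b c d.
  by apply: bcont_cdiff => // x y _ _ _; exists l; exact: cdiff_affine.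
have berr : bcont err a b c d.
  have -> : err = (fun w => g w + (-1) * aff w).
    by apply/funext => w; rewrite /aff /err; ring.
  exact: (bcontD bcg (bcontM (bcont_cst (-1) a b c d) baff)).
have -> : rint g a b c d = rint (fun w => aff w + err w) a b c d by rewrite -gE.
rewrite rintD// rint_affine// add0r.
pose s := S / 2 ^+ n.
have sE : (b - a) + (d - c) = s by rewrite Eab Ecd /s /S /W /H; ring.
have Hb := @rint_bound _ err a b c d (e * s) ab cd berr.
apply: le_trans (Hb _) _.
  move=> x y xab ycd _.
  have zs : cmod (x +i* y - z) <= s.
    apply: le_trans (cmod_le_ReIm _) _; rewrite !(cReD, cImD, cReN, cImN) /= -sE.
    by apply: lerD; rewrite ler_norml; lra.
  have sD : s < D by rewrite -sE; lra.
  have := HD (x +i* y - z) (le_lt_trans zs sD).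
  rewrite [z + _]addrC subrK -/(err _) => /le_trans; apply.
  by rewrite ler_wpM2l// ltW.
rewrite sE Eab Ecd /e /s -/W -/H.
rewrite le_eqVlt; apply/orP; left; apply/eqP; field; rewrite ?gt_eqF// exprn_gt0//.
Qed.

(** Only continuity is asked at 0, because [q] will be a difference quotient completed there. After
    subtraction of [q 0], the contour shrinks to a small square about 0, on which the integrand is
    o(1/|z|). *)
Lemma rint_cauchy q x1 x2 y1 y2 : x1 < 0 < x2 -> y1 < 0 < y2 ->
  (forall z, inrect x1 x2 y1 y2 z -> z != 0 -> exists l, cdiff q z l) ->
  {for 0, continuous q} ->
  rint (fun z => q z / z) x1 x2 y1 y2 = q 0 * rint (fun z => z^-1) x1 x2 y1 y2.
Proof.
move=> /andP[x10 x20] /andP[y10 y20] dq cq.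
have nz0 x y : x != 0 \/ y != 0 -> x +i* y != 0 :> R[i].
  by move=> H; apply/eqP => -[] ? ?; subst x y; case: H; rewrite eqxx.
pose g z := (q z - q 0) / z.
have dg z : inrect x1 x2 y1 y2 z -> z != 0 -> exists l, cdiff g z l.
  move=> zin z0; have [l dl] := dq z zin z0.
  eexists; apply: cdiffM; last exact: cdiff_inv.
  by apply: cdiffD; [exact: dl|exact: cdiff_cst].
have bb x y : x1 <= x <= x2 -> y1 <= y <= y2 -> [\/ x = x1, x = x2, y = y1 | y = y2] ->
    inrect x1 x2 y1 y2 (x +i* y) /\ x +i* y != 0.
  move=> hx hy H; split=> //; apply: nz0.
  by case: H => ->; [left|left|right|right]; apply/eqP; lra.
have bg : bcont g x1 x2 y1 y2.
  by apply: bcont_cdiff; rewrite ?ltW ?(lt_trans x10) ?(lt_trans y10)// => x y hx hy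
     /(bb _ _ hx hy)[]; exact: dg.
have bi : bcont (fun z : R[i] => z^-1) x1 x2 y1 y2.
  apply: bcont_cdiff; rewrite ?ltW ?(lt_trans x10) ?(lt_trans y10)// => x y hx hy
     /(bb _ _ hx hy)[_ h]; eexists; exact: cdiff_inv.
have bq : bcont (fun z : R[i] => q 0 * z^-1) x1 x2 y1 y2.
  by apply: (bcontM (bcont_cst (q 0) x1 x2 y1 y2) bi).
suff g0 : rint g x1 x2 y1 y2 = 0.
  have -> : (fun z => q z / z) = (fun z => g z + q 0 * z^-1).
    by apply/funext => z; rewrite /g -mulrDl subrK.
  by rewrite (rintD bg bq) g0 add0r (rintZ _ bi).
have gou a b c d : a < b -> c < d -> x1 <= a -> b <= x2 -> y1 <= c -> d <= y2 ->
   0 < a \/ b < 0 \/ 0 < c \/ d < 0 -> rint g a b c d = 0.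
  move=> ab cd xa bx yc dy H; apply: goursat => // -[x y] [/= h1 h2].
  apply: dg; first by split=> /=; lra.
  by apply: nz0; case: H => [|[|[|]]] H; [left|left|right|right]; apply/eqP; lra.
have bcg a b c d : a <= b -> c <= d -> x1 <= a -> b <= x2 -> y1 <= c -> d <= y2 ->
   a != 0 -> b != 0 -> c != 0 -> d != 0 -> bcont g a b c d.
  move=> ab cd xa bx yc dy a0 b0 c0 d0; apply: bcont_cdiff => // x y hx hy H.
  apply: dg; first by split=> /=; lra.
  by apply: nz0; case: H => ->; [left|left|right|right].
(* The region between the two contours is cut into four rectangles that miss 0, where [goursat]
   applies. *)
have ring_dec t : 0 < t -> t < x2 -> t < y2 -> x1 < - t -> y1 < - t ->
    rint g x1 x2 y1 y2 = rint g (- t) t (- t) t.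
  move=> t0 tx ty xt yt.
  have nt0 : - t < 0 by rewrite oppr_lt0.
  have ntt : - t <= t by apply: le_trans (ltW nt0) (ltW t0).
  have [x1' y1'] : x1 != 0 /\ y1 != 0 by rewrite !lt_eqF.
  have [x2' y2'] : x2 != 0 /\ y2 != 0 by rewrite !gt_eqF.
  have [t' nt'] : t != 0 /\ - t != 0 by rewrite gt_eqF// lt_eqF.
  have [x1t y1t] : x1 <= t /\ y1 <= t by rewrite !(le_trans _ ntt) ?ltW.
  have [x2t y2t] : - t <= x2 /\ - t <= y2 by rewrite !(le_trans ntt) ?ltW.
  have y12 : y1 <= y2 by rewrite (le_trans y1t)// ltW.
  have x12 : x1 <= x2 by rewrite (le_trans x1t)// ltW.
  have {}xt' := ltW xt; have {}yt' := ltW yt; have {}tx' := ltW tx; have {}ty' := ltW ty.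
  have S1 : x1 <= - t <= x2 by rewrite xt'.
  have S2 : - t <= t <= x2 by rewrite ntt.
  have S3 : y1 <= - t <= y2 by rewrite yt'.
  have S4 : - t <= t <= y2 by rewrite ntt.
  have B1 : bcont g x1 x2 y1 y2 by apply: bcg.
  have [_ _ _ B2] : bcont g x1 (- t) y1 y2 by apply: bcg.
  have B3 : bcont g (- t) x2 y1 y2 by apply: bcg.
  have [_ _ _ B4] : bcont g (- t) t y1 y2 by apply: bcg.
  have B5 : bcont g (- t) t y1 y2 by apply: bcg.
  have [_ B6 _ _] : bcont g (- t) t y1 (- t) by apply: bcg.
  have B7 : bcont g (- t) t (- t) y2 by apply: bcg.
  have [_ B8 _ _] : bcont g (- t) t (- t) t by apply: bcg.
  have y12' : y1 < y2 by apply: lt_trans y10 y20.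
  have nttlt : - t < t by apply: lt_trans nt0 t0.
  have G1 : rint g x1 (- t) y1 y2 = 0 by apply: gou => //; right; left.
  have G2 : rint g t x2 y1 y2 = 0 by apply: gou => //; left.
  have G3 : rint g (- t) t y1 (- t) = 0 by apply: gou => //; do 3 right.
  have G4 : rint g (- t) t t y2 = 0 by apply: gou => //; do 2 right; left.
  rewrite (rint_hsplit S1 B1 B2) G1 add0r (rint_hsplit S2 B3 B4) G2 addr0.
  by rewrite (rint_vsplit S3 B5 B6) G3 add0r (rint_vsplit S4 B7 B8) G4 addr0.
apply/eqP; rewrite -cmod_eq0; apply/eqP/le_anti; rewrite cmod_ge0 andbT.
apply/ler_addgt0Pl => e e0; rewrite addr0.
(* For the square of half side [t], [rint_bound] gives [4 * (e / 16 / t) * (4 * t) = e]. *)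
have e16 : 0 < e / 16 by rewrite divr_gt0.
have /ccontP/(_ _ e16)[D D0 HD] := cq.
clear gou dg bg bi bq bb dq nz0.
pose m := Num.min (Num.min x2 y2) (Num.min (- x1) (- y1)).
pose t := Num.min m D / 4.
have t0 : 0 < t by rewrite divr_gt0// !lt_min x20 y20 D0 !oppr_gt0 x10 y10.
have tm : t < m.
  apply: (@lt_le_trans _ _ (4 * t)); first lra.
  by rewrite /t [4 * _]mulrC divfK ?pnatr_eq0// ge_min lexx.
have tD : t < D / 3.
  rewrite ltr_pdivlMr// mulrC; apply: (@lt_le_trans _ _ (4 * t)); first lra.
  by rewrite /t [4 * _]mulrC divfK ?pnatr_eq0// ge_min lexx orbT.
move: tm; rewrite /m !lt_min => /andP[/andP[tx ty] /andP[tx1 ty1]].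
rewrite (ring_dec t)//; [|by lra|by lra].
have -> : e = 4 * (e / 16 / t) * ((t - - t) + (t - - t)) by field; rewrite gt_eqF.
apply: rint_bound; [lra|lra|by apply: bcg; try lra; apply/eqP; lra|].
move=> x y hx hy H.
have xyt : t <= cmod (x +i* y).
  have tt : `|t| = t by rewrite ger0_norm// ltW.
  by case: H => H; [have := Re_le_cmod (x +i* y)|have := Re_le_cmod (x +i* y)
    |have := Im_le_cmod (x +i* y)|have := Im_le_cmod (x +i* y)];
    rewrite H ?normrN tt.
rewrite /g cmodf ler_pdivrMr ?(lt_le_trans t0)//.
apply: (@le_trans _ _ (e / 16)).
  apply/ltW/HD; rewrite subr0; apply: le_lt_trans (cmod_le_ReIm _) _ => /=.
  have : `|x| <= t by rewrite ler_norml.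
  have : `|y| <= t by rewrite ler_norml.
  lra.
by rewrite mulrAC ler_pdivlMr// ler_wpM2l ?(ltW e16).
Qed.

End Cauchy.

(** * Cauchy's estimate and continuity of the derivative *)

Section CauchyEstimates.
Variable R : realType.
Implicit Types (g f df q : R[i] -> R[i]) (x y b c d t r : R) (a z w : R[i]).
Notation mu := (@lebesgue_measure R).

Definition sq a r z := `|complex.Re (z - a)| <= r /\ `|complex.Im (z - a)| <= r.

Lemma nz_cplx x y : x != 0 \/ y != 0 -> x +i* y != 0 :> R[i].
Proof. by move=> H; apply/eqP => -[] ? ?; subst x y; case: H; rewrite eqxx. Qed.

Lemma bcont_inv x1 x2 y1 y2 : x1 < 0 < x2 -> y1 < 0 < y2 ->
  bcont (fun z : R[i] => z^-1) x1 x2 y1 y2.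
Proof.
move=> /andP[x10 x20] /andP[y10 y20]; apply: bcont_cdiff.
- exact: ltW (lt_trans x10 x20).
- exact: ltW (lt_trans y10 y20).
- move=> x y _ _ H; eexists; apply: cdiff_inv; apply: nz_cplx.
  by case: H => ->; [left|left|right|right]; rewrite ?(lt_eqF x10) ?(gt_eqF x20)
    ?(lt_eqF y10) ?(gt_eqF y20).
Qed.

(** The value is 2 pi i, but a lower bound is enough to divide by. In the imaginary part the
    horizontal sides contribute nonnegatively, so does the left side, and the right side has
    integrand at least [1 / (4 * r)] over a length at least [r]. The position of each side is left
    free within a range, since Fubini's theorem will choose it. *)
Lemma rint_inv_ge r x1 x2 y1 y2 : 0 < r ->
  - r <= x1 <= - (r / 2) -> r / 2 <= x2 <= r ->
  - r <= y1 <= - (r / 2) -> r / 2 <= y2 <= r ->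
  1 / 4 <= cmod (rint (fun z : R[i] => z^-1) x1 x2 y1 y2).
Proof.
move=> r0 hx1 hx2 hy1 hy2.
have x12 : x1 < 0 < x2 by lra.
have y12 : y1 < 0 < y2 by lra.
have [b1 b2 b3 b4] := bcont_inv x12 y12.
have hs (x y : R) : x != 0 -> 0 < x ^+ 2 + y ^+ 2.
  by move=> x0; rewrite ltr_pwDl ?sqr_ge0// exprn_even_gt0.
have hs' (x y : R) : y != 0 -> 0 < x ^+ 2 + y ^+ 2.
  by move=> y0; rewrite ltr_wpDl ?sqr_ge0// exprn_even_gt0.
apply: le_trans (Im_le_cmod _); apply: le_trans (ler_norm _).
rewrite /rint cImD cImM /= mul0r add0r.
rewrite -[leLHS]add0r; apply: lerD.
  apply: Rintegral_ge0 => x _.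
  rewrite [X in 0 <= X](_ : _ = - y1 / (x ^+ 2 + y1 ^+ 2) - - y2 / (x ^+ 2 + y2 ^+ 2)); last first.
    by rewrite !mulNr.
  rewrite subr_ge0; apply: (@le_trans _ _ 0).
    by rewrite mulNr oppr_le0 divr_ge0 ?addr_ge0 ?sqr_ge0//; lra.
  by rewrite divr_ge0 ?addr_ge0 ?sqr_ge0//; lra.
rewrite [leRHS]mul1r.
apply: (@le_trans _ _ (\int[mu]_(t in `[y1, y2]) (1 / (4 * r)))).
  rewrite Rintegral_cst//= lebesgue_measure_itv /= lte_fin.
  have -> : y1 < y2 by lra.
  have E4 : 1 / 4 = (1 / (4 * r)) * r by field; rewrite gt_eqF.
  apply: (@le_trans _ _ ((1 / (4 * r)) * r)); first by rewrite -E4; lra.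
  by rewrite /= ler_wpM2l ?divr_ge0 ?mulr_ge0 ?(ltW r0)//; lra.
apply: le_Rintegral => //.
- by apply: rcont_integrable => t _; exact: cvg_cst.
- exact: (intRe (pcontB b4 b3)).
move=> y; rewrite /= in_itv /= => /andP[h1 h2].
rewrite [leRHS](_ : _ = x2 / (x2 ^+ 2 + y ^+ 2) - x1 / (x1 ^+ 2 + y ^+ 2)) //.
have A : 1 / (4 * r) <= x2 / (x2 ^+ 2 + y ^+ 2).
  have x20 : x2 != 0 by rewrite gt_eqF//; lra.
  rewrite ler_pdivlMr ?hs// mul1r.
  have r4 : 0 < 4 * r by rewrite mulr_gt0.
  rewrite mulrC ler_pdivrMr//.
  have : x2 ^+ 2 <= r ^+ 2 by rewrite ler_sqr ?nnegrE; lra.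
  have : y ^+ 2 <= r ^+ 2 by rewrite -subr_ge0 subr_sqr mulr_ge0//; lra.
  have : r / 2 * (4 * r) <= x2 * (4 * r) by rewrite ler_wpM2r ?(ltW r4)//; lra.
  have -> : r / 2 * (4 * r) = 2 * r ^+ 2 by field.
  lra.
have B : x1 / (x1 ^+ 2 + y ^+ 2) <= 0.
  by rewrite mulr_le0_ge0 ?invr_ge0 ?addr_ge0 ?sqr_ge0//; lra.
lra.
Qed.

(** The difference quotient of [f] at [a], with [a] moved to the origin. It is continuous at 0 and
    holomorphic elsewhere, as [rint_cauchy] asks, and its value at 0 is the derivative to be
    estimated. *)
Definition quot f df a w := if w == 0 then df a else (f (a + w) - f a) / w.

Lemma quot_cdiff f df a w : w != 0 -> cdiff f (a + w) (df (a + w)) ->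
  cdiff (quot f df a) w (df (a + w) / w - quot f df a w / w).
Proof.
move=> w0 dfw.
have w0' : 0 < cmod w by rewrite cmod_gt0.
have H : cdiff (fun w => (f (a + w) - f a) / w) w
   ((df (a + w) + 0) / w + (f (a + w) - f a) * (- w^-1 ^+ 2 * 1)).
  apply: (cdiffM (f := fun w => f (a + w) - f a)).
    by apply: cdiffD; [exact: cdiff_shift|exact: cdiff_cst].
  by apply: cdiffV => //; exact: cdiff_id.
have -> : df (a + w) / w - quot f df a w / w =
  ((df (a + w) + 0) / w + (f (a + w) - f a) * (- w^-1 ^+ 2 * 1)).
  by rewrite /quot (negbTE w0); field.
apply: (cdiff_eq_near w0' H) => z zw; rewrite /quot; case: eqP => // z0.
by move: zw; rewrite z0 sub0r cmodN ltxx.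
Qed.

Lemma quot_cont f df a : cdiff f a (df a) -> {for 0, continuous (quot f df a)}.
Proof.
move=> dfa; apply/ccontP => e e0.
have e2 : 0 < e / 2 by rewrite divr_gt0.
have [D D0 HD] := cdiff_slope dfa e2.
exists D => // w; rewrite subr0 => wD; rewrite /quot eqxx.
have [_|w0] := eqVneq w 0; first by rewrite subrr cmod0.
have := HD (a + w); rewrite -subr_eq0 [a + w - a]addrAC subrr add0r => /(_ w0 wD).
by move=> /le_lt_trans; apply; lra.
Qed.

Lemma inrect_sq a r x1 x2 y1 y2 z : - r <= x1 -> x2 <= r -> - r <= y1 -> y2 <= r ->
  inrect x1 x2 y1 y2 z -> sq a r (a + z).
Proof.
move=> h1 h2 h3 h4 [/andP[h5 h6] /andP[h7 h8]]; rewrite /sq addrAC subrr add0r.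
by split; rewrite ler_norml; apply/andP; split; lra.
Qed.

Lemma quot_cauchy f df a r x1 x2 y1 y2 :
  (forall z, sq a r z -> cdiff f z (df z)) ->
  - r <= x1 -> x2 <= r -> - r <= y1 -> y2 <= r ->
  x1 < 0 < x2 -> y1 < 0 < y2 ->
  rint (fun w => quot f df a w / w) x1 x2 y1 y2 = df a * rint (fun z => z^-1) x1 x2 y1 y2.
Proof.
move=> dF h1 h2 h3 h4 hx hy.
rewrite (@rint_cauchy _ (quot f df a))//; first by rewrite /quot eqxx.
- move=> z zin z0; eexists; apply: quot_cdiff => //.
  by apply: dF; exact: (inrect_sq a h1 h2 h3 h4 zin).
- apply: quot_cont; apply: dF; rewrite /sq subrr /= normr0.
  by case/andP: hx => _ h; split; apply: ltW; apply: lt_le_trans h2.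
Qed.

Lemma bcont_quot f df a r x1 x2 y1 y2 :
  (forall z, sq a r z -> cdiff f z (df z)) ->
  - r <= x1 -> x2 <= r -> - r <= y1 -> y2 <= r ->
  x1 < 0 < x2 -> y1 < 0 < y2 ->
  bcont (quot f df a) x1 x2 y1 y2.
Proof.
move=> dF h1 h2 h3 h4 /andP[x10 x20] /andP[y10 y20].
apply: bcont_cdiff.
- exact: ltW (lt_trans x10 x20).
- exact: ltW (lt_trans y10 y20).
- move=> x y hx hy H; eexists; apply: quot_cdiff.
    apply: nz_cplx.
    by case: H => ->; [left|left|right|right]; rewrite ?(lt_eqF x10) ?(gt_eqF x20)
      ?(lt_eqF y10) ?(gt_eqF y20).
  by apply: dF; apply: (inrect_sq a h1 h2 h3 h4).
Qed.

Lemma cmod_edge r x y : 0 < r -> [\/ x = - r, x = r, y = - r | y = r] -> r <= cmod (x +i* y).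
Proof.
move=> r0 H; have rr : `|r| = r by rewrite gtr0_norm.
by case: H => H; [have := Re_le_cmod (x +i* y)|have := Re_le_cmod (x +i* y)
    |have := Im_le_cmod (x +i* y)|have := Im_le_cmod (x +i* y)]; rewrite /= H ?normrN rr.
Qed.

(** On the boundary of the square [quot f df a w / w] is at most [2 * M / r / r], so its contour
    integral is at most [32 * M / r]; it also equals [df a] times an integral of modulus at least
    1/4. The constant 256 is generous. *)
Lemma cauchy_estimate f df a r M : 0 < r ->
  (forall z, sq a r z -> cdiff f z (df z)) ->
  (forall z, sq a r z -> cmod (f z) <= M) ->
  cmod (df a) <= 256 * M / r.
Proof.
move=> r0 dF fM.
have rN : - r < 0 by rewrite oppr_lt0.
have hr : - r < 0 < r by rewrite rN r0.
have rr : - r <= r by apply: ltW; exact: lt_trans rN r0.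
have M0 : 0 <= M.
  apply: le_trans (fM a _); first exact: cmod_ge0.
  by rewrite /sq subrr /= normr0 (ltW r0).
have E := quot_cauchy dF (lexx _) (lexx _) (lexx _) (lexx _) hr hr.
have bq := bcont_quot dF (lexx _) (lexx _) (lexx _) (lexx _) hr hr.
have H1 : 1 / 4 <= cmod (rint (fun z : R[i] => z^-1) (- r) r (- r) r).
  by apply: (@rint_inv_ge r) => //; lra.
have H2 : cmod (rint (fun w => quot f df a w / w) (- r) r (- r) r) <=
    4 * (2 * M / r / r) * ((r - - r) + (r - - r)).
  apply: (rint_bound rr rr (bcontM bq (bcont_inv hr hr))).
  move=> x y hx hy H; have rw := cmod_edge r0 H.
  have w0 : x +i* y != 0 by rewrite -cmod_gt0; exact: lt_le_trans rw.
  have r0' : 0 < cmod (x +i* y) by rewrite cmod_gt0.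
  have i1 : 0 <= (cmod (x +i* y))^-1 by rewrite invr_ge0 cmod_ge0.
  have i2 : (cmod (x +i* y))^-1 <= r^-1 by rewrite lef_pV2// ?posrE.
  rewrite /quot (negbTE w0) !cmodf.
  apply: ler_pM => //; first by rewrite divr_ge0 ?cmod_ge0.
  apply: ler_pM => //; first exact: cmod_ge0.
  apply: le_trans (cmodD _ _) _; rewrite cmodN.
  have -> : 2 * M = M + M by ring.
  apply: lerD; apply: fM.
    by apply: (@inrect_sq a r (- r) r (- r) r).
  by rewrite /sq subrr /= normr0 (ltW r0).
have : cmod (df a) * (1 / 4) <= 64 / 2 * M / r * 1.
  apply: (@le_trans _ _ (cmod (df a * rint (fun z : R[i] => z^-1) (- r) r (- r) r))).
    by rewrite cmodM ler_wpM2l ?cmod_ge0.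
  rewrite -E; apply: le_trans H2 _.
  by rewrite le_eqVlt; apply/orP; left; apply/eqP; field; rewrite gt_eqF.
have -> : 256 * M / r = 8 * (64 / 2 * M / r) by field; rewrite gt_eqF.
have : 0 <= 64 / 2 * M / r by rewrite divr_ge0 ?mulr_ge0// ltW.
lra.
Qed.

Lemma segment_lip f df a w K : (forall t, 0 <= t <= 1 -> cdiff f (a + w * t%:C) (df (a + w * t%:C))) ->
  (forall t, 0 <= t <= 1 -> cmod (df (a + w * t%:C)) <= K) ->
  cmod (f (a + w) - f a) <= K * cmod w.
Proof.
move=> H HK.
have := @rdiff_le _ (fun t => f (a + w * t%:C)) (fun t => df (a + w * t%:C) * w)
  (fun t => K * cmod w * t) (fun=> K * cmod w) 0 1 ler01.
rewrite mulr1 !mulr0 addr0 mulr1 subr0; apply.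
- by move=> t /H; exact: cdiff_rdiff.
- move=> t _; have := @is_deriveZ _ _ _ id (K * cmod w) t 1 1 (is_derive_id _ _).
  by rewrite /= -[_ *: 1]/(_ * 1) mulr1.
- by move=> t /HK h; rewrite cmodM ler_wpM2r ?cmod_ge0.
Qed.

Lemma sq_trans a z w r r' : sq a r z -> sq z r' w -> sq a (r + r') w.
Proof.
move=> [h1 h2] [h3 h4].
rewrite /sq; have -> : w - a = (z - a) + (w - z) by ring.
split.
  rewrite cReD; apply: le_trans (ler_normD _ _) _.
  exact: lerD.
by rewrite cImD; apply: le_trans (ler_normD _ _) _; apply: lerD.
Qed.

Lemma sq_seg a r z w t : 0 <= t <= 1 -> sq a r z -> sq a r w -> sq a r (z + (w - z) * t%:C).
Proof.
move=> /andP[t0 t1]; rewrite /sq !(cReD, cReN, cReM, cImD, cImN, cImM) /= !ler_norml.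
move=> [/andP[h1 h2] /andP[h3 h4]] [/andP[h5 h6] /andP[h7 h8]].
by split; apply/andP; split; nra.
Qed.

Lemma sq_le a r r' z : r <= r' -> sq a r z -> sq a r' z.
Proof. by move=> h [h1 h2]; split; apply: le_trans h. Qed.

Lemma cmod_sq a r z : cmod (z - a) <= r -> sq a r z.
Proof. by move=> h; split; apply: le_trans h; [exact: Re_le_cmod|exact: Im_le_cmod]. Qed.

Lemma sq_cmod a r z : sq a r z -> cmod (z - a) <= 2 * r.
Proof.
move=> [h1 h2]; apply: le_trans (cmod_le_ReIm _) _.
by rewrite mulr_natl mulr2n lerD.
Qed.

(** By continuity [f] is bounded near [a]; hence [cauchy_estimate] bounds [df] there and [f] is
    Lipschitz. Cauchy's formula on congruent squares about [a] and [b] expresses [df b - df a]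
    through the integrand [((f (b + w) - f (a + w)) - (f b - f a)) / w / w], which is O(|b - a|) on
    the contour. *)
Lemma derivative_cont f df a r : 0 < r -> (forall z, sq a r z -> cdiff f z (df z)) ->
  {for a, continuous df}.
Proof.
move=> r0 dF.
have [|D D0 HD] := (ccontP f a).1 _ 1 ltr01.
  by apply: cdiff_cont (dF a _); rewrite /sq subrr /= normr0 (ltW r0).
(* Three radii [s] are spent: one from [a] to [b], one for the contour about [b], one for Cauchy's
   estimate at the points reached. *)
pose s := Num.min r (D / 4) / 3.
have s0 : 0 < s by rewrite divr_gt0// lt_min r0 divr_gt0.
have s3 : 3 * s = Num.min r (D / 4) by rewrite /s mulrC divfK.
have sr : 3 * s <= r by rewrite s3 ge_min lexx.
have sD : 3 * s <= D / 4 by rewrite s3 ge_min lexx orbT.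
have fM z : sq a (3 * s) z -> cmod (f z) <= cmod (f a) + 1.
  move=> /sq_cmod h; have : cmod (f z - f a) < 1 by apply: HD; apply: le_lt_trans h _; lra.
  by have := cmodD (f z - f a) (f a); rewrite subrK; lra.
have E3 : 3 * s = 2 * s + s by ring.
have E2 : 2 * s = s + s by ring.
pose L := 256 * (cmod (f a) + 1) / s.
have L0 : 0 <= L by rewrite divr_ge0 ?(ltW s0)// mulr_ge0// addr_ge0// cmod_ge0.
have dL z : sq a (2 * s) z -> cmod (df z) <= L.
  move=> az; apply: (cauchy_estimate s0) => w zw.
    by apply: dF; apply: (sq_le sr); rewrite E3; apply: sq_trans zw.
  by apply: fM; rewrite E3; apply: sq_trans zw.
have lip z w : sq a (2 * s) z -> sq a (2 * s) w -> cmod (f w - f z) <= L * cmod (w - z).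
  move=> az aw.
  have := @segment_lip f df z (w - z) L; rewrite [z + _]addrC subrK; apply=> t t01.
    by apply: dF; apply: (@sq_le _ (2 * s)); [lra|exact: sq_seg].
  by apply: dL; exact: sq_seg.
have sN : - s < 0 < s by rewrite oppr_lt0 s0.
have ss : - s <= s by lra.
have ab (b : R[i]) : sq a s b -> forall z, sq b s z -> sq a (2 * s) z.
  by move=> ab z bz; rewrite E2; apply: sq_trans bz.
have aa : sq a s a by rewrite /sq subrr /= normr0 (ltW s0).
have dFb (b : R[i]) : sq a s b -> forall z, sq b s z -> cdiff f z (df z).
  by move=> /ab h z /h h'; apply: dF; apply: sq_le h'; lra.
pose I := rint (fun z : R[i] => z^-1) (- s) s (- s) s.
have I4 : 1 / 4 <= cmod I by apply: (@rint_inv_ge s) => //; lra.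
have key (b : R[i]) : sq a s b -> cmod (df b - df a) <= 256 * L / s * cmod (b - a).
  move=> sb.
  have Ea := quot_cauchy (dFb _ aa) (lexx _) (lexx _) (lexx _) (lexx _) sN sN.
  have Eb := quot_cauchy (dFb _ sb) (lexx _) (lexx _) (lexx _) (lexx _) sN sN.
  have bqa := bcont_quot (dFb _ aa) (lexx _) (lexx _) (lexx _) (lexx _) sN sN.
  have bqb := bcont_quot (dFb _ sb) (lexx _) (lexx _) (lexx _) (lexx _) sN sN.
  have bi := bcont_inv sN sN.
  have b1 := bcontM bqa bi; have b2 := bcontM bqb bi.
  have bN := bcontM (bcont_cst (-1) (- s) s (- s) s) b1.
  have E : (df b - df a) * I =
      rint (fun w => quot f df b w / w + -1 * (quot f df a w / w)) (- s) s (- s) s.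
    by rewrite (rintD b2 bN) (rintZ _ b1) Ea Eb -/I; ring.
  have B : cmod ((df b - df a) * I) <=
      4 * (2 * L * cmod (b - a) / s / s) * ((s - - s) + (s - - s)).
    rewrite E; apply: (rint_bound ss ss (bcontD b2 bN)).
    move=> x y hx hy H; have rw := cmod_edge s0 H.
    set w := x +i* y in rw *.
    have w0 : w != 0 by rewrite -cmod_gt0; exact: lt_le_trans rw.
    have w0' : 0 < cmod w by rewrite cmod_gt0.
    have i1 : 0 <= (cmod w)^-1 by rewrite invr_ge0 cmod_ge0.
    have i2 : (cmod w)^-1 <= s^-1 by rewrite lef_pV2// ?posrE.
    have win z : sq z s (z + w) by apply: (@inrect_sq z s (- s) s (- s) s).
    rewrite /quot (negbTE w0).
    have -> : (f (b + w) - f b) / w / w + -1 * ((f (a + w) - f a) / w / w) =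
       ((f (b + w) - f (a + w)) - (f b - f a)) / w / w by field.
    rewrite !cmodf.
    apply: ler_pM => //; first by rewrite divr_ge0 ?cmod_ge0.
    apply: ler_pM => //; first exact: cmod_ge0.
    apply: le_trans (cmodD _ _) _; rewrite cmodN.
    have -> : 2 * L * cmod (b - a) = L * cmod (b - a) + L * cmod (b - a) by ring.
    apply: lerD.
      have -> : b - a = (b + w) - (a + w) by ring.
      by apply: lip; [exact: ab aa _ (win a)|exact: ab sb _ (win b)].
    by apply: lip; [apply: sq_le aa|apply: sq_le sb]; lra.
  move: B; rewrite cmodM => B.
  have : cmod (df b - df a) * (1 / 4) <= 32 * L / s * cmod (b - a).
    apply: (@le_trans _ _ (cmod (df b - df a) * cmod I)).
      by rewrite ler_wpM2l ?cmod_ge0.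
    apply: le_trans B _.
    by rewrite le_eqVlt; apply/orP; left; apply/eqP; field; rewrite gt_eqF.
  have : 0 <= 32 * L / s * cmod (b - a).
    by rewrite mulr_ge0 ?cmod_ge0// divr_ge0 ?(ltW s0)// mulr_ge0.
  have -> : 256 * L / s * cmod (b - a) = 8 * (32 * L / s * cmod (b - a)) by field; rewrite gt_eqF.
  lra.
apply/ccontP => e e0.
pose K := 256 * L / s + 1.
have K0 : 0 < K by rewrite ltr_pwDr// divr_ge0 ?(ltW s0)// mulr_ge0.
exists (Num.min s (e / K)); first by rewrite lt_min s0 divr_gt0.
move=> b; rewrite lt_min => /andP[bs].
rewrite ltr_pdivlMr// => h; apply: le_lt_trans h.
apply: le_trans (key b _) _; first exact/cmod_sq/ltW.
by rewrite mulrC ler_wpM2l ?cmod_ge0// /K lerDl.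
Qed.

End CauchyEstimates.

(** * Area integrals *)

Section NonnegIntegral.
Local Open Scope ereal_scope.
Context d (T : measurableType d) (R : realType) (mu : {measure set T -> \bar R}).

(* Unlike [ge0_le_integral], no measurability: the integral of a nonnegative
   function is a supremum over simple functions below it. *)
Lemma integral_mono (D : set T) (f g : T -> \bar R) :
  (forall x, D x -> 0 <= f x) -> (forall x, D x -> f x <= g x) ->
  \int[mu]_(x in D) f x <= \int[mu]_(x in D) g x.
Proof.
move=> f0 fg; rewrite [leLHS]integral_mkcond [leRHS]integral_mkcond.
have f0' x : 0 <= (f \_ D) x by apply: erestrict_ge0.
have fg' x : (f \_ D) x <= (g \_ D) x.
  by rewrite /patch; case: ifPn => // /set_mem; exact: fg.
have g0' x : 0 <= (g \_ D) x by exact: le_trans (fg' x).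
rewrite !ge0_integralTE//; apply: le_ereal_sup => _ [h hf <-].
by exists h => // x; apply: le_trans (hf x) (fg' x).
Qed.

Lemma integral_mono_set (D E : set T) (f : T -> \bar R) : D `<=` E ->
  (forall x, E x -> 0 <= f x) ->
  \int[mu]_(x in D) f x <= \int[mu]_(x in E) f x.
Proof.
move=> DE f0; rewrite [leLHS]integral_mkcond [leRHS]integral_mkcond.
apply: integral_mono => x _; first by apply: erestrict_ge0 => y /DE; exact: f0.
rewrite /patch; case: ifPn => [/set_mem Dx|_]; first by rewrite mem_set//; exact: DE.
by case: ifPn => // /set_mem; exact: f0.
Qed.

End NonnegIntegral.

(** * Boxes, measurability and Tonelli's theorem in the plane *)

Section PlaneMeasure.
Variable R : realType.
Notation RR := (measurableTypeR R * measurableTypeR R)%type.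
Implicit Types (w : RR) (D : set RR).
Notation mu := (@lebesgue_measure R).
Notation mu2 := (@lebesgue_measure R \x @lebesgue_measure R)%E.

Definition box (p : R * R) (r : R) : set RR :=
  `[p.1 - r, p.1 + r]%classic `*` `[p.2 - r, p.2 + r]%classic.

Lemma boxE p r w : box p r w <-> `|w.1 - p.1| <= r /\ `|w.2 - p.2| <= r.
Proof.
rewrite /box /setX /= !in_itv /= !ler_distl.
by split=> [[]|[]].
Qed.

Lemma measurable_box p r : measurable (box p r).
Proof. by apply: measurableX; exact: measurable_itv. Qed.

Lemma measure_box p r : 0 <= r -> mu2 (box p r) = (4 * r ^+ 2)%:E.
Proof.
move=> r0; rewrite /box product_measure1E; [|exact: measurable_itv|exact: measurable_itv].
have E (x : R) : mu `[x - r, x + r]%classic = (2 * r)%:E.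
  rewrite lebesgue_measure_itv /= lte_fin; case: ltP => h.
    by rewrite -EFinB; congr (_%:E); ring.
  have -> : r = 0 by lra.
  by rewrite mulr0.
rewrite [X in (X * _)%E](E p.1) [X in (_ * X)%E](E p.2) -EFinM; congr (_%:E); ring.
Qed.

(** The set where [h] exceeds [c] is the trace on [D] of the boxes with rational centre and radius
    [k.+1%:R^-1] on whose trace [h > c]. There are countably many, and each is a product of
    intervals, so it belongs to the product sigma-algebra. *)
Lemma measurable_continuous_plane D (h : RR -> R) : measurable D ->
  (forall w e, D w -> 0 < e -> exists2 d, 0 < d & forall w', D w' ->
    `|w'.1 - w.1| <= d -> `|w'.2 - w.2| <= d -> `|h w' - h w| < e) ->
  measurable_fun D h.
Proof.
move=> mD ch; move=> _; apply: (measurability _ (RGenOInfty.measurableE R)) => //.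
move=> /= _ [_ [c ->] <-].
pose S (t : rat * rat * nat) := box (ratr t.1.1, ratr t.1.2) (t.2.+1%:R^-1).
pose F n : set RR := if unpickle n is Some t then
  (if `[< forall w, D w -> S t w -> c < h w >] then S t else set0) else set0.
have -> : D `&` h @^-1` `]c, +oo[%classic = D `&` \bigcup_n F n.
  apply/seteqP; split=> [w [Dw]|w [Dw [n _]]]; last first.
    rewrite /F; case: unpickle => // t; case: asboolP => // H Sw.
    by split=> //=; rewrite in_itv /= andbT; exact: H.
  rewrite /= in_itv /= andbT => cw; split=> //.
  have e0 : 0 < h w - c by rewrite subr_gt0.
  have [d d0 Hd] := ch w _ Dw e0.
  have [k Hk] : exists k, k.+1%:R^-1 < d / 2 :> R.
    have d2 : 0 <= (d / 2)^-1 by rewrite invr_ge0 divr_ge0// ltW.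
    have /archi_boundP H := d2; exists (Num.bound (d / 2)^-1).
    rewrite -[ltRHS]invrK ltf_pV2 ?posrE ?invr_gt0 ?divr_gt0//.
    by apply: lt_le_trans H _; rewrite ler_nat.
  set rho : R := k.+1%:R^-1 in Hk.
  have rho0 : 0 < rho by rewrite invr_gt0.
  have rat_near (x : R) : exists q : rat, `|x - ratr q| <= rho.
    have /rat_in_itvoo[q] : x - rho < x + rho by rewrite ltrD2l gtrN.
    by rewrite in_itv /= => /andP[h1 h2]; exists q; rewrite ler_distl; apply/andP; split; lra.
  have [q1 Hq1] := rat_near w.1; have [q2 Hq2] := rat_near w.2.
  pose t := (q1, q2, k).
  exists (pickle t); [exact: I|rewrite /F pickleK].
  have Sw : S t w by apply/boxE.
  case: asboolP => // -[] w' Dw' /boxE/=[h1 h2].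
  have : `|h w' - h w| < h w - c.
    apply: Hd => //.
      have -> : w'.1 - w.1 = (w'.1 - ratr q1) + (ratr q1 - w.1) by ring.
      by apply: le_trans (ler_normD _ _) _; rewrite [`|ratr q1 - _|]distrC; rewrite -/rho in h1; lra.
    have -> : w'.2 - w.2 = (w'.2 - ratr q2) + (ratr q2 - w.2) by ring.
    by apply: le_trans (ler_normD _ _) _; rewrite [`|ratr q2 - _|]distrC; rewrite -/rho in h2; lra.
  by rewrite ltr_norml => /andP[]; lra.
apply: measurableI => //; apply: bigcupT_measurable => n; rewrite /F.
by case: unpickle => // t; case: asboolP => // _; exact: measurable_box.
Qed.

Local Open Scope ereal_scope.

(** Chebyshev's inequality for slices: if all slices between [u] and [v] had integral at least [m],
    Tonelli's theorem would give a total of at least [m * (v - u)]. *)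
Lemma tonelli_good1 (H : RR -> \bar R) (A m u v : R) :
  measurable_fun setT H -> (forall w, 0 <= H w) -> (u <= v)%R -> (0 <= m)%R ->
  \int[mu2]_w H w <= A%:E -> (A < m * (v - u))%R ->
  exists2 x, (u <= x <= v)%R & \int[mu]_y H (x, y) < m%:E.
Proof.
move=> mH H0 uv m0 HA Am; apply: contrapT => nex.
have : (m * (v - u))%:E <= A%:E.
  apply: le_trans HA; rewrite fubini_tonelli1//.
  apply: (@le_trans _ _ (\int[mu]_(x in `[u, v]) (fubini_F mu H x))); last first.
    apply: integral_mono_set => // x _; exact: integral_ge0.
  apply: (@le_trans _ _ (\int[mu]_(x in `[u, v]) (cst m%:E x))).
    rewrite integral_cst//= lebesgue_measure_itv /= lte_fin.
    case: ltP => h; first by rewrite -EFinB -EFinM.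
    have -> : v = u by lra.
    by rewrite subrr mulr0 mule0.
  apply: integral_mono => x /=; rewrite in_itv /= => uxv; first by rewrite lee_fin.
  by rewrite leNgt; apply/negP => hx; apply: nex; exists x.
by rewrite lee_fin leNgt Am.
Qed.

Lemma tonelli_good2 (H : RR -> \bar R) (A m u v : R) :
  measurable_fun setT H -> (forall w, 0 <= H w) -> (u <= v)%R -> (0 <= m)%R ->
  \int[mu2]_w H w <= A%:E -> (A < m * (v - u))%R ->
  exists2 y, (u <= y <= v)%R & \int[mu]_x H (x, y) < m%:E.
Proof.
move=> mH H0 uv m0 HA Am; apply: contrapT => nex.
have : (m * (v - u))%:E <= A%:E.
  apply: le_trans HA; rewrite fubini_tonelli2//.
  apply: (@le_trans _ _ (\int[mu]_(x in `[u, v]) (fubini_G mu H x))); last first.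
    apply: integral_mono_set => // x _; exact: integral_ge0.
  apply: (@le_trans _ _ (\int[mu]_(x in `[u, v]) (cst m%:E x))).
    rewrite integral_cst//= lebesgue_measure_itv /= lte_fin.
    case: ltP => h; first by rewrite -EFinB -EFinM.
    have -> : v = u by lra.
    by rewrite subrr mulr0 mule0.
  apply: integral_mono => x /=; rewrite in_itv /= => uxv; first by rewrite lee_fin.
  by rewrite leNgt; apply/negP => hx; apply: nex; exists x.
by rewrite lee_fin leNgt Am.
Qed.

Lemma box_majorant (p : nat -> R * R) (r c : nat -> R) :
  (forall k, 0 <= r k)%R -> (forall k, 0 <= c k)%R ->
  exists S : RR -> \bar R, [/\ measurable_fun setT S, (forall w, 0 <= S w),
    \int[mu2]_w S w = \sum_(0 <= k <oo) (c k * (4 * r k ^+ 2))%:E &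
    forall k w, box (p k) (r k) w -> (c k)%:E <= S w].
Proof.
move=> r0 c0.
pose f k w : \bar R := (c k)%:E * (\1_(box (p k) (r k)) w)%:E.
have f0 k w : 0 <= f k w by rewrite mule_ge0 ?lee_fin.
have mf k : measurable_fun setT (f k).
  apply: measurable_funeM; apply/measurable_EFinP/measurable_indic; exact: measurable_box.
exists (fun w => \sum_(0 <= k <oo) f k w); split.
- by apply: ge0_emeasurable_sum => // k w _ _; exact: f0.
- by move=> w; apply: nneseries_ge0.
- rewrite integral_nneseries//.
  apply: eq_eseriesr => k _ /=.
  have mi : measurable_fun setT (fun w : RR => (\1_(box (p k) (r k)) w)%:E : \bar R).
    by apply/measurable_EFinP/measurable_indic; exact: measurable_box.
  have i0 (w : RR) : setT w -> 0 <= (\1_(box (p k) (r k)) w)%:E :> \bar R.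
    by move=> _; rewrite lee_fin.
  rewrite (ge0_integralZl _ measurableT mi i0) ?lee_fin//.
  rewrite integral_indic//; last exact: measurable_box.
  by rewrite setIT [X in (_ * X)%E](measure_box (p k) (r0 k)) EFinM.
- move=> k w bk.
  have -> : (c k)%:E = f k w by rewrite /f indicE mem_set// mule1.
  rewrite (@nneseriesD1 _ (fun k => f k w) k xpredT)//.
  by rewrite leeDl// nneseries_ge0.
Qed.

End PlaneMeasure.

(** * A pointwise bound on a derivative by its area integral *)

Section AreaBound.
Variable R : realType.
Implicit Types (f df g dg : R[i] -> R[i]) (x y b c d t r : R) (a z w : R[i]).
Notation mu := (@lebesgue_measure R).
Notation mu2 := (@lebesgue_measure R \x @lebesgue_measure R)%E.
Notation RR := (measurableTypeR R * measurableTypeR R)%type.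

(** The fundamental theorem of calculus on each side; the corner values cancel. Differentiability is
    asked on the boundary only, since the primitive to which this is applied is a difference
    quotient, known to be merely continuous at 0. *)
Lemma rint_deriv g dg x1 x2 y1 y2 : x1 <= x2 -> y1 <= y2 -> bcont dg x1 x2 y1 y2 ->
  (forall x y, x1 <= x <= x2 -> y1 <= y <= y2 ->
    [\/ x = x1, x = x2, y = y1 | y = y2] -> cdiff g (x +i* y) (dg (x +i* y))) ->
  rint dg x1 x2 y1 y2 = 0.
Proof.
move=> x12 y12 [b1 b2 b3 b4] H.
have Hh y : y = y1 \/ y = y2 -> hcont dg x1 x2 y ->
    cint x1 x2 (fun x => dg (x +i* y)) = g (x2 +i* y) - g (x1 +i* y).
  move=> hy ch; apply: (@cFTC _ _ _ (fun x => g (x +i* y))) => // t tx.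
  have -> : (fun x => g (x +i* y)) = (fun x : R => g ((0 +i* y) + 1 * x%:C)).
    by apply/funext => x; rewrite -hlineE.
  rewrite -[dg _]mulr1; apply: cdiff_rdiff; rewrite -hlineE; apply: H => //.
    by case: hy => ->; rewrite lexx ?y12.
  by case: hy => ->; [exact: Or43|exact: Or44].
have Hv x : x = x1 \/ x = x2 -> vcont dg x y1 y2 ->
    (0 +i* 1) * cint y1 y2 (fun y => dg (x +i* y)) = g (x +i* y2) - g (x +i* y1).
  move=> hx ch; rewrite -(cintZ _ ch).
  apply: (@cFTC _ y1 y2 (fun y => g (x +i* y)) (fun y => (0 +i* 1) * dg (x +i* y)) y12).
    by move=> t ty; apply: cvgM; [exact: cvg_cst|exact: ch].
  move=> t tx.
  have -> : (fun y => g (x +i* y)) = (fun y : R => g (x%:C + (0 +i* 1) * y%:C)).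
    by apply/funext => y; rewrite -vlineE.
  rewrite mulrC; apply: cdiff_rdiff; rewrite -vlineE; apply: H => //.
    by case: hx => ->; rewrite lexx ?x12.
  by case: hx => ->; [exact: Or41|exact: Or42].
rewrite /rint (cintB b1 b2) (cintB b4 b3) mulrBr.
rewrite (Hh y1)//; last by left.
rewrite (Hh y2)//; last by right.
rewrite (Hv x1)//; last by left.
rewrite (Hv x2)//; last by right.
by ring.
Qed.

Lemma Rint_shift k b c (g : R -> R) : b <= c ->
  (forall t, k + b <= t <= k + c -> {for t, continuous g}) ->
  (\int[mu]_(t in `[k + b, k + c]) g t = \int[mu]_(t in `[b, c]) g (k + t)%R)%R.
Proof.
move=> bc cg; rewrite /Rintegral; congr fine.
pose F (t : R) := k + t.
have dF (t : R) : is_derive t 1 F 1.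
  rewrite -[X in is_derive _ _ _ X]add0r.
  apply: (@is_deriveD _ _ _ (cst k) id t 1 0 1).
have F' : derive1 F = cst 1 by apply/funext => t; rewrite derive1E; case: (dF t).
have cF (t : R) : {for t, continuous F}.
  by have [+ _] := dF t => /derivable1_diffP/differentiable_continuous.
rewrite (@integration_by_substitution_increasing _ F g b c)//.
- by apply: eq_integral => t _; rewrite F' /= mulr1.
- by move=> s t _ _; rewrite ltrD2l.
- by move=> t _; rewrite F'; exact: cst_continuous.
- by rewrite F'; exact: is_cvg_cst.
- by rewrite F'; exact: is_cvg_cst.
- split; first by move=> t _; have [] := dF t.
  + by apply: cvg_at_right_filter; exact: cF.
  + by apply: cvg_at_left_filter; exact: cF.
- by apply: continuous_in_subspaceT => t; rewrite inE /= in_itv /=; exact: cg.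
Qed.

Lemma Rint_subitv b c b' c' (g : R -> R) : b' <= b -> c <= c' ->
  (forall t, b' <= t <= c' -> {for t, continuous g}) -> (forall t, 0 <= g t) ->
  (\int[mu]_(t in `[b, c]) g t <= \int[mu]_(t in `[b', c']) g t)%R.
Proof.
move=> bb cc cg g0.
have gi := rcont_integrable cg.
have sub : `[b, c]%classic `<=` `[b', c']%classic.
  by move=> t /=; rewrite !in_itv /= => /andP[h1 h2]; apply/andP; split; lra.
have gi' : mu.-integrable `[b, c] (EFin \o g) by apply: integrableS gi.
rewrite /Rintegral fine_le//; first exact: integrable_fin_num.
  exact: integrable_fin_num.
apply: (@integral_mono_set _ _ R mu _ _ (fun t => (g t)%:E)) => // x _.
by rewrite lee_fin.
Qed.

(** On this side [1 / w] has modulus at most [2 / r], and [cint_bound_int] adds a factor 2. The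
    integral is extended to the whole width of the square, so that the bound depends on the height
    of the side only. *)
Lemma cint_side_h df a r x1 x2 y1 : 0 < r -> - r <= x1 -> x1 <= x2 -> x2 <= r ->
  r / 2 <= `|y1| <= r ->
  (forall z, sq a r z -> {for z, continuous df}) ->
  cmod (cint x1 x2 (fun x => df (a + (x +i* y1)) / (x +i* y1))) <=
    4 / r * (\int[mu]_(t in `[(complex.Re a - r)%R, (complex.Re a + r)%R])
       cmod (df (t +i* (complex.Im a + y1)))%R).
Proof.
move=> r0 h1 h2 h3 /andP[h4 h5] cdf.
have E (t : R) : a + (t +i* y1) = (complex.Re a + t) +i* (complex.Im a + y1).
  by apply: cplxP => /=; rewrite ?cReD ?cImD.
have y0 : y1 != 0 by rewrite -normr_gt0; lra.
have nz t : t +i* y1 != 0 by apply: nz_cplx; right.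
have cG (t : R) : complex.Re a - r <= t <= complex.Re a + r ->
   {for t, continuous (fun t => df (t +i* (complex.Im a + y1)))}.
  move=> ht; apply: cont_hline; apply: cdf; split.
    by rewrite cReD cReN /= ler_distl.
  by rewrite cImD cImN /= addrAC subrr add0r.
have cG2 : forall t, complex.Re a - r <= t <= complex.Re a + r ->
   {for t, continuous (fun t => cmod (df (t +i* (complex.Im a + y1))))}.
  by move=> t /cG /cont_cmod.
have c1 : pcont x1 x2 (fun x => df (a + (x +i* y1))).
  move=> t /andP[t1 t2].
  have -> : (fun x => df (a + (x +i* y1))) =
    (fun x : R => df ((a + (0 +i* y1)) + 1 * x%:C)).
    by apply/funext => x; rewrite -addrA -hlineE.
  apply: (@continuous_comp _ _ _ (fun s : R => a + (0 +i* y1) + 1 * s%:C) df).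
    exact: pcont_affine.
  rewrite -addrA -hlineE; apply: cdf.
  rewrite /sq addrAC subrr add0r /=; split => //.
  by rewrite ler_norml; apply/andP; split; lra.
have c2 : pcont x1 x2 (fun x => (x +i* y1)^-1).
  by move=> t _; apply: (@cont_hline _ (fun z => z^-1)); apply: cdiff_cont (cdiff_inv _).
apply: le_trans (cint_bound_int h2 (pcontM c1 c2)) _.
have E4 : 4 / r = 2 * (2 / r) by field; rewrite gt_eqF.
rewrite E4 -mulrA ler_wpM2l//.
apply: (@le_trans _ _ (\int[mu]_(t in `[x1, x2]) (2 / r * cmod (df (a + (t +i* y1)))))).
  apply: le_Rintegral => //.
  - by apply: rcont_integrable => t ht; apply: cont_cmod; exact: (pcontM c1 c2).
  - by apply: rcont_integrable => t ht; apply: cvgMr; apply: cont_cmod; exact: c1.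
  move=> t _; rewrite cmodf mulrC ler_wpM2r ?cmod_ge0//.
  rewrite -[leRHS]invrK invf_div lef_pV2 ?posrE ?cmod_gt0//; last by rewrite divr_gt0.
  by apply: le_trans h4 _; exact: (Im_le_cmod (t +i* y1)).
rewrite RintegralZl//; last by apply: rcont_integrable => t ht; apply: cont_cmod; exact: c1.
rewrite ler_wpM2l ?divr_ge0 ?(ltW r0)//.
under eq_Rintegral do rewrite E.
rewrite -(@Rint_shift (complex.Re a) x1 x2 (fun t => cmod (df (t +i* (complex.Im a + y1)))))//.
  by apply: Rint_subitv => //; [lra|lra|by move=> t; exact: cmod_ge0].
by move=> t /andP[t1 t2]; apply: cG2; lra.
Qed.

Lemma cint_side_v df a r y1 y2 x1 : 0 < r -> - r <= y1 -> y1 <= y2 -> y2 <= r ->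
  r / 2 <= `|x1| <= r ->
  (forall z, sq a r z -> {for z, continuous df}) ->
  cmod (cint y1 y2 (fun y => df (a + (x1 +i* y)) / (x1 +i* y))) <=
    4 / r * (\int[mu]_(t in `[(complex.Im a - r)%R, (complex.Im a + r)%R])
       cmod (df ((complex.Re a + x1) +i* t))%R).
Proof.
move=> r0 h1 h2 h3 /andP[h4 h5] cdf.
have E (t : R) : a + (x1 +i* t) = (complex.Re a + x1) +i* (complex.Im a + t).
  by apply: cplxP => /=; rewrite ?cReD ?cImD.
have x0 : x1 != 0 by rewrite -normr_gt0; lra.
have nz t : x1 +i* t != 0 by apply: nz_cplx; left.
have cG (t : R) : complex.Im a - r <= t <= complex.Im a + r ->
   {for t, continuous (fun t => df ((complex.Re a + x1) +i* t))}.
  move=> ht; apply: cont_vline; apply: cdf; split.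
    by rewrite cReD cReN /= addrAC subrr add0r.
  by rewrite cImD cImN /= ler_distl.
have cG2 : forall t, complex.Im a - r <= t <= complex.Im a + r ->
   {for t, continuous (fun t => cmod (df ((complex.Re a + x1) +i* t)))}.
  by move=> t /cG /cont_cmod.
have c1 : pcont y1 y2 (fun y => df (a + (x1 +i* y))).
  move=> t /andP[t1 t2].
  have -> : (fun y => df (a + (x1 +i* y))) =
    (fun y : R => df ((a + x1%:C) + (0 +i* 1) * y%:C)).
    by apply/funext => y; rewrite -addrA -vlineE.
  apply: (@continuous_comp _ _ _ (fun s : R => a + x1%:C + (0 +i* 1) * s%:C) df).
    exact: pcont_affine.
  rewrite -addrA -vlineE; apply: cdf.
  rewrite /sq addrAC subrr add0r /=; split => //.
  by rewrite ler_norml; apply/andP; split; lra.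
have c2 : pcont y1 y2 (fun y => (x1 +i* y)^-1).
  by move=> t _; apply: (@cont_vline _ (fun z => z^-1)); apply: cdiff_cont (cdiff_inv _).
apply: le_trans (cint_bound_int h2 (pcontM c1 c2)) _.
have E4 : 4 / r = 2 * (2 / r) by field; rewrite gt_eqF.
rewrite E4 -mulrA ler_wpM2l//.
apply: (@le_trans _ _ (\int[mu]_(t in `[y1, y2]) (2 / r * cmod (df (a + (x1 +i* t)))))).
  apply: le_Rintegral => //.
  - by apply: rcont_integrable => t ht; apply: cont_cmod; exact: (pcontM c1 c2).
  - by apply: rcont_integrable => t ht; apply: cvgMr; apply: cont_cmod; exact: c1.
  move=> t _; rewrite cmodf mulrC ler_wpM2r ?cmod_ge0//.
  rewrite -[leRHS]invrK invf_div lef_pV2 ?posrE ?cmod_gt0//; last by rewrite divr_gt0.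
  by apply: le_trans h4 _; exact: (Re_le_cmod (x1 +i* t)).
rewrite RintegralZl//; last by apply: rcont_integrable => t ht; apply: cont_cmod; exact: c1.
rewrite ler_wpM2l ?divr_ge0 ?(ltW r0)//.
under eq_Rintegral do rewrite E.
rewrite -(@Rint_shift (complex.Im a) y1 y2 (fun t => cmod (df ((complex.Re a + x1) +i* t))))//.
  by apply: Rint_subitv => //; [lra|lra|by move=> t; exact: cmod_ge0].
by move=> t /andP[t1 t2]; apply: cG2; lra.
Qed.

Lemma measurable_cont_cplx (h : R[i] -> R) (D : set RR) : measurable D ->
  (forall w : RR, D w -> forall e, 0 < e -> exists2 d, 0 < d & forall z,
    cmod (z - (w.1 +i* w.2)) < d -> `|h z - h (w.1 +i* w.2)| < e) ->
  measurable_fun D (fun w : RR => h (w.1 +i* w.2)).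
Proof.
move=> mD ch; apply: measurable_continuous_plane => // w e Dw e0.
have [d d0 Hd] := ch w Dw e e0; exists (d / 3); first by rewrite divr_gt0.
move=> w' _ h1 h2; apply: Hd; apply: le_lt_trans (cmod_le_ReIm _) _.
by rewrite cReD cReN cImD cImN /=; lra.
Qed.

(** The four sides cost [4 / r * m] each, and division by the integral of [1 / w] costs a factor
    4. *)
Lemma contour_mean f df a r m u1 u2 v1 v2 : 0 < r ->
  (forall z, sq a r z -> cdiff f z (df z)) ->
  (forall z, sq a r z -> {for z, continuous df}) ->
  - r <= u1 <= - (r / 2) -> r / 2 <= u2 <= r ->
  - r <= v1 <= - (r / 2) -> r / 2 <= v2 <= r ->
  (forall u, u = u1 \/ u = u2 ->
    \int[mu]_(t in `[(complex.Im a - r)%R, (complex.Im a + r)%R])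
       cmod (df ((complex.Re a + u) +i* t)) <= m) ->
  (forall v, v = v1 \/ v = v2 ->
    \int[mu]_(t in `[(complex.Re a - r)%R, (complex.Re a + r)%R])
       cmod (df (t +i* (complex.Im a + v))) <= m) ->
  cmod (df a) <= 64 / r * m.
Proof.
move=> r0 dF' cdf hu1 hu2 hv1 hv2 X Y.
have X1 := X _ (or_introl erefl); have X2 := X _ (or_intror erefl).
have Y1 := Y _ (or_introl erefl); have Y2 := Y _ (or_intror erefl).
have ru1 : - r <= u1 by lra.
have ru2 : u2 <= r by lra.
have rv1 : - r <= v1 by lra.
have rv2 : v2 <= r by lra.
have u12 : u1 < 0 < u2 by lra.
have v12 : v1 < 0 < v2 by lra.
have lu : u1 <= u2 by lra.
have lv : v1 <= v2 by lra.
have [u1z u2z] : u1 != 0 /\ u2 != 0 by split; apply/eqP; lra.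
have [v1z v2z] : v1 != 0 /\ v2 != 0 by split; apply/eqP; lra.
have nu1 : r / 2 <= `|u1| <= r by rewrite ler0_norm; move: hu1 r0; clear; lra.
have nu2 : r / 2 <= `|u2| <= r by rewrite ger0_norm; move: hu2 r0; clear; lra.
have nv1 : r / 2 <= `|v1| <= r by rewrite ler0_norm; move: hv1 r0; clear; lra.
have nv2 : r / 2 <= `|v2| <= r by rewrite ger0_norm; move: hv2 r0; clear; lra.
have bq := bcont_quot dF' ru1 ru2 rv1 rv2 u12 v12.
have bi := bcont_inv u12 v12.
have bqi := bcontM bq bi.
have bshift x y : u1 <= x <= u2 -> v1 <= y <= v2 -> sq a r (a + (x +i* y)).
  by move=> hx hy; apply: (@inrect_sq _ a r u1 u2 v1 v2).
have bdf : bcont (fun w => df (a + w)) u1 u2 v1 v2.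
  apply: bcontP => // x y hx hy _.
  apply/ccontP => e' e'0.
  have [d d0 Hd] := (ccontP _ _).1 (cdf _ (bshift _ _ hx hy)) e' e'0.
  by exists d => // w hw; apply: Hd; have -> : a + w - (a + (x +i* y)) = w - (x +i* y) by ring.
have bdi := bcontM bdf bi.
have bN := bcontM (bcont_cst (-1) u1 u2 v1 v2) bqi.
(* Integration by parts: on the boundary the integrand is the derivative of [quot f df a]. *)
have D0 : rint (fun w => df (a + w) / w + -1 * (quot f df a w / w)) u1 u2 v1 v2 = 0.
  apply: (rint_deriv (g := quot f df a) lu lv (bcontD bdi bN)).
  move=> x y hx hy Hb; rewrite mulN1r; apply: quot_cdiff.
    apply: nz_cplx.
    by case: Hb => ->; [left|left|right|right].
  by apply: dF'; exact: bshift.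
have E : rint (fun w => df (a + w) / w) u1 u2 v1 v2 = df a * rint (fun z => z^-1) u1 u2 v1 v2.
  rewrite -(quot_cauchy dF' ru1 ru2 rv1 rv2 u12 v12).
  move: D0; rewrite (rintD bdi bN) (rintZ _ bqi) mulN1r => /eqP.
  by rewrite subr_eq0 => /eqP.
have I4 := rint_inv_ge r0 hu1 hu2 hv1 hv2.
have B : cmod (rint (fun w => df (a + w) / w) u1 u2 v1 v2) <= 16 / r * m.
  case: bdi => c1 c2 c3 c4.
  rewrite /rint (cintB c1 c2) (cintB c4 c3).
  have r4 : 0 <= 4 / r by rewrite divr_ge0// ltW.
  have F1 := le_trans (cint_side_h r0 ru1 lu ru2 nv1 cdf) (ler_wpM2l r4 ( Y1)).
  have F2 := le_trans (cint_side_h r0 ru1 lu ru2 nv2 cdf) (ler_wpM2l r4 ( Y2)).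
  have F3 := le_trans (cint_side_v r0 rv1 lv rv2 nu1 cdf) (ler_wpM2l r4 ( X1)).
  have F4 := le_trans (cint_side_v r0 rv1 lv rv2 nu2 cdf) (ler_wpM2l r4 ( X2)).
  apply: le_trans (cmodD _ _) _; rewrite cmodM cmodi normr1 mul1r.
  have -> : 16 / r * m = (4 / r * m + 4 / r * m) + (4 / r * m + 4 / r * m) by field; rewrite gt_eqF.
  apply: lerD; apply: le_trans (cmodD _ _) _; rewrite cmodN;
    [exact: (lerD F1 F2)|exact: (lerD F4 F3)].
have K : cmod (df a) * (1 / 4) <= 16 / r * m.
  by apply: le_trans B; rewrite E cmodM ler_wpM2l ?cmod_ge0.
have E4 : 64 / r * m = 4 * (16 / r * m) by ring.
by rewrite E4; move: K; clear; lra.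
Qed.

(* This replaces the mean value property.  By Fubini there is a rectangle, with
   sides between the box of radius [r / 2] and that of radius [r], on whose
   boundary [df] has a small integral; and by Cauchy's formula for the quotient
   [quot f df a] and integration by parts, [df a] times the integral of [1 / w]
   is the integral of [df (a + w) / w] along that boundary. *)
Lemma area_bound f df a r A : 0 < r ->
  (forall z, sq a (2 * r) z -> cdiff f z (df z)) ->
  (\int[mu2]_(w in box (complex.Re a, complex.Im a) r) (cmod (df (w.1 +i* w.2)))%:E <= A%:E)%E ->
  cmod (df a) * r ^+ 2 <= 256 * A.
Proof.
have p256 : 0 < 256 :> R by rewrite ltr0n.
move=> r0 dF; set a1 := complex.Re a; set a2 := complex.Im a => HA.
have A0 : 0 <= A.
  by rewrite -lee_fin; apply: le_trans HA; apply: integral_ge0 => w _; rewrite lee_fin cmod_ge0.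
apply/ler_addgt0Pl => e e0.
move: HA.
(* A strip of width [r / 2] carries a total of at most [A], so one of its lines has integral below
   [m] as soon as [A < m * (r / 2)]. The term [e / 256] provides the strict inequality and becomes
   [e / 2] at the end. *)
pose m := 2 / r * (A + e / 256).
have e256 : 0 < e / 256 := divr_gt0 e0 p256.
have e1 : 0 < A + e / 256 := ltr_wpDl A0 e256.
have m0 : 0 <= m := mulr_ge0 (divr_ge0 (ler0n R 2) (ltW r0)) (ltW e1).
have Am (u v : R) : v - u = r / 2 -> A < m * (v - u).
  move=> ->; have -> : m * (r / 2) = A + e / 256 by rewrite /m; field; rewrite gt_eqF.
  by rewrite ltrDl e256.
move=> HA.
have cdf z : sq a r z -> {for z, continuous df}.
  move=> az; apply: (derivative_cont r0) => w zw; apply: dF.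
  have -> : 2 * r = r + r by ring.
  exact: sq_trans zw.
pose Q := box (a1, a2) r.
have QE (w : RR) : Q w <-> sq a r (w.1 +i* w.2).
  rewrite /Q boxE /= /sq cReD cReN cImD cImN /=; tauto.
pose H : RR -> \bar R := (fun w : RR => (cmod (df (w.1 +i* w.2)))%:E) \_ Q.
have mQ : measurable Q by exact: measurable_box.
have mh : measurable_fun Q (fun w : RR => cmod (df (w.1 +i* w.2))).
  apply: (@measurable_cont_cplx (fun z => cmod (df z))) => // w Qw eps eps0.
  have [d d0 Hd] := (ccontP _ _).1 (cdf _ ((QE w).1 Qw)) eps eps0.
  exists d => // z /Hd; apply: le_lt_trans; exact: ler_cmodB.
have mH : measurable_fun setT H.
  by apply/(measurable_restrictT _ _).1 => //; exact/measurable_EFinP.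
have H0 (w : RR) : (0 <= H w)%E.
  by apply: erestrict_ge0 => z _; rewrite lee_fin cmod_ge0.
have HA' : (\int[mu2]_w H w <= A%:E)%E by rewrite -integral_mkcond.
have Hrow (x : R) : `|x - a1| <= r ->
   (\int[mu]_y H (x, y) = (\int[mu]_(t in `[(a2 - r)%R, (a2 + r)%R])
       cmod (df (x +i* t)))%R%:E)%E.
  move=> hx; rewrite /Rintegral fineK; last first.
    apply: integrable_fin_num => //; apply: rcont_integrable => t ht.
    apply: cont_cmod; apply: cont_vline; apply: cdf; rewrite /sq cReD cReN cImD cImN /=.
    by rewrite !ler_distl in hx *.
  rewrite [RHS]integral_mkcond; apply: eq_integral => y _; rewrite /H /patch.
  case: ifPn => [/set_mem|].
    by move=> /QE[_]; rewrite cImD cImN /= => hy; rewrite mem_set//= in_itv /= -ler_distl.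
  move=> /negP nQ; case: ifPn => // /set_mem; rewrite /= in_itv /= -ler_distl => hy.
  by exfalso; apply: nQ; apply/mem_set/QE; rewrite /sq cReD cReN cImD cImN.
have Hcol (y : R) : `|y - a2| <= r ->
   (\int[mu]_x H (x, y) = (\int[mu]_(t in `[(a1 - r)%R, (a1 + r)%R])
       cmod (df (t +i* y)))%R%:E)%E.
  move=> hy; rewrite /Rintegral fineK; last first.
    apply: integrable_fin_num => //; apply: rcont_integrable => t ht.
    apply: cont_cmod; apply: cont_hline; apply: cdf; rewrite /sq cReD cReN cImD cImN /=.
    by rewrite !ler_distl in hy *.
  rewrite [RHS]integral_mkcond; apply: eq_integral => x _; rewrite /H /patch.
  case: ifPn => [/set_mem|].
    by move=> /QE[+ _]; rewrite cReD cReN /= => hx; rewrite mem_set//= in_itv /= -ler_distl.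
  move=> /negP nQ; case: ifPn => // /set_mem; rewrite /= in_itv /= -ler_distl => hx.
  by exfalso; apply: nQ; apply/mem_set/QE; rewrite /sq cReD cReN cImD cImN.
have [x1 hx1 X1] : exists2 x, a1 - r <= x <= a1 - r / 2 & (\int[mu]_y H (x, y) < m%:E)%E.
  by apply: (tonelli_good1 mH H0 _ m0 HA'); [lra|apply: Am; field].
have [x2 hx2 X2] : exists2 x, a1 + r / 2 <= x <= a1 + r & (\int[mu]_y H (x, y) < m%:E)%E.
  by apply: (tonelli_good1 mH H0 _ m0 HA'); [lra|apply: Am; field].
have [y1 hy1 Y1] : exists2 y, a2 - r <= y <= a2 - r / 2 & (\int[mu]_x H (x, y) < m%:E)%E.
  by apply: (tonelli_good2 mH H0 _ m0 HA'); [lra|apply: Am; field].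
have [y2 hy2 Y2] : exists2 y, a2 + r / 2 <= y <= a2 + r & (\int[mu]_x H (x, y) < m%:E)%E.
  by apply: (tonelli_good2 mH H0 _ m0 HA'); [lra|apply: Am; field].
rewrite Hrow ?lte_fin in X1; last by rewrite ler_distl; lra.
rewrite Hrow ?lte_fin in X2; last by rewrite ler_distl; lra.
rewrite Hcol ?lte_fin in Y1; last by rewrite ler_distl; lra.
rewrite Hcol ?lte_fin in Y2; last by rewrite ler_distl; lra.
clear Hrow Hcol mH H0 HA' H mh mQ QE Q HA Am.
have X u : u = x1 - a1 \/ u = x2 - a1 ->
    \int[mu]_(t in `[(a2 - r)%R, (a2 + r)%R]) cmod (df ((a1 + u) +i* t)) <= m.
  by case=> ->; rewrite [_ + (_ - _)]addrC subrK ltW.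
have Y v : v = y1 - a2 \/ v = y2 - a2 ->
    \int[mu]_(t in `[(a1 - r)%R, (a1 + r)%R]) cmod (df (t +i* (a2 + v))) <= m.
  by case=> ->; rewrite [_ + (_ - _)]addrC subrK ltW.
have dF' z : sq a r z -> cdiff f z (df z).
  by move=> az; apply: dF; apply: sq_le az; move: r0; clear; lra.
have := @contour_mean f df a r m (x1 - a1) (x2 - a1) (y1 - a2) (y2 - a2) r0 dF' cdf.
clear X1 X2 Y1 Y2 dF' dF cdf => K.
have {}K : cmod (df a) <= 64 / r * m by apply: (K _ _ _ _ X Y); clear K X Y; lra.
have E : 64 / r * m = (128 * A + e / 2) / r ^+ 2 by rewrite /m; field; rewrite gt_eqF.
rewrite E ler_pdivlMr ?exprn_gt0// in K.
by apply: le_trans K _; clear -A0 e0; lra.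
Qed.

End AreaBound.

(** * Growth of functions on the disc *)

Section DiscFunctions.
Variable R : realType.
Implicit Types (f df : R[i] -> R[i]) (x y b c d t r : R) (a z w : R[i]).
Notation mu2 := (@lebesgue_measure R \x @lebesgue_measure R)%E.
Notation RR := (measurableTypeR R * measurableTypeR R)%type.
Notation cbox a r := (box (complex.Re a, complex.Im a) r).

Lemma cboxE a r (w : RR) : cbox a r w <-> sq a r (w.1 +i* w.2).
Proof. by rewrite boxE /= /sq cReD cReN cImD cImN. Qed.

Lemma measurable_cmod (D : set RR) f : measurable D ->
  (forall w : RR, D w -> {for w.1 +i* w.2, continuous f}) ->
  measurable_fun D (fun w : RR => cmod (f (w.1 +i* w.2))).
Proof.
move=> mD cf; apply: (@measurable_cont_cplx _ (fun z => cmod (f z))) => // w Dw e e0.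
have [d d0 Hd] := (ccontP _ _).1 (cf w Dw) e e0.
by exists d => // z /Hd; apply: le_lt_trans; exact: ler_cmodB.
Qed.

(** Reduction to [area_bound] without Jensen's inequality: [t] is at most [l] plus l^(1-p) t^p, for
    [t >= 0] and [l > 0]. With [l = cmod (df a) / (8 * k)] the constant term contributes exactly
    half of [cmod (df a) * r ^+ 2] and is absorbed. *)
Lemma power_bound : exists2 K : R, 0 < K & forall f df a r p I, 0 < r -> 1 <= p ->
  (forall z, sq a (2 * r) z -> cdiff f z (df z)) ->
  (\int[mu2]_(w in cbox a r) (cmod (df (w.1 +i* w.2)) `^ p)%:E <= I%:E)%E ->
  (cmod (df a) / K) `^ p * r ^+ 2 <= I.
Proof.
have [k k0 Hk] : exists2 k : R, 0 < k & forall f df a r A, 0 < r ->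
  (forall z, sq a (2 * r) z -> cdiff f z (df z)) ->
  (\int[mu2]_(w in cbox a r) (cmod (df (w.1 +i* w.2)))%:E <= A%:E)%E ->
  cmod (df a) * r ^+ 2 <= k * A.
  by exists 256; [rewrite ltr0n|exact: area_bound].
have K0 : 0 < 8 * k by rewrite mulr_gt0.
exists (8 * k) => // f df a r p I r0 p1 dF HI.
have I0 : 0 <= I.
  by rewrite -lee_fin; apply: le_trans HI; apply: integral_ge0 => w _; rewrite lee_fin powR_ge0.
have [a0|a0] := eqVneq (cmod (df a)) 0.
  by rewrite a0 mul0r powR0 ?mul0r// gt_eqF// (lt_le_trans ltr01).
have {}a0 : 0 < cmod (df a) by rewrite lt_def a0 cmod_ge0.
pose l := cmod (df a) / (8 * k).
have l0 : 0 < l by rewrite divr_gt0.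
have cdf z : sq a r z -> {for z, continuous df}.
  move=> az; apply: (derivative_cont r0) => w zw; apply: dF.
  have -> : 2 * r = r + r by ring.
  exact: sq_trans zw.
have mQ : measurable (cbox a r) by exact: measurable_box.
have mh : measurable_fun (cbox a r) (fun w : RR => cmod (df (w.1 +i* w.2))).
  by apply: measurable_cmod => // w /cboxE; exact: cdf.
have mhp : measurable_fun (cbox a r) (fun w : RR => cmod (df (w.1 +i* w.2)) `^ p).
  by apply: (measurableT_comp (measurable_powR _)).
have := Hk f df a r (4 * r ^+ 2 * l + l `^ (1 - p) * I) r0 dF.
move=> H.
have {}H : cmod (df a) * r ^+ 2 <= k * (4 * r ^+ 2 * l + l `^ (1 - p) * I).
  apply: H.
  apply: (@le_trans _ _ (\int[mu2]_(w in cbox a r)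
     (l%:E + (l `^ (1 - p))%:E * (cmod (df (w.1 +i* w.2)) `^ p)%:E))%E).
    apply: integral_mono => w _; first by rewrite lee_fin cmod_ge0.
    rewrite -EFinM -EFinD lee_fin; set t := cmod _.
    have t0 : 0 <= t by exact: cmod_ge0.
    have [tl|lt] := leP t l.
      by rewrite (le_trans tl)// lerDl mulr_ge0 ?powR_ge0.
    apply: (@le_trans _ _ (l `^ (1 - p) * t `^ p)); last by rewrite lerDr ltW.
    have test_point : 0 < t by exact: lt_trans lt.
    have -> : t `^ p = t * t `^ (p - 1) by rewrite mulr_powRB1// (lt_le_trans ltr01).
    rewrite mulrCA ler_peMr//.
    have -> : 1 - p = - (p - 1) by ring.
    rewrite powRN mulrC ler_pdivlMr ?powR_gt0// mul1r.
    by apply: ge0_ler_powR; rewrite ?nnegrE ?subr_ge0// ltW.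
  rewrite ge0_integralD//; first last.
  - apply: measurable_funeM; exact/measurable_EFinP.
  - by move=> w _; rewrite mule_ge0// lee_fin powR_ge0.
  - by move=> w _; rewrite lee_fin ltW.
  rewrite ge0_integralZl//; first last.
  - by rewrite lee_fin powR_ge0.
  - by move=> w _; rewrite lee_fin powR_ge0.
  - exact/measurable_EFinP.
  have -> : (\int[mu2]_(x in cbox a r) l%:E = (4 * r ^+ 2 * l)%:E)%E.
    rewrite (@integral_cst _ _ _ mu2 _ mQ l%:E) [X in (_ * X)%E](measure_box _ (ltW r0)).
    by rewrite -EFinM mulrC.
  rewrite EFinD; apply: leeD => //.
  by rewrite EFinM lee_pmul2l// ?lte_fin ?powR_gt0.
have E : cmod (df a) * r ^+ 2 = k * (8 * (l * r ^+ 2)).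
  by rewrite /l; field; rewrite gt_eqF.
rewrite E ler_pM2l// in H.
have lp : 0 < l `^ (p - 1) by rewrite powR_gt0.
have Hl : l `^ (1 - p) = (l `^ (p - 1))^-1 by rewrite -powRN; congr (_ `^ _); ring.
rewrite -/l -(@mulr_powRB1 _ l p) ?(ltW l0)//; last by rewrite (lt_le_trans ltr01).
have {}H : 4 * (l * r ^+ 2) <= l `^ (1 - p) * I by lra.
rewrite Hl [X in _ <= X]mulrC ler_pdivlMr// in H.
have : 0 <= l * r ^+ 2 * l `^ (p - 1) := mulr_ge0 (mulr_ge0 (ltW l0) (sqr_ge0 r)) (powR_ge0 _ _).
have -> : l * l `^ (p - 1) * r ^+ 2 = l * r ^+ 2 * l `^ (p - 1) by ring.
lra.
Qed.

Definition discset : set RR := [set w | unit_disc (w.1 +i* w.2)].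

Lemma measurable_discset : measurable discset.
Proof.
have mc : measurable_fun setT (fun w : RR => cmod (w.1 +i* w.2)).
  apply: (@measurable_cmod _ id) => // w _; exact: cvg_id.
have := mc measurableT _ (measurable_itv `]-oo, 1[).
rewrite setTI; congr measurable; apply/seteqP; split=> w;
  by rewrite /discset /unit_disc /= in_itv.
Qed.

Lemma hol_cdiff f z : Hol_disc f -> cmod z < 1 -> cdiff f z (derive1 f z).
Proof. by move=> hf z1; apply: derivable_cdiff; exact: hf. Qed.

Lemma cmod_sq_le a r w : sq a r w -> cmod w <= cmod a + 2 * r.
Proof.
by move=> /sq_cmod h; have := cmodD (w - a) a; rewrite subrK; lra.
Qed.

Lemma hol_deriv_cont f z : Hol_disc f -> cmod z < 1 -> {for z, continuous (derive1 f)}.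
Proof.
move=> hf z1; pose r := (1 - cmod z) / 4.
have r0 : 0 < r by rewrite divr_gt0// subr_gt0.
apply: (derivative_cont r0) => w /cmod_sq_le h; apply: hol_cdiff => //.
by apply: le_lt_trans h _; rewrite /r; lra.
Qed.

Lemma measurable_hol_deriv f : Hol_disc f ->
  measurable_fun discset (fun w : RR => cmod (derive1 f (w.1 +i* w.2))).
Proof.
move=> hf; apply: measurable_cmod; first exact: measurable_discset.
by move=> w dw; exact: hol_deriv_cont.
Qed.

Lemma cbox_disc a r : cmod a + 2 * r < 1 -> cbox a r `<=` discset.
Proof.
by move=> h w /cboxE /cmod_sq_le hw; apply: le_lt_trans hw h.
Qed.

(** It says that exp(2 g(z,a)) = 1 + (1-|a|^2)(1-|z|^2)/|z-a|^2 off the pole, the source of the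
    bounds on [green] from both sides. *)
Lemma green_identity a z :
  cmod (1 - a^* * z) ^+ 2 = cmod (z - a) ^+ 2 + (1 - cmod a ^+ 2) * (1 - cmod z ^+ 2).
Proof.
case: a z => a1 a2 [z1 z2]; rewrite !sqr_cmod.
by rewrite !(cReD, cImD, cReN, cImN, cReM, cImM) /=; ring.
Qed.

(** By [green_identity] the ratio inside the logarithm has square at least 1 + 2/3, which exceeds
    (5/4)^2 = 25/16. *)
Lemma green_ge z a : z != a -> cmod (z - a) ^+ 2 <= (1 - cmod a ^+ 2) * (1 - cmod z ^+ 2) * (3 / 2) ->
  ln (5 / 4) <= green z a.
Proof.
move=> za h; have za0 : 0 < cmod (z - a) by rewrite cmod_gt0 subr_eq0.
have q0 : 0 < cmod (1 - a^* * z).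
  rewrite lt_def cmod_ge0 andbT -sqrf_eq0 green_identity gt_eqF//.
  have : 0 < cmod (z - a) ^+ 2 by rewrite exprn_gt0.
  lra.
have le54 : 5 / 4 * cmod (z - a) <= cmod (1 - a^* * z).
  rewrite -ler_sqr ?nnegrE ?mulr_ge0 ?cmod_ge0//.
  by rewrite green_identity exprMn; have := sqr_ge0 (cmod (z - a)); lra.
rewrite /green cmodf ler_ln ?posrE ?divr_gt0//.
by rewrite ler_pdivlMr.
Qed.

Lemma Q_space_bound f s : Q_space s f -> exists2 M : R, 0 <= M & forall a, unit_disc a ->
   (\int[mu2]_(w in discset)
     (cmod (derive1 f (w.1 +i* w.2)) ^+ 2 * green (w.1 +i* w.2) a `^ s)%:E <= M%:E)%E.
Proof.
move=> [hf Hs].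
set S := ereal_sup _ in Hs.
have S0 : (0 <= S)%E.
  apply: (@le_trans _ _ (disc_integral (fun z =>
     (cmod (derive1 f z) ^+ 2 * green z 0 `^ s)%:E))).
    rewrite /disc_integral mule_ge0//; first by rewrite lee_fin invr_ge0 pi_ge0.
    by apply: integral_ge0 => w _; rewrite lee_fin mulr_ge0 ?exprn_ge0 ?cmod_ge0 ?powR_ge0.
  by apply: ereal_sup_ubound; exists 0 => //; rewrite /unit_disc /= cmod0.
have Sf : S \is a fin_num by rewrite ge0_fin_numE.
exists (pi * fine S); first by rewrite mulr_ge0 ?pi_ge0// fine_ge0.
move=> a da.
have : (disc_integral (fun z => (cmod (derive1 f z) ^+ 2 * green z a `^ s)%:E) <= S)%E.
  by apply: ereal_sup_ubound; exists a.
rewrite /disc_integral => h.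
rewrite EFinM fineK//.
have := lee_wpmul2l _ h; move=> /(_ pi%:E); rewrite lee_fin pi_ge0 => /(_ isT).
by rewrite muleA -EFinM divff ?mul1e// gt_eqF// pi_gt0.
Qed.

(** On a box about [z] of radius comparable to [1 - cmod z], the Green function of a suitable pole
    is bounded below, so the area integral of |f'|^2 over the box is bounded uniformly in [z];
    [power_bound] with exponent 2 concludes. *)
Lemma bloch f s : 0 < s -> Q_space s f -> exists2 B, 0 <= B &
  forall z, cmod z < 1 -> cmod (derive1 f z) * (1 - cmod z) <= B.
Proof.
move=> s0 Qf; have [hf _] := Qf.
have [M M0 HM] := Q_space_bound Qf.
pose c0 : R := ln (5 / 4).
have c00 : 0 < c0 by apply: ln_gt0; lra.
have [K K0 power_bound'] := power_bound.
pose C := K * Num.sqrt (64 * ((c0 `^ s)^-1 * M)).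
exists C; first by rewrite mulr_ge0 ?sqrtr_ge0 ?(ltW K0).
move=> z z1; pose rho := 1 - cmod z; pose r := rho / 8.
have rho0 : 0 < rho by rewrite subr_gt0.
have r0 : 0 < r by rewrite divr_gt0.
(* The pole is not [z] itself, so that the junk value of [green] at the pole stays outside the box.
   At distance [4 * r = rho / 2] it is still inside the disc and close enough for [green_ge]. *)
pose a := z + (4 * r)%:C.
have ca : cmod a <= cmod z + rho / 2.
  apply: le_trans (cmodD _ _) _; rewrite lerD2l cmodR ger0_norm; last by rewrite mulr_ge0// ltW.
  by rewrite /r; lra.
have a1 : cmod a < 1 by apply: le_lt_trans ca _; rewrite /rho; lra.
have zr : cmod z + 2 * r < 1 by rewrite /r /rho; lra.
have dF w : sq z (2 * r) w -> cdiff f w (derive1 f w).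
  by move=> /cmod_sq_le h; apply: hol_cdiff => //; apply: le_lt_trans h _; rewrite /r /rho; lra.
have key : (\int[mu2]_(w in cbox z r) (cmod (derive1 f (w.1 +i* w.2)) `^ 2)%:E <=
    ((c0 `^ s)^-1 * M)%:E)%E.
  have cs0 : 0 < c0 `^ s by rewrite powR_gt0.
  suff : (\int[mu2]_(w in cbox z r) ((c0 `^ s)%:E * (cmod (derive1 f (w.1 +i* w.2)) `^ 2)%:E) <= M%:E)%E.
    rewrite ge0_integralZl//; first last.
    - by rewrite lee_fin ltW.
    - by move=> w _; rewrite lee_fin powR_ge0.
    - apply/measurable_EFinP/(measurableT_comp (measurable_powR _)).
      apply: measurable_cmod; first exact: measurable_box.
      by move=> w /(cbox_disc zr); exact: hol_deriv_cont.
    - exact: measurable_box.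
    by rewrite -lee_pdivlMl// ; rewrite -EFinM.
  apply: le_trans (HM a a1).
  apply: (@le_trans _ _ (\int[mu2]_(w in cbox z r)
     (cmod (derive1 f (w.1 +i* w.2)) ^+ 2 * green (w.1 +i* w.2) a `^ s)%:E)%E).
    apply: integral_mono => w hw.
      by rewrite -EFinM lee_fin mulr_ge0 ?powR_ge0.
    rewrite -EFinM lee_fin powR_mulrn ?cmod_ge0// mulrC ler_wpM2l ?exprn_ge0 ?cmod_ge0//.
    have [wz1 wz2] := (cboxE _ _ _).1 hw.
    set v := w.1 +i* w.2 in wz1 wz2 *.
    have vz : cmod (v - z) <= rho / 4.
      by have := sq_cmod (conj wz1 wz2); rewrite /r; lra.
    have cv : cmod v <= cmod z + rho / 4.
      by have := cmodD (v - z) z; rewrite subrK; lra.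
    have g0 : c0 <= green v a.
      apply: green_ge.
        rewrite -subr_eq0; apply/eqP => va0.
        have E : complex.Re (v - a) = complex.Re (v - z) - 4 * r.
          by rewrite /a !(cReD, cReN) /=; ring.
        move: E wz1; rewrite va0 /= => E; rewrite ler_norml => /andP[_]; lra.
      have va : cmod (v - a) <= 3 / 4 * rho.
        have -> : v - a = (v - z) + - (4 * r)%:C by rewrite /a; ring.
        apply: le_trans (cmodD _ _) _; rewrite cmodN cmodR ger0_norm; last by rewrite mulr_ge0// ltW.
        by rewrite /r; lra.
      have h1 : rho / 2 <= 1 - cmod a ^+ 2.
        have : cmod a ^+ 2 <= cmod a by rewrite expr2 ler_piMr ?cmod_ge0// ltW.
        by rewrite /rho in ca *; lra.
      have h2 : 3 / 4 * rho <= 1 - cmod v ^+ 2.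
        have v1 : cmod v <= 1 by rewrite /rho in cv; lra.
        have : cmod v ^+ 2 <= cmod v by rewrite expr2 ler_piMr ?cmod_ge0.
        by rewrite /rho in cv *; lra.
      have : cmod (v - a) ^+ 2 <= (3 / 4 * rho) ^+ 2.
        by rewrite ler_sqr ?nnegrE ?cmod_ge0// mulr_ge0// ?ltW//; lra.
      move/le_trans; apply.
      have -> : (3 / 4 * rho) ^+ 2 = rho / 2 * (3 / 4 * rho) * (3 / 2) by field.
      apply: ler_wpM2r; first lra.
      by apply: ler_pM => //; [rewrite divr_ge0// ltW|rewrite mulr_ge0// ?ltW//; lra].
    by apply: ge0_ler_powR => //; rewrite ?nnegrE ?(ltW s0) ?(ltW c00)// (le_trans _ g0)// ltW.
  apply: integral_mono_set; first exact: cbox_disc.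
  by move=> w _; rewrite lee_fin mulr_ge0 ?exprn_ge0 ?cmod_ge0 ?powR_ge0.
have := power_bound' _ _ _ _ _ _ r0 _ dF key; move=> /(_ (ler1n R 2)) H.
set t := cmod (derive1 f z) in H *.
have t0 : 0 <= t by exact: cmod_ge0.
rewrite powR_mulrn ?divr_ge0 ?(ltW K0)// in H.
rewrite -/rho /C.
have -> : t * rho = K * (t / K * rho) by field; rewrite gt_eqF.
rewrite ler_wpM2l ?(ltW K0)//.
rewrite -[leLHS]ger0_norm; last by rewrite !mulr_ge0 ?invr_ge0 ?(ltW K0) ?(ltW rho0).
rewrite -sqrtr_sqr ler_wsqrtr// exprMn.
have -> : rho ^+ 2 = 64 * r ^+ 2 by rewrite /r; field.
by rewrite mulrCA ler_wpM2l.
Qed.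

(** On the box of radius (1-|z|)/8 the weight is at least ((1-|z|)/2)^alpha, so the weighted
    integral controls the integral of |F'|^p there; the extra exponent 2 is the area of the box in
    [power_bound]. *)
Lemma dirichlet_deriv_growth F p alpha : 1 <= p -> 0 <= alpha -> Dirichlet_space p alpha F ->
  exists2 K, 0 <= K & forall z, cmod z < 1 ->
    cmod (derive1 F z) `^ p * (1 - cmod z) `^ (alpha + 2) <= K.
Proof.
move=> p1 al0 [hF Hs].
set D := disc_integral _ in Hs.
have D0 : (0 <= D)%E.
  rewrite /D /disc_integral mule_ge0//; first by rewrite lee_fin invr_ge0 pi_ge0.
  by apply: integral_ge0 => w _; rewrite lee_fin mulr_ge0 ?powR_ge0.
have Df : D \is a fin_num by rewrite ge0_fin_numE.
pose M := pi * fine D.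
have M0 : 0 <= M by rewrite mulr_ge0 ?pi_ge0// fine_ge0.
have HM : (\int[mu2]_(w in discset)
   ((1 - cmod (w.1 +i* w.2) ^+ 2) `^ alpha * cmod (derive1 F (w.1 +i* w.2)) `^ p)%:E <= M%:E)%E.
  rewrite /M EFinM fineK// /D /disc_integral muleA -EFinM divff ?mul1e//.
  by rewrite gt_eqF// pi_gt0.
have [K K0 power_bound'] := power_bound.
exists (K `^ p * (64 * (2 `^ alpha * M))).
  by rewrite mulr_ge0 ?powR_ge0// mulr_ge0 ?ler0n// mulr_ge0 ?powR_ge0.
move=> z z1; pose rho := 1 - cmod z; pose r := rho / 8.
have rho0 : 0 < rho by rewrite subr_gt0.
have r0 : 0 < r by rewrite divr_gt0.
have zr : cmod z + 2 * r < 1 by rewrite /r /rho; lra.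
have dF w : sq z (2 * r) w -> cdiff F w (derive1 F w).
  by move=> /cmod_sq_le h; apply: hol_cdiff => //; apply: le_lt_trans h _; rewrite /r /rho; lra.
have k0 : 0 < (rho / 2) `^ alpha by rewrite powR_gt0// divr_gt0.
have key : (\int[mu2]_(w in cbox z r) (cmod (derive1 F (w.1 +i* w.2)) `^ p)%:E <=
    (((rho / 2) `^ alpha)^-1 * M)%:E)%E.
  suff : (\int[mu2]_(w in cbox z r) (((rho / 2) `^ alpha)%:E * (cmod (derive1 F (w.1 +i* w.2)) `^ p)%:E) <= M%:E)%E.
    rewrite ge0_integralZl//; first last.
    - by rewrite lee_fin ltW.
    - by move=> w _; rewrite lee_fin powR_ge0.
    - apply/measurable_EFinP/(measurableT_comp (measurable_powR _)).
      apply: measurable_cmod; first exact: measurable_box.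
      by move=> w /(cbox_disc zr); exact: hol_deriv_cont.
    - exact: measurable_box.
    by rewrite -lee_pdivlMl// ; rewrite -EFinM.
  apply: le_trans HM.
  apply: (@le_trans _ _ (\int[mu2]_(w in cbox z r)
    ((1 - cmod (w.1 +i* w.2) ^+ 2) `^ alpha * cmod (derive1 F (w.1 +i* w.2)) `^ p)%:E)%E).
    apply: integral_mono => w hw.
      by rewrite -EFinM lee_fin mulr_ge0 ?powR_ge0.
    rewrite -EFinM lee_fin ler_wpM2r ?powR_ge0//.
    have := cmod_sq_le ((cboxE _ _ _).1 hw).
    set v := w.1 +i* w.2 => cv.
    have h2 : rho / 2 <= 1 - cmod v ^+ 2.
      have v1 : cmod v <= 1 by rewrite /rho in cv; lra.
      have : cmod v ^+ 2 <= cmod v by rewrite expr2 ler_piMr ?cmod_ge0.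
      by rewrite /r /rho in cv *; lra.
    apply: ge0_ler_powR => //; rewrite nnegrE; first by rewrite divr_ge0// ltW.
    by apply: le_trans h2; rewrite divr_ge0// ltW.
  apply: integral_mono_set; first exact: cbox_disc.
  by move=> w _; rewrite lee_fin mulr_ge0 ?powR_ge0.
have H := power_bound' _ _ _ _ _ _ r0 p1 dF key.
set t := cmod (derive1 F z) in H *.
have t0 : 0 <= t by exact: cmod_ge0.
rewrite -/rho.
have -> : t `^ p = K `^ p * (t / K) `^ p.
  by rewrite -powRM ?divr_ge0 ?(ltW K0)//; congr (_ `^ _); field; rewrite gt_eqF.
rewrite -mulrA ler_wpM2l ?powR_ge0//.
have -> : rho `^ (alpha + 2) = 64 * (2 `^ alpha * (rho / 2) `^ alpha * r ^+ 2).
  rewrite -powRM ?divr_ge0// ?(ltW rho0)//.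
  have -> : 2 * (rho / 2) = rho by field.
  rewrite powRD; last by rewrite (gt_eqF rho0) implybT.
  rewrite (@powR_mulrn _ rho 2) ?(ltW rho0)//.
  by rewrite /r; field.
have -> : (t / K) `^ p * (64 * (2 `^ alpha * (rho / 2) `^ alpha * r ^+ 2)) =
   64 * (2 `^ alpha * ((rho / 2) `^ alpha * ((t / K) `^ p * r ^+ 2))) by ring.
rewrite ler_wpM2l// ler_wpM2l ?powR_ge0//.
by rewrite -ler_pdivlMl.
Qed.

End DiscFunctions.

(** * Growth along radii, and sufficiency of the growth condition *)

Section Sufficiency.
Variable R : realType.
Implicit Types (f phi : R[i] -> R[i]) (x y b c d t r : R) (a z w : R[i]).
Notation mu2 := (@lebesgue_measure R \x @lebesgue_measure R)%E.
Notation RR := (measurableTypeR R * measurableTypeR R)%type.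

Lemma radial_growth f (k psi : R -> R) : Hol_disc f ->
  (forall z, cmod z < 1 -> cmod (derive1 f z) <= k (cmod z)) ->
  (forall x, 0 <= x < 1 -> is_derive x 1 psi (k x)) ->
  forall z, cmod z < 1 -> cmod (f z - f 0) <= psi (cmod z) - psi 0.
Proof.
move=> hf hk hpsi z z1.
have [u u1 uz] : exists2 u, cmod u = 1 & u * (cmod z)%:C = z.
  have [->|z0] := eqVneq z 0; first by exists 1; rewrite ?cmod1// mul1r cmod0.
  have cz : (cmod z)%:C != 0 by rewrite -cmod_eq0 cmodR ger0_norm ?cmod_ge0// cmod_eq0.
  exists (z / (cmod z)%:C); last by rewrite divfK.
  by rewrite cmodf cmodR ger0_norm ?cmod_ge0// divff// cmod_eq0.
have cut t : 0 <= t -> cmod (0 + u * t%:C) = t.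
  by move=> t0; rewrite add0r cmodM u1 mul1r cmodR ger0_norm.
have := @rdiff_le _ (fun t => f (0 + u * t%:C)) (fun t => derive1 f (0 + u * t%:C) * u)
  psi k 0 (cmod z) (cmod_ge0 z).
rewrite [in f (0 + u * (cmod z)%:C)]add0r uz mulr0 addr0; apply.
- move=> t /andP[t0 tz]; apply: cdiff_rdiff; apply: hol_cdiff => //.
  by rewrite cut// (le_lt_trans tz).
- by move=> t /andP[t0 tz]; apply: hpsi; rewrite t0 (le_lt_trans tz).
- move=> t /andP[t0 tz]; rewrite cmodM u1 mulr1.
  by have := hk (0 + u * t%:C); rewrite cut//; apply; exact: le_lt_trans z1.
Qed.

Lemma is_derive_1B x : is_derive x 1 (fun y : R => 1 - y) (-1).
Proof.
have : is_derive x 1 (cst 1 - id : R -> R) (0 - 1) by apply: is_deriveB.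
by rewrite sub0r.
Qed.

Lemma bloch_growth f B : Hol_disc f ->
  (forall z, cmod z < 1 -> cmod (derive1 f z) * (1 - cmod z) <= B) ->
  forall z, cmod z < 1 -> cmod (f z) <= cmod (f 0) - B * ln (1 - cmod z).
Proof.
move=> hf hB z z1.
have := @radial_growth f (fun x => B / (1 - x)) (fun x => - B * ln (1 - x)) hf _ _ z z1.
rewrite subr0 ln1 mulr0 subr0 => H.
have := cmodD (f z - f 0) (f 0); rewrite subrK => /le_trans; apply.
rewrite addrC lerD2l -mulNr; apply: H.
  by move=> w w1; rewrite ler_pdivlMr ?subr_gt0//; exact: hB.
move=> x /andP[_ x1].
have x10 : 0 < 1 - x by rewrite subr_gt0.
have d1 := @is_derive1_comp _ (@ln R) (fun y : R => 1 - y) x _ _ (is_derive1_ln x10) (is_derive_1B x).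
have := @is_deriveZ _ _ _ (@ln R \o (fun y => 1 - y)) (- B) x 1 _ d1.
by rewrite -[_ *: (_ * _)]/(_ * _) mulrN1 mulrNN.
Qed.

(** The bound on F' has exponent -(alpha+2)/p = -kap-1 and is integrated along a radius. Since
    [p < alpha + 2] makes [kap] positive, the primitive is a multiple of (1-|z|)^(-kap), which is at
    least 1 and absorbs the value at 0. *)
Lemma dirichlet_growth F p alpha : 1 <= p -> 0 <= alpha -> p < alpha + 2 ->
  Dirichlet_space p alpha F ->
  exists2 K, 0 <= K & forall z, cmod z < 1 ->
    cmod (F z) <= K * (1 - cmod z) `^ (- ((alpha + 2) / p - 1)).
Proof.
move=> p1 al0 pa DF; have [hF _] := DF.
have [K K0 HK] := dirichlet_deriv_growth p1 al0 DF.
have p0 : 0 < p by exact: lt_le_trans p1.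
pose kap := (alpha + 2) / p - 1.
have kap0 : 0 < kap by rewrite subr_gt0 ltr_pdivlMr// mul1r.
pose K1 := K `^ p^-1.
have HK1 z : cmod z < 1 -> cmod (derive1 F z) <= K1 * (1 - cmod z) `^ (- kap - 1).
  move=> z1; have rho0 : 0 < 1 - cmod z by rewrite subr_gt0.
  have := HK z z1 => H.
  have E : - kap - 1 = - ((alpha + 2) * p^-1) by rewrite /kap; ring.
  rewrite E powRN ler_pdivlMr ?powR_gt0//.
  have -> : cmod (derive1 F z) = (cmod (derive1 F z) `^ p) `^ p^-1.
    by rewrite -powRrM divff ?gt_eqF// powRr1// cmod_ge0.
  rewrite powRrM -powRM ?powR_ge0//.
  by apply: ge0_ler_powR; rewrite ?nnegrE ?invr_ge0 ?(ltW p0)// mulr_ge0 ?powR_ge0.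
exists (cmod (F 0) + K1 / kap).
  by rewrite addr_ge0 ?cmod_ge0// divr_ge0 ?powR_ge0// ltW.
move=> z z1; rewrite -/kap.
have := @radial_growth F (fun x => K1 * (1 - x) `^ (- kap - 1))
  (fun x => K1 / kap * (1 - x) `^ (- kap)) hF HK1 _ z z1.
rewrite subr0 powR1 mulr1 => H.
have {}H : cmod (F z - F 0) <= K1 / kap * (1 - cmod z) `^ (- kap) - K1 / kap.
  apply: H => x /andP[_ x1].
  have x10 : 0 < 1 - x by rewrite subr_gt0.
  have d1 := @is_derive1_comp _ (@powR R ^~ (- kap)) (fun y : R => 1 - y) x _ _ (is_derive1_powR (- kap) x10) (is_derive_1B x).
  have := @is_deriveZ _ _ _ ((@powR R ^~ (- kap)) \o (fun y => 1 - y)) (K1 / kap) x 1 _ d1.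
  rewrite -[_ *: (_ * _)]/(_ * _).
  have -> // : K1 / kap * (- kap * (1 - x) `^ (- kap - 1) * -1) = K1 * (1 - x) `^ (- kap - 1).
  by field; rewrite gt_eqF.
have h1 : 1 <= (1 - cmod z) `^ (- kap).
  rewrite powRN -[leLHS]invr1 lef_pV2 ?posrE ?powR_gt0 ?subr_gt0//.
  apply: (@le_trans _ _ ((1 - cmod z) `^ 0)); last by rewrite powRr0.
  by apply: ger_powR; [rewrite subr_gt0 z1 gerBl cmod_ge0|exact: ltW].
have := cmodD (F z - F 0) (F 0); rewrite subrK => /le_trans; apply.
have K10 : 0 <= K1 / kap by rewrite divr_ge0 ?powR_ge0// ltW.
have : cmod (F 0) * 1 <= cmod (F 0) * (1 - cmod z) `^ (- kap) by rewrite ler_wpM2l ?cmod_ge0.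
rewrite mulrDl; lra.
Qed.

(** Only the pole 0 is used: g(z,0) = -log|z| is at least 1-|z|, hence at least (1-|z|^2)/2. *)
Lemma Q_space_weighted f s : 0 < s -> Q_space s f ->
  (\int[mu2]_(w in @discset R)
    ((1 - cmod (w.1 +i* w.2) ^+ 2) `^ s * cmod (derive1 f (w.1 +i* w.2)) ^+ 2)%:E < +oo)%E.
Proof.
move=> s0 Qf; have [hf _] := Qf; have [M M0 HM] := Q_space_bound Qf.
have mD := @measurable_discset R.
have mf := measurable_hol_deriv hf.
(* A box of radius 0 is the single point 0, where [green] is junk and the comparison may fail; it is
   removed as a null set. *)
pose N : set RR := box (0, 0) 0.
have mN : measurable N by exact: measurable_box.
have mg : measurable_fun (@discset R) (fun w : RR =>
    ((1 - cmod (w.1 +i* w.2) ^+ 2) `^ s * cmod (derive1 f (w.1 +i* w.2)) ^+ 2)).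
  have mc : measurable_fun (@discset R) (fun w : RR => cmod (w.1 +i* w.2)).
    by apply: (@measurable_cmod _ _ id) => // w _; exact: cvg_id.
  apply: measurable_funM.
    apply: (measurableT_comp (measurable_powR _)).
    apply: measurable_funB; first exact: measurable_cst.
    exact: measurable_funX.
  exact: measurable_funX.
rewrite (ge0_negligible_integral mN mD); first last.
- by rewrite [LHS](measure_box _ (lexx 0)) expr0n mulr0.
- by move=> w _; rewrite lee_fin mulr_ge0 ?powR_ge0 ?exprn_ge0 ?cmod_ge0.
- exact/measurable_EFinP.
have d0 : unit_disc (0 : R[i]) by rewrite /unit_disc /= cmod0.
have c20 : (0 : R) <= 2 `^ s by exact: powR_ge0.
apply: (@le_lt_trans _ _ ((2 `^ s)%:E * M%:E)%E); last by rewrite -EFinM ltry.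
rewrite -lee_pdivrMl ?powR_gt0//.
rewrite -ge0_integralZl//; first last.
- by move=> w _; rewrite lee_fin mulr_ge0 ?powR_ge0 ?exprn_ge0 ?cmod_ge0.
- by apply/measurable_EFinP; apply: measurable_funS mg => // w [].
- exact: measurableD.
apply: le_trans (HM 0 d0).
apply: (@le_trans _ _ (\int[mu2]_(w in @discset R `\` N)
   (cmod (derive1 f (w.1 +i* w.2)) ^+ 2 * green (w.1 +i* w.2) 0 `^ s)%:E)%E); last first.
  apply: integral_mono_set; first by move=> w [].
  by move=> w _; rewrite lee_fin mulr_ge0 ?powR_ge0 ?exprn_ge0 ?cmod_ge0.
apply: integral_mono => w [dw Nw]; rewrite -EFinM lee_fin.
  by rewrite mulr_ge0 ?invr_ge0// mulr_ge0 ?powR_ge0 ?exprn_ge0 ?cmod_ge0.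
rewrite mulrA mulrC ler_wpM2l ?exprn_ge0 ?cmod_ge0//.
set z := w.1 +i* w.2 in dw *.
have z1 : cmod z < 1 by [].
have z0 : 0 < cmod z.
  rewrite cmod_gt0; apply/eqP => z0; apply: Nw; apply/boxE => /=.
  move: z0; rewrite /z => -[-> ->]; by rewrite subrr normr0.
have u0 : 0 <= 1 - cmod z ^+ 2.
  by rewrite subr_ge0 expr_le1 ?cmod_ge0// ltW.
rewrite -powRN -[2 `^ (- s)]invrK -powRN opprK -[X in X * _]powRN.
have -> : 2 `^ (- s) * (1 - cmod z ^+ 2) `^ s = ((1 - cmod z ^+ 2) / 2) `^ s.
  by rewrite powRM// -powR_inv1// -powRrM mulN1r mulrC.
have g : (1 - cmod z ^+ 2) / 2 <= green z 0.
  have E1 : cmod (1 - 0^* * z) = 1.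
    apply/eqP; rewrite -(@pexpr_eq1 _ _ 2) ?cmod_ge0//; apply/eqP.
    by rewrite green_identity subr0 cmod0; ring.
  rewrite /green cmodf E1 subr0 div1r lnV ?posrE//.
  have := @le_ln1Dx R (cmod z - 1); rewrite [1 + _]addrC subrK.
  move=> /(_ _); have h : -1 < cmod z - 1 by lra.
  move=> /(_ h) hln.
  have : 0 <= (1 - cmod z) ^+ 2 by exact: sqr_ge0.
  have -> : (1 - cmod z) ^+ 2 = 1 - 2 * cmod z + cmod z ^+ 2 by ring.
  lra.
have u20 : 0 <= (1 - cmod z ^+ 2) / 2 by rewrite divr_ge0.
by apply: ge0_ler_powR; rewrite ?nnegrE ?(ltW s0)// (le_trans _ g).
Qed.

Definition exp_type0 phi := forall e, 0 < e -> exists C, forall z,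
  cmod (phi z) <= C * expR (e * cmod z).

Lemma exp_type0_deriv phi : entire phi -> exp_type0 phi -> exp_type0 (derive1 phi).
Proof.
move=> ephi H e e0; have [C HC] := H e e0.
have C0 : 0 <= C.
  have := HC 0; rewrite cmod0 mulr0 expR0 mulr1; apply: le_trans; exact: cmod_ge0.
exists (256 * C * expR (2 * e)) => z.
have := @cauchy_estimate R phi (derive1 phi) z 1 (C * expR (e * (cmod z + 2))) ltr01.
rewrite divr1 => K.
have {}K : cmod (derive1 phi z) <= 256 * (C * expR (e * (cmod z + 2))).
  apply: K => w zw; first by apply: derivable_cdiff; exact: ephi.
  apply: le_trans (HC w) _; rewrite ler_wpM2l// ler_expR ler_wpM2l ?(ltW e0)//.
  by have := cmod_sq_le zw; rewrite mulr1.
apply: le_trans K _.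
rewrite mulrDr expRD; rewrite le_eqVlt; apply/orP; left; apply/eqP.
by rewrite [2 * e]mulrC; ring.
Qed.

Lemma sufficiency phi s p alpha : entire phi -> 0 < s -> 2 <= p -> p - 2 + s < alpha ->
  exp_type0 phi -> superposition phi @` Q_space s `<=` Dirichlet_space p alpha.
Proof.
move=> ephi s0 p2 pa gphi _ [f Qf <-].
have [hf _] := Qf.
have [B B0 HB] := bloch s0 Qf.
have fB := bloch_growth hf HB.
have cF z : cmod z < 1 -> cdiff (superposition phi f) z (derive1 phi (f z) * derive1 f z).
  move=> z1; apply: cdiff_comp; first exact: hol_cdiff.
  by apply: derivable_cdiff; exact: ephi.
split; first by move=> z z1; exact: cdiff_derivable (cF z z1).
pose delta := alpha - (p - 2 + s).
have de0 : 0 < delta by rewrite subr_gt0.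
have p0 : 0 < p by lra.
have Bp1 : 0 < B * p + 1 by rewrite ltr_wpDl// mulr_ge0// ltW.
(* The slack [delta] in the exponent pays for phi': its p-th power costs [e * B * p <= delta]. The
   summand 1 covers [B = 0]. *)
pose e := delta / (B * p + 1).
have e0 : 0 < e by rewrite divr_gt0.
have eBp : e * B * p <= delta.
  by rewrite /e -mulrA mulrAC ler_pdivrMr// ler_wpM2l ?(ltW de0)// lerDl.
have [C0 HC] := exp_type0_deriv ephi gphi e0.
pose C := Num.max C0 0 * expR (e * cmod (f 0)).
have Cge0 : 0 <= C by rewrite mulr_ge0 ?expR_ge0// le_max lexx orbT.
have dphi z : cmod z < 1 -> cmod (derive1 phi (f z)) <= C * (1 - cmod z) `^ (- (e * B)).
  move=> z1; apply: le_trans (HC _) _.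
  apply: (@le_trans _ _ (Num.max C0 0 * expR (e * cmod (f z)))).
    by rewrite ler_wpM2r ?expR_ge0// le_max lexx.
  rewrite /C -mulrA ler_wpM2l ?le_max ?lexx ?orbT//.
  rewrite /powR gt_eqF ?subr_gt0// -expRD ler_expR.
  have := fB z z1 => h; apply: (@le_trans _ _ (e * (cmod (f 0) - B * ln (1 - cmod z)))).
    by rewrite ler_wpM2l// ltW.
  by rewrite le_eqVlt; apply/orP; left; apply/eqP; ring.
rewrite /disc_integral.
have p20 : 0 <= p - 2 by rewrite subr_ge0.
(* The total negative power of 1-|z|: [e * B * p] from phi' and [p - 2] from the Bloch bound. By the
   choice of [e], [s <= alpha - x]. *)
pose x := e * B * p + (p - 2).
have x0 : 0 <= x := addr_ge0 (mulr_ge0 (mulr_ge0 (ltW e0) B0) (ltW p0)) p20.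
pose K := C `^ p * B `^ (p - 2) * 2 `^ x.
have K0 : 0 <= K by rewrite !mulr_ge0 ?powR_ge0.
apply: (@le_lt_trans _ _ ((pi^-1)%:E * (K%:E *
  \int[mu2]_(w in @discset R)
    ((1 - cmod (w.1 +i* w.2) ^+ 2) `^ s * cmod (derive1 f (w.1 +i* w.2)) ^+ 2)%:E))%E); last first.
  have := Q_space_weighted s0 Qf => Hw.
  by rewrite lte_mul_pinfty ?lee_fin ?invr_ge0 ?pi_ge0// lte_mul_pinfty.
apply: lee_wpmul2l; first by rewrite lee_fin invr_ge0 pi_ge0.
rewrite -ge0_integralZl//; first last.
- by move=> w _; rewrite lee_fin mulr_ge0 ?powR_ge0 ?exprn_ge0 ?cmod_ge0.
- apply/measurable_EFinP; apply: measurable_funM.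
    apply: (measurableT_comp (measurable_powR _)).
    apply: measurable_funB; first exact: measurable_cst.
    apply: measurable_funX; apply: (@measurable_cmod _ _ id); first exact: measurable_discset.
    by move=> w _; exact: cvg_id.
  by apply: measurable_funX; exact: measurable_hol_deriv.
- exact: measurable_discset.
apply: integral_mono => w dw; first by rewrite lee_fin mulr_ge0 ?powR_ge0.
rewrite -EFinM lee_fin.
set z := w.1 +i* w.2 in dw *.
have z1 : cmod z < 1 by [].
rewrite (cdiff_derive1 (cF z z1)) cmodM.
pose v := cmod (derive1 f z).
have v0 : 0 <= v by exact: cmod_ge0.
pose rho := 1 - cmod z.
have rho0 : 0 < rho by rewrite subr_gt0.
pose u := 1 - cmod z ^+ 2.
have u0 : 0 < u by rewrite subr_gt0 expr_lt1// cmod_ge0.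
have u1 : u <= 1 by rewrite gerBl sqr_ge0.
have urho : u / 2 <= rho.
  have : 0 <= (1 - cmod z) ^+ 2 by exact: sqr_ge0.
  have -> : (1 - cmod z) ^+ 2 = 1 - 2 * cmod z + cmod z ^+ 2 by ring.
  by rewrite /u /rho; lra.
have hv : v <= B / rho by rewrite ler_pdivlMr//; exact: HB.
rewrite powRM ?cmod_ge0//.
rewrite -/u.
change (u `^ alpha * (cmod (derive1 phi (f z)) `^ p * v `^ p) <= K * (u `^ s * v ^+ 2)).
have F1 : cmod (derive1 phi (f z)) `^ p <= C `^ p * rho `^ (- (e * B * p)).
  have -> : - (e * B * p) = - (e * B) * p by ring.
  rewrite powRrM -powRM ?powR_ge0//.
  apply: ge0_ler_powR; rewrite ?nnegrE ?(ltW p0) ?cmod_ge0 ?(mulr_ge0 Cge0 (powR_ge0 _ _))//.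
  exact: (dphi z z1).
have F2 : v `^ p <= B `^ (p - 2) * rho `^ (- (p - 2)) * v ^+ 2.
  have -> : v `^ p = v `^ (p - 2) * v ^+ 2.
    rewrite -(@powR_mulrn _ v 2)// -powRD; first by congr (_ `^ _); ring.
    by apply/implyP; rewrite subrK gt_eqF.
  rewrite ler_wpM2r ?sqr_ge0//.
  have -> : rho `^ (- (p - 2)) = (rho^-1) `^ (p - 2).
    by rewrite -powR_inv1 ?(ltW rho0)// -powRrM mulN1r.
  rewrite -powRM ?invr_ge0 ?(ltW rho0)//.
  by apply: ge0_ler_powR; rewrite ?nnegrE ?divr_ge0 ?(ltW rho0).
have F3 : u `^ alpha * rho `^ (- x) <= 2 `^ x * u `^ s.
  have G1 : rho `^ (- x) <= 2 `^ x * u `^ (- x).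
    have u2 : u <= 2 * rho by move: urho; clear; lra.
    have h : u `^ x <= 2 `^ x * rho `^ x.
      rewrite -powRM ?(ltW rho0)//.
      exact: (ge0_ler_powR x0 (ltW u0) (le_trans (ltW u0) u2) u2).
    have ux0 : 0 < u `^ x by rewrite powR_gt0.
    have rx0 : 0 < rho `^ x by rewrite powR_gt0.
    by rewrite !powRN ler_pdivlMr// ler_pdivrMl// mulrC.
  apply: (@le_trans _ _ (u `^ alpha * (2 `^ x * u `^ (- x)))); first by rewrite ler_wpM2l ?powR_ge0.
  rewrite mulrCA ler_wpM2l ?powR_ge0// -powRD; last by rewrite (gt_eqF u0) implybT.
  apply: ger_powR; first by rewrite u0.
  by move: eBp; rewrite /x /delta; move: (e * B * p) => y; clear; lra.
apply: (@le_trans _ _ (u `^ alpha * ((C `^ p * rho `^ (- (e * B * p))) *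
   (B `^ (p - 2) * rho `^ (- (p - 2)) * v ^+ 2)))).
  by rewrite ler_wpM2l ?powR_ge0// ler_pM ?powR_ge0.
have -> : u `^ alpha * ((C `^ p * rho `^ (- (e * B * p))) *
   (B `^ (p - 2) * rho `^ (- (p - 2)) * v ^+ 2)) =
   C `^ p * B `^ (p - 2) * v ^+ 2 * (u `^ alpha * rho `^ (- x)).
  have -> : - x = - (e * B * p) + - (p - 2) by rewrite /x; ring.
  rewrite (@powRD _ rho); last by rewrite (gt_eqF rho0) implybT.
  by ring.
have -> : K * (u `^ s * v ^+ 2) = C `^ p * B `^ (p - 2) * v ^+ 2 * (2 `^ x * u `^ s).
  by rewrite /K; ring.
by rewrite ler_wpM2l// !mulr_ge0 ?powR_ge0 ?sqr_ge0.
Qed.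

End Sufficiency.

(** * Test functions *)

Section LogarithmicGrowth.
Variable R : realType.
Implicit Types (f phi : R[i] -> R[i]) (x y b c d t r g rho : R) (a z w : R[i]).
Notation mu2 := (@lebesgue_measure R \x @lebesgue_measure R)%E.
Notation RR := (measurableTypeR R * measurableTypeR R)%type.

Lemma geometric_nneseries c q : 0 <= c -> 0 <= q < 1 ->
  (\sum_(0 <= k <oo) (c * q ^+ k)%:E <= (c / (1 - q))%:E)%E.
Proof.
move=> c0 /andP[q0 q1]; have q10 : 0 < 1 - q by rewrite subr_gt0.
apply: lime_le.
  by apply: is_cvg_nneseries => n _ _; rewrite lee_fin mulr_ge0// exprn_ge0.
apply: nearW => n; rewrite sumEFin lee_fin.
have -> : \sum_(0 <= k < n) c * q ^+ k = c * (1 - q ^+ n) / (1 - q).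
  elim: n => [|n IH]; first by rewrite big_nil expr0 subrr mulr0 mul0r.
  by rewrite big_nat_recr//= IH exprS; field; rewrite gt_eqF.
rewrite ler_wpM2r ?invr_ge0 ?(ltW q10)// ler_piMr// gerBl exprn_ge0//.
Qed.

Lemma half_pow_small e : 0 < e -> exists n, (1 / 2 : R) ^+ n < e.
Proof.
move=> e0; have e10 : 0 <= e^-1 by rewrite invr_ge0 ltW.
exists (Num.bound e^-1).
rewrite expr_div_n expr1n div1r -[ltRHS]invrK ltf_pV2 ?posrE ?invr_gt0 ?exprn_gt0//.
apply: lt_trans (archi_boundP e10) _.
by rewrite -natrX ltr_nat ltn_expl.
Qed.

Lemma dyadic_inner rho t : 0 < t -> t <= rho ->
  exists k, rho * (1 / 2) ^+ k.+1 <= t /\ t <= rho * (1 / 2) ^+ k.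
Proof.
move=> t0 tr; have rho0 := lt_le_trans t0 tr.
have ex : exists k, rho * (1 / 2) ^+ k.+1 <= t.
  have [n Hn] := half_pow_small (divr_gt0 t0 rho0); exists n.
  rewrite mulrC -ler_pdivlMr//; apply: le_trans (ltW Hn).
  rewrite exprS ler_piMl ?exprn_ge0//; lra.
exists (ex_minn ex); case: ex_minnP => k Hk Hmin; split=> //.
case: k Hk Hmin => [|k] Hk Hmin; first by rewrite expr0 mulr1.
rewrite leNgt; apply/negP => /ltW /Hmin.
by rewrite ltnn.
Qed.

Lemma dyadic_outer rho t : 0 < rho -> rho <= t ->
  exists k, rho * 2 ^+ k / 2 <= t /\ t <= rho * 2 ^+ k.
Proof.
move=> rho0 rt.
have ex : exists k, t <= rho * 2 ^+ k.
  have t0 : 0 <= t / rho by rewrite divr_ge0 ?(ltW rho0)// (le_trans (ltW rho0)).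
  exists (Num.bound (t / rho)); rewrite mulrC -ler_pdivrMr//.
  apply/ltW; apply: lt_trans (archi_boundP t0) _.
  by rewrite -natrX ltr_nat ltn_expl.
exists (ex_minn ex); case: ex_minnP => k Hk Hmin; split=> //.
case: k Hk Hmin => [|k] Hk Hmin; first by rewrite expr0 mulr1; lra.
rewrite exprS mulrCA mulrAC divff// mul1r leNgt; apply/negP => /ltW /Hmin.
by rewrite ltnn.
Qed.

Lemma powR_half_exp g k : ((1 / 2 : R) ^+ k) `^ g = ((1 / 2) `^ g) ^+ k.
Proof.
rewrite -(@powR_mulrn _ (1 / 2)); last by lra.
by rewrite -powRrM [k%:R * g]mulrC powRrM powR_mulrn ?powR_ge0.
Qed.

Lemma powR_2B x g : 0 < x -> x `^ (2 - g) = x ^+ 2 * x `^ (- g).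
Proof.
move=> x0; rewrite powRD; last by rewrite (gt_eqF x0) implybT.
by rewrite (@powR_mulrn _ x 2) ?(ltW x0).
Qed.

Lemma cbox_cmod a r (w : RR) : cmod (w.1 +i* w.2 - a) <= r ->
  box (complex.Re a, complex.Im a) r w.
Proof. by move=> h; apply/cboxE; exact: cmod_sq. Qed.

(* Sums of multiples of indicators of dyadic boxes bound the powers of
   [`|w - a|], which avoids integrating in polar coordinates. *)
Lemma inner_majorant g : 0 <= g < 2 -> exists2 C : R, 0 <= C & forall a rho, 0 < rho ->
  exists S : RR -> \bar R, [/\ measurable_fun setT S, (forall w : RR, 0 <= S w)%E,
    (\int[mu2]_w S w <= (C * rho `^ (2 - g))%:E)%E &
    forall w : RR, 0 < cmod (w.1 +i* w.2 - a) <= rho ->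
      ((cmod (w.1 +i* w.2 - a) `^ (- g))%:E <= S w)%E].
Proof.
move=> /andP[g0 g2].
have q01 : 0 <= (1 / 2 : R) `^ (2 - g) < 1.
  rewrite powR_ge0/= /powR gt_eqF; last lra.
  rewrite expR_lt1 pmulr_rlt0 ?subr_gt0// ln_lt0//; lra.
pose q : R := (1 / 2) `^ (2 - g).
exists (4 * 2 `^ g / (1 - q)).
  by rewrite divr_ge0 ?mulr_ge0 ?powR_ge0// subr_ge0; case/andP: q01 => _ /ltW.
move=> a rho rho0.
have r0 k : 0 < rho * (1 / 2) ^+ k by rewrite mulr_gt0// exprn_gt0//; lra.
pose c k := (rho * (1 / 2) ^+ k.+1) `^ (- g).
have c0 k : 0 <= c k by exact: powR_ge0.
have [S [mS S0 IS HS]] := @box_majorant R (fun=> (complex.Re a, complex.Im a))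
  (fun k => rho * (1 / 2) ^+ k) c (fun k => ltW (r0 k)) c0.
exists S; split=> //.
  rewrite IS.
  have -> : (\sum_(0 <= k <oo) (c k * (4 * (rho * (1 / 2) ^+ k) ^+ 2))%:E =
     \sum_(0 <= k <oo) (4 * 2 `^ g * rho `^ (2 - g) * q ^+ k)%:E)%E.
    apply: eq_eseriesr => k _; congr EFin; rewrite /c /q -powR_half_exp.
    have h1 : (0 : R) <= 1 / 2 by lra.
    have hk : 0 < (1 / 2 : R) ^+ k by rewrite exprn_gt0//; lra.
    rewrite exprS powRM ?(ltW rho0) ?mulr_ge0 ?(ltW hk)// powRM// ?(ltW hk)//.
    have -> : (1 / 2 : R) `^ (- g) = 2 `^ g.
      by rewrite div1r -powR_inv1// -powRrM mulrNN mul1r.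
    rewrite (powR_2B _ rho0) (powR_2B _ hk).
    by ring.
  apply: le_trans (geometric_nneseries _ q01) _.
    by rewrite !mulr_ge0 ?powR_ge0.
  by rewrite lee_fin -/q le_eqVlt; apply/orP; left; apply/eqP; ring.
move=> w /andP[t0 tr]; have [k [k1 k2]] := dyadic_inner t0 tr.
apply: le_trans (HS k w (cbox_cmod k2)).
rewrite lee_fin /c !powRN lef_pV2 ?posrE ?powR_gt0//.
by apply: ge0_ler_powR => //; rewrite nnegrE ?cmod_ge0// ltW.
Qed.

(** The counterpart of [inner_majorant] at infinity: the boxes double in size, and [2 < g] makes the
    geometric ratio smaller than 1. *)
Lemma outer_majorant g : 2 < g -> exists2 C : R, 0 <= C & forall a rho, 0 < rho ->
  exists S : RR -> \bar R, [/\ measurable_fun setT S, (forall w : RR, 0 <= S w)%E,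
    (\int[mu2]_w S w <= (C * rho `^ (2 - g))%:E)%E &
    forall w : RR, rho <= cmod (w.1 +i* w.2 - a) ->
      ((cmod (w.1 +i* w.2 - a) `^ (- g))%:E <= S w)%E].
Proof.
move=> g2; have g0 : 0 <= g by lra.
have q01 : 0 <= (2 : R) `^ (2 - g) < 1.
  rewrite powR_ge0/= /powR gt_eqF//.
  rewrite expR_lt1 pmulr_llt0 ?subr_lt0// ln_gt0//; lra.
pose q : R := 2 `^ (2 - g).
exists (4 * 2 `^ g / (1 - q)).
  by rewrite divr_ge0 ?mulr_ge0 ?powR_ge0// subr_ge0; case/andP: q01 => _ /ltW.
move=> a rho rho0.
have r0 k : 0 < rho * 2 ^+ k by rewrite mulr_gt0// exprn_gt0.
pose c k := (rho * 2 ^+ k / 2) `^ (- g).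
have c0 k : 0 <= c k by exact: powR_ge0.
have [S [mS S0 IS HS]] := @box_majorant R (fun=> (complex.Re a, complex.Im a))
  (fun k => rho * 2 ^+ k) c (fun k => ltW (r0 k)) c0.
exists S; split=> //.
  rewrite IS.
  have -> : (\sum_(0 <= k <oo) (c k * (4 * (rho * 2 ^+ k) ^+ 2))%:E =
     \sum_(0 <= k <oo) (4 * 2 `^ g * rho `^ (2 - g) * q ^+ k)%:E)%E.
    apply: eq_eseriesr => k _; congr EFin; rewrite /c /q.
    have hk : 0 < (2 : R) ^+ k by rewrite exprn_gt0.
    have -> : ((2 : R) `^ (2 - g)) ^+ k = (2 ^+ k) `^ (2 - g).
      by rewrite -(@powR_mulrn _ 2 k)// -powRrM [k%:R * _]mulrC powRrM powR_mulrn ?powR_ge0.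
    rewrite powRM ?invr_ge0 ?(ltW (r0 k))// powRM ?(ltW rho0) ?(ltW hk)//.
    have -> : (2^-1 : R) `^ (- g) = 2 `^ g.
      by rewrite -powR_inv1// -powRrM mulrNN mul1r.
    rewrite (powR_2B _ rho0) (powR_2B _ hk).
    by ring.
  apply: le_trans (geometric_nneseries _ q01) _.
    by rewrite !mulr_ge0 ?powR_ge0.
  by rewrite lee_fin -/q le_eqVlt; apply/orP; left; apply/eqP; ring.
move=> w tr; have [k [k1 k2]] := dyadic_outer rho0 tr.
have t0 := lt_le_trans rho0 tr.
apply: le_trans (HS k w (cbox_cmod k2)).
have h0 : 0 < rho * 2 ^+ k / 2 by rewrite divr_gt0.
rewrite lee_fin /c !powRN lef_pV2 ?posrE ?powR_gt0//.
by apply: ge0_ler_powR => //; rewrite nnegrE ?cmod_ge0// ltW.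
Qed.

(** With [X] the right-hand side, [green_identity] makes [green z a] half of ln(1+X), and ln(1+X) <=
    X. *)
Lemma green_le z a : cmod z < 1 -> cmod a < 1 -> z != a ->
  0 <= green z a <= (1 - cmod a ^+ 2) * (1 - cmod z ^+ 2) / cmod (z - a) ^+ 2.
Proof.
move=> z1 a1 za; have d0 : 0 < cmod (z - a) by rewrite cmod_gt0 subr_eq0.
have d20 : 0 < cmod (z - a) ^+ 2 by rewrite exprn_gt0.
have z2 : 0 < 1 - cmod z ^+ 2 by rewrite subr_gt0 expr_lt1// cmod_ge0.
have a2 : 0 < 1 - cmod a ^+ 2 by rewrite subr_gt0 expr_lt1// cmod_ge0.
set X := (1 - cmod a ^+ 2) * (1 - cmod z ^+ 2) / cmod (z - a) ^+ 2.
have X0 : 0 < X by rewrite divr_gt0// mulr_gt0.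
pose q := cmod (1 - a^* * z) / cmod (z - a).
have q2 : q ^+ 2 = 1 + X.
  by rewrite /q expr_div_n green_identity /X; field; rewrite gt_eqF.
have qge : 0 <= q by rewrite divr_ge0 ?cmod_ge0.
have q1 : 1 <= q by rewrite -(@expr_ge1 _ 2)// q2 lerDl ltW.
have q0 : 0 < q by exact: lt_le_trans q1.
rewrite /green cmodf -/q ln_ge0//=.
have : ln (q ^+ 2) <= X by rewrite q2 le_ln1Dx//; lra.
by rewrite lnXn// mulr2n; have := ln_ge0 q1; lra.
Qed.

Lemma powR_neg_le x y k g : 0 < x -> 0 < k -> x * k <= y -> 0 <= g ->
  y `^ (- g) <= x `^ (- g) * k `^ (- g).
Proof.
move=> x0 k0 xy g0; rewrite -powRM ?(ltW x0) ?(ltW k0)//.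
have xk0 : 0 < x * k by rewrite mulr_gt0.
have y0 : 0 < y by exact: lt_le_trans xy.
rewrite !powRN lef_pV2 ?posrE ?powR_gt0//.
by apply: ge0_ler_powR; rewrite ?nnegrE ?(ltW xk0) ?(ltW y0).
Qed.

(** Here [green_le] is combined with 1-|z|^2 <= 2|1-z| and 1-|a|^2 <= 2|1-a|. What remains has
    singularities at 1 and at [a], of orders [2 - s] and [2 * s]. *)
Lemma log_integrand_le z a s A v : 0 < s -> 0 <= A -> 0 <= v -> cmod z < 1 -> cmod a < 1 ->
  z != 1 -> z != a -> v <= A / cmod (z - 1) ->
  v ^+ 2 * green z a `^ s <= A ^+ 2 * 4 `^ s *
    (cmod (1 - a) `^ s * cmod (z - 1) `^ (- (2 - s)) * cmod (z - a) `^ (- (2 * s))).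
Proof.
move=> s0 A0 v0 z1 a1 z1' za hf1.
pose u := cmod (z - 1); pose d := cmod (z - a); pose rho := cmod (1 - a).
have u0 : 0 < u by rewrite cmod_gt0 subr_eq0.
have d0 : 0 < d by rewrite cmod_gt0 subr_eq0.
have rho0 : 0 <= rho by exact: cmod_ge0.
have hg : green z a <= 4 * (rho * u / d ^+ 2).
  have /andP[_ h] := green_le z1 a1 za; apply: le_trans h _.
  rewrite -/d mulrA ler_wpM2r ?invr_ge0 ?sqr_ge0//.
  have hz : 1 - cmod z ^+ 2 <= 2 * u.
    have h : 1 - cmod z <= u by rewrite /u cmodBC -[1 in X in X <= _]cmod1 cmodB.
    have : (1 - cmod z) * (1 + cmod z) <= u * 2.
      apply: ler_pM => //; [by rewrite subr_ge0 ltW|by rewrite addr_ge0 ?cmod_ge0|].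
      by move: (ltW z1); move: (cmod z) => y; clear; lra.
    have -> : (1 - cmod z) * (1 + cmod z) = 1 - cmod z ^+ 2 by ring.
    by rewrite mulrC.
  have ha : 1 - cmod a ^+ 2 <= 2 * rho.
    have h : 1 - cmod a <= rho by rewrite /rho -[1 in X in X <= _]cmod1 cmodB.
    have : (1 - cmod a) * (1 + cmod a) <= rho * 2.
      apply: ler_pM => //; [by rewrite subr_ge0 ltW|by rewrite addr_ge0 ?cmod_ge0|].
      by move: (ltW a1); move: (cmod a) => y; clear; lra.
    have -> : (1 - cmod a) * (1 + cmod a) = 1 - cmod a ^+ 2 by ring.
    by rewrite mulrC.
  have -> : 4 * (rho * u) = (2 * rho) * (2 * u) by ring.
  by apply: ler_pM => //; rewrite subr_ge0 expr_le1 ?cmod_ge0// ltW.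
change (v ^+ 2 * green z a `^ s <=
  A ^+ 2 * 4 `^ s * (rho `^ s * u `^ (- (2 - s)) * d `^ (- (2 * s)))).
have g0 : 0 <= green z a by have /andP[] := green_le z1 a1 za.
have e1 : v ^+ 2 <= A ^+ 2 * u `^ (- 2).
  rewrite powRN (@powR_mulrn _ u 2) ?(ltW u0)// -expr_div_n.
  by rewrite ler_sqr ?nnegrE ?v0// divr_ge0// ltW.
have e2 : green z a `^ s <= 4 `^ s * (rho `^ s * u `^ s * d `^ (- (2 * s))).
  have -> : 4 `^ s * (rho `^ s * u `^ s * d `^ (- (2 * s))) = (4 * (rho * u / d ^+ 2)) `^ s.
    rewrite powRM//; last exact: divr_ge0 (mulr_ge0 rho0 (ltW u0)) (sqr_ge0 d).
    rewrite powRM ?invr_ge0 ?sqr_ge0//; last exact: mulr_ge0 rho0 (ltW u0).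
    rewrite powRM ?rho0 ?(ltW u0)//.
    rewrite powRN powRrM (@powR_mulrn _ d 2) ?(ltW d0)//.
    by rewrite -(@powR_inv1 _ (d ^+ 2)) ?sqr_ge0// powRAC powR_inv1// powR_ge0.
  apply: ge0_ler_powR; rewrite ?nnegrE ?(ltW s0)//.
  exact: le_trans hg.
apply: (@le_trans _ _ (A ^+ 2 * u `^ (- 2) * (4 `^ s * (rho `^ s * u `^ s * d `^ (- (2 * s)))))).
  by apply: ler_pM => //; rewrite ?sqr_ge0 ?powR_ge0.
have -> : - (2 - s) = - 2 + s by ring.
rewrite (@powRD _ u (- 2)); last by rewrite (gt_eqF u0) implybT.
by rewrite le_eqVlt; apply/orP; left; apply/eqP; ring.
Qed.

(** The disc is split at distance rho/2, rho = |1-a|, into points near 1, points near [a] and the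
    rest. On each part all distances but one are replaced by multiples of rho or of the remaining
    one, leaving an exponent [2 - s], [2 * s] or [2 + s]. The first two are below 2 and the third
    above 2, and in each case the powers of rho cancel, so the bound is uniform in [a]. *)
Lemma Q_space_log f s A : 0 < s < 1 -> Hol_disc f -> 0 <= A ->
  (forall z, cmod z < 1 -> cmod (derive1 f z) * cmod (1 - z) <= A) -> Q_space s f.
Proof.
move=> /andP[s0 s1] hf A0 HA; split=> //.
have [C1 C10 H1] : exists2 C : R, 0 <= C & forall a rho, 0 < rho ->
  exists S : RR -> \bar R, [/\ measurable_fun setT S, (forall w : RR, 0 <= S w)%E,
    (\int[mu2]_w S w <= (C * rho `^ (2 - (2 - s)))%:E)%E &
    forall w : RR, 0 < cmod (w.1 +i* w.2 - a) <= rho ->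
      ((cmod (w.1 +i* w.2 - a) `^ (- (2 - s)))%:E <= S w)%E].
  by apply: inner_majorant; lra.
have [C2 C20 H2] : exists2 C : R, 0 <= C & forall a rho, 0 < rho ->
  exists S : RR -> \bar R, [/\ measurable_fun setT S, (forall w : RR, 0 <= S w)%E,
    (\int[mu2]_w S w <= (C * rho `^ (2 - 2 * s))%:E)%E &
    forall w : RR, 0 < cmod (w.1 +i* w.2 - a) <= rho ->
      ((cmod (w.1 +i* w.2 - a) `^ (- (2 * s)))%:E <= S w)%E].
  by apply: inner_majorant; lra.
have [C3 C30 H3] : exists2 C : R, 0 <= C & forall a rho, 0 < rho ->
  exists S : RR -> \bar R, [/\ measurable_fun setT S, (forall w : RR, 0 <= S w)%E,
    (\int[mu2]_w S w <= (C * rho `^ (2 - (2 + s)))%:E)%E &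
    forall w : RR, rho <= cmod (w.1 +i* w.2 - a) ->
      ((cmod (w.1 +i* w.2 - a) `^ (- (2 + s)))%:E <= S w)%E].
  by apply: outer_majorant; lra.
pose K : R := A ^+ 2 * 4 `^ s.
have K0 : 0 <= K by rewrite mulr_ge0 ?sqr_ge0 ?powR_ge0.
pose h2 : R := (1 / 2) `^ (- (2 * s)).
pose h3 : R := (1 / 2) `^ (- (2 - s)).
pose h4 : R := (1 / 4) `^ (- (2 * s)).
pose h5 : R := (1 / 2) `^ (- s).
have [h20 h30 h40 h50] : [/\ 0 <= h2, 0 <= h3, 0 <= h4 & 0 <= h5].
  by split; exact: powR_ge0.
pose B := K * h2 * C1 + K * h3 * C2 + K * h4 * h5 * C3.
suff HB a : unit_disc a -> (\int[mu2]_(w in @discset R)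
     (cmod (derive1 f (w.1 +i* w.2)) ^+ 2 * green (w.1 +i* w.2) a `^ s)%:E <= B%:E)%E.
  apply: (@le_lt_trans _ _ ((pi^-1)%:E * B%:E)%E); last by rewrite -EFinM ltry.
  apply: ge_ereal_sup => _ [a /HB Ha <-].
  by rewrite /disc_integral lee_wpmul2l// lee_fin invr_ge0 pi_ge0.
move=> a1; pose rho := cmod (1 - a).
have rho0 : 0 < rho.
  rewrite cmod_gt0 subr_eq0; apply/eqP => E; move: a1; rewrite /unit_disc /= -E cmod1.
  by rewrite ltxx.
have [S1 [mS1 S10 IS1 HS1]] := H1 1 rho rho0.
have [S2 [mS2 S20 IS2 HS2]] := H2 a rho rho0.
have rho20 : 0 < rho / 2 by rewrite divr_gt0.
have [S3 [mS3 S30 IS3 HS3]] := H3 1 (rho / 2) rho20.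
pose k1 := K * h2 * rho `^ (- s).
pose k2 := K * h3 * rho `^ (2 * s - 2).
pose k3 := K * h4 * rho `^ s.
have k10 : 0 <= k1 := mulr_ge0 (mulr_ge0 K0 h20) (powR_ge0 _ _).
have k20 : 0 <= k2 := mulr_ge0 (mulr_ge0 K0 h30) (powR_ge0 _ _).
have k30 : 0 <= k3 := mulr_ge0 (mulr_ge0 K0 h40) (powR_ge0 _ _).
pose T (w : RR) : \bar R := (k1%:E * S1 w + (k2%:E * S2 w + k3%:E * S3 w))%E.
have T1 (w : RR) : (0 <= k1%:E * S1 w)%E by rewrite mule_ge0 ?lee_fin.
have T2 (w : RR) : (0 <= k2%:E * S2 w)%E by rewrite mule_ge0 ?lee_fin.
have T3 (w : RR) : (0 <= k3%:E * S3 w)%E by rewrite mule_ge0 ?lee_fin.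
have T0 (w : RR) : (0 <= T w)%E by rewrite /T !adde_ge0.
have mT1 : measurable_fun setT (fun w : RR => k1%:E * S1 w)%E by exact: measurable_funeM.
have mT2 : measurable_fun setT (fun w : RR => k2%:E * S2 w)%E by exact: measurable_funeM.
have mT3 : measurable_fun setT (fun w : RR => k3%:E * S3 w)%E by exact: measurable_funeM.
have IT : (\int[mu2]_w T w <= B%:E)%E.
  rewrite ge0_integralD//; last first.
  - exact: emeasurable_funD.
  - by move=> w _; rewrite adde_ge0.
  rewrite ge0_integralD// !ge0_integralZl//.
  rewrite /B -addrA 2!EFinD; apply: leeD; [|apply: leeD].
  - apply: le_trans (lee_wpmul2l _ IS1) _; first by rewrite lee_fin.
    rewrite -EFinM lee_fin /k1.
    have -> : 2 - (2 - s) = s by ring.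
    have -> : K * h2 * rho `^ (- s) * (C1 * rho `^ s) = K * h2 * C1.
      by rewrite powRN; field; rewrite gt_eqF// powR_gt0.
    by [].
  - apply: le_trans (lee_wpmul2l _ IS2) _; first by rewrite lee_fin.
    rewrite -EFinM lee_fin /k2.
    have -> : 2 * s - 2 = - (2 - 2 * s) by ring.
    have -> : K * h3 * rho `^ (- (2 - 2 * s)) * (C2 * rho `^ (2 - 2 * s)) = K * h3 * C2.
      by rewrite powRN; field; rewrite gt_eqF// powR_gt0.
    by [].
  - apply: le_trans (lee_wpmul2l _ IS3) _; first by rewrite lee_fin.
    rewrite -EFinM lee_fin /k3.
    have -> : 2 - (2 + s) = - s by ring.
    have -> : (rho / 2) `^ (- s) = rho `^ (- s) * h5.
      by rewrite -powRM ?(ltW rho0)//; congr (_ `^ _); ring.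
    have -> : K * h4 * rho `^ s * (C3 * (rho `^ (- s) * h5)) = K * h4 * h5 * C3.
      by rewrite powRN; field; rewrite gt_eqF// powR_gt0.
    by [].
apply: le_trans IT.
apply: (@le_trans _ _ (\int[mu2]_(w in @discset R) T w)%E); last first.
  exact: integral_mono_set.
apply: integral_mono => w dw.
  by rewrite lee_fin mulr_ge0 ?sqr_ge0 ?powR_ge0.
set z := w.1 +i* w.2 in dw *.
have z1 : cmod z < 1 by [].
(* At the pole the quotient, its logarithm and then the integrand are 0. *)
have [za|za] := eqVneq z a.
  rewrite za /green subrr invr0 mulr0 cmod0 ln0// powR0 ?gt_eqF// mulr0.
  exact: T0.
pose u := cmod (z - 1); pose d := cmod (z - a).
have u0 : 0 < u.
  rewrite cmod_gt0 subr_eq0; apply/eqP => E; move: z1; rewrite E cmod1.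
  by rewrite ltxx.
have d0 : 0 < d by rewrite cmod_gt0 subr_eq0.
have hf1 : cmod (derive1 f z) <= A / u.
  by rewrite ler_pdivlMr//; have := HA z z1; rewrite /u cmodBC.
have z11 : z != 1 by rewrite -subr_eq0 -cmod_gt0.
have hH := log_integrand_le s0 A0 (cmod_ge0 _) z1 a1 z11 za hf1.
move: hH; rewrite -lee_fin => hH; apply: (le_trans hH); clear hH.
have tri : rho <= u + d.
  have := cmodD (z - a) (1 - z); rewrite /rho /u /d [cmod (z - 1)]cmodBC.
  have -> : z - a + (1 - z) = 1 - a by ring.
  by rewrite [X in _ <= X -> _]addrC.
have k20' : 0 < (1 / 2 : R) by rewrite divr_gt0.
have E2 (x : R) : x * (1 / 2) = x / 2 by rewrite div1r.
clear hf1 H1 H2 H3 IS1 IS2 IS3 HA mT1 mT2 mT3 mS1 mS2 mS3.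
(* Near 1, the distance [d] to the pole is at least [rho / 2]. *)
have [ul|ul] := leP u (rho / 2).
  apply: (@le_trans _ _ (k1%:E * S1 w)%E); last by rewrite /T leeDl// adde_ge0.
  apply: (@le_trans _ _ (k1%:E * (u `^ (- (2 - s)))%:E)%E); last first.
    rewrite lee_wpmul2l ?lee_fin//; apply: HS1; rewrite -/u u0/=; move: ul rho0; clear; lra.
  have h : d `^ (- (2 * s)) <= rho `^ (- (2 * s)) * h2.
    apply: powR_neg_le => //; first by rewrite E2; move: tri ul; clear; lra.
    by rewrite mulr_ge0// ltW.
  rewrite -EFinM lee_fin.
  have -> : k1 * u `^ (- (2 - s)) = K * (rho `^ s * u `^ (- (2 - s)) * (rho `^ (- (2 * s)) * h2)).
    rewrite /k1; have -> : - s = s + - (2 * s) by ring.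
    rewrite (@powRD _ rho); last by rewrite (gt_eqF rho0) implybT.
    by ring.
  by rewrite ler_wpM2l// ler_wpM2l// mulr_ge0 ?powR_ge0.
(* Near the pole, the distance [u] to 1 is at least [rho / 2]. *)
have [dl|dl] := leP d (rho / 2).
  apply: (@le_trans _ _ (k2%:E * S2 w)%E).
    apply: (@le_trans _ _ (k2%:E * (d `^ (- (2 * s)))%:E)%E); last first.
      rewrite lee_wpmul2l ?lee_fin//; apply: HS2; rewrite -/d d0/=; move: dl rho0; clear; lra.
    have h : u `^ (- (2 - s)) <= rho `^ (- (2 - s)) * h3.
      apply: powR_neg_le => //; first by rewrite E2 ltW.
      by move: s1; clear; lra.
    rewrite -EFinM lee_fin.
    have -> : k2 * d `^ (- (2 * s)) = K * (rho `^ s * (rho `^ (- (2 - s)) * h3) * d `^ (- (2 * s))).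
      rewrite /k2; have -> : 2 * s - 2 = s + - (2 - s) by ring.
      rewrite (@powRD _ rho); last by rewrite (gt_eqF rho0) implybT.
      by ring.
    by rewrite ler_wpM2l// ler_wpM2r ?powR_ge0// ler_wpM2l ?powR_ge0.
  rewrite /T; apply: (@le_trans _ _ (k2%:E * S2 w + k3%:E * S3 w)%E); first by rewrite leeDl.
  by rewrite leeDr.
apply: (@le_trans _ _ (k3%:E * S3 w)%E); last first.
  rewrite /T; apply: (@le_trans _ _ (k2%:E * S2 w + k3%:E * S3 w)%E); first by rewrite leeDr.
  by rewrite leeDr.
apply: (@le_trans _ _ (k3%:E * (u `^ (- (2 + s)))%:E)%E); last first.
  rewrite lee_wpmul2l ?lee_fin//; apply: HS3; rewrite -/u; exact: ltW.
have tri2 : u <= rho + d.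
  have := cmodD (a - 1) (z - a); rewrite /rho /u /d [cmod (1 - a)]cmodBC.
  have -> : a - 1 + (z - a) = z - 1 by ring.
  by [].
(* Far from both, [u <= rho + d] and [rho < 2 * d] give [u < 3 * d], so [d] may be replaced by
   [u / 4]. *)
have hd : d `^ (- (2 * s)) <= u `^ (- (2 * s)) * h4.
  apply: powR_neg_le => //; first by move: tri2 ul dl; clear; lra.
  by rewrite mulr_ge0// ltW.
rewrite -EFinM lee_fin.
have -> : k3 * u `^ (- (2 + s)) = K * (rho `^ s * u `^ (- (2 - s)) * (u `^ (- (2 * s)) * h4)).
  rewrite /k3; have -> : - (2 + s) = - (2 - s) + - (2 * s) by ring.
  rewrite (@powRD _ u); last by rewrite (gt_eqF u0) implybT.
  by ring.
by rewrite ler_wpM2l// ler_wpM2l// mulr_ge0 ?powR_ge0.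
Qed.

End LogarithmicGrowth.

(** * The family of test functions and its derivatives *)

Section TestFunctions.
Variable R : realType.
Implicit Types (f phi : R[i] -> R[i]) (x y c d t r M B : R) (a z w h : R[i])
  (u v : nat -> R[i]) (n N L : nat).

Definition eps n : R := (1 / 2) ^+ n.

Lemma eps_gt0 n : 0 < eps n.
Proof. by rewrite exprn_gt0// divr_gt0. Qed.

Lemma eps_le1 n : eps n <= 1.
Proof. by rewrite exprn_ile1//; lra. Qed.

Lemma epsS n : eps n.+1 = eps n / 2.
Proof. by rewrite /eps exprS; ring. Qed.

Lemma le_eps n N : (n <= N)%N -> eps N <= eps n.
Proof. by move=> nN; apply: ler_wiXn2l => //; lra. Qed.

Lemma eps_small x : 0 < x -> exists n, eps n < x.
Proof. exact: half_pow_small. Qed.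

Definition psum u N : R[i] := \sum_(0 <= n < N) u n.

Lemma psumS u N : psum u N.+1 = psum u N + u N.
Proof. by rewrite /psum big_nat_recr. Qed.

(* Only sequences dominated by a multiple of [eps] are summed; otherwise the value
   is junk. *)
Definition csum u : R[i] := xget 0 [set S | exists M, forall N,
  cmod (S - psum u N) <= M * eps N].

Lemma eps_unique z w : (exists M, forall N, cmod (z - w) <= M * eps N) -> z = w.
Proof.
move=> [M HM]; apply/eqP; rewrite -subr_eq0 -cmod_eq0; apply/eqP/le_anti.
rewrite cmod_ge0 andbT leNgt; apply/negP => c0.
have M0 : 0 < M by have := HM 0%N; rewrite /eps expr0 mulr1; exact: lt_le_trans.
have [n Hn] := eps_small (divr_gt0 c0 M0).
by have := HM n; rewrite leNgt mulrC -ltr_pdivlMr// Hn.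
Qed.

Lemma csum_unique u S M : (forall N, cmod (S - psum u N) <= M * eps N) -> csum u = S.
Proof.
move=> HS; rewrite /csum.
case: xgetP => [T _ [M' HT]|/(_ S) /=]; last by case; exists M.
apply: eps_unique; exists (M' + M) => N.
have -> : T - S = (T - psum u N) + (psum u N - S) by ring.
apply: le_trans (cmodD _ _) _; rewrite [cmod (_ - S)]cmodBC mulrDl.
exact: lerD.
Qed.

(** The intervals of radius [2 * M * eps N] about the partial sums are nested, because [eps] halves
    at each step. The supremum of their left ends is the sum, and the rate of convergence comes for
    free. *)
Lemma real_series_limit (r : nat -> R) M : (forall n, `|r n| <= M * eps n) ->
  exists S, forall N, `|S - \sum_(0 <= n < N) r n| <= 2 * M * eps N.
Proof.
move=> Hr; have M0 : 0 <= M by have := Hr 0%N; rewrite /eps expr0 mulr1; exact: le_trans.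
pose s N := \sum_(0 <= n < N) r n.
have sS N : s N.+1 = s N + r N by rewrite /s big_nat_recr.
have mono N k : s N - 2 * M * eps N <= s (N + k)%N - 2 * M * eps (N + k)%N /\
   s (N + k)%N + 2 * M * eps (N + k)%N <= s N + 2 * M * eps N.
  elim: k => [|k [IH1 IH2]]; first by rewrite addn0.
  rewrite addnS sS epsS; have := Hr (N + k)%N; rewrite ler_norml => /andP[h1 h2].
  split; lra.
have cross N m : s N - 2 * M * eps N <= s m + 2 * M * eps m.
  have e0 n : 0 <= M * eps n by rewrite mulr_ge0// ltW// eps_gt0.
  have [Nm|mN] := leqP N m.
    by have [h _] := mono N (m - N)%N; rewrite subnKC// in h; have := e0 m; lra.
  by have [_ h] := mono m (N - m)%N; rewrite subnKC ?(ltnW mN)// in h; have := e0 N; lra.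
pose A : set R := range (fun N => s N - 2 * M * eps N).
have hA : has_sup A.
  split; first by exists (s 0%N - 2 * M * eps 0), 0%N.
  by exists (s 0%N + 2 * M * eps 0) => _ [m _ <-]; exact: cross.
exists (sup A) => N; rewrite -/(s N) ler_distl; apply/andP; split.
  by apply: ub_le_sup; [case: hA|exists N].
by apply: ge_sup; [case: hA|move=> _ [m _ <-]; exact: cross].
Qed.

Lemma RePsum u N : complex.Re (psum u N) = \sum_(0 <= n < N) complex.Re (u n).
Proof.
elim: N => [|N IH]; first by rewrite /psum !big_nil.
by rewrite psumS cReD IH big_nat_recr.
Qed.

Lemma ImPsum u N : complex.Im (psum u N) = \sum_(0 <= n < N) complex.Im (u n).
Proof.
elim: N => [|N IH]; first by rewrite /psum !big_nil.
by rewrite psumS cImD IH big_nat_recr.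
Qed.

Definition dom u M := forall n, cmod (u n) <= M * eps n.

Lemma csum_approx u M : dom u M -> forall N, cmod (csum u - psum u N) <= 4 * M * eps N.
Proof.
move=> Hu.
have [S1 H1] : exists S, forall N, `|S - \sum_(0 <= n < N) complex.Re (u n)| <= 2 * M * eps N.
  by apply: real_series_limit => n; apply: le_trans (Re_le_cmod _) (Hu n).
have [S2 H2] : exists S, forall N, `|S - \sum_(0 <= n < N) complex.Im (u n)| <= 2 * M * eps N.
  by apply: real_series_limit => n; apply: le_trans (Im_le_cmod _) (Hu n).
have H N : cmod ((S1 +i* S2) - psum u N) <= 4 * M * eps N.
  apply: le_trans (cmod_le_ReIm _) _; rewrite cReD cReN cImD cImN RePsum ImPsum /=.
  by have := lerD (H1 N) (H2 N); lra.
by rewrite (csum_unique H).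
Qed.

Lemma csum_lin u v (k : R[i]) M M' : dom u M -> dom v M' ->
  csum (fun n => u n + k * v n) = csum u + k * csum v.
Proof.
move=> Hu Hv; apply: (@csum_unique _ _ (4 * M + cmod k * (4 * M'))) => N.
have -> : psum (fun n => u n + k * v n) N = psum u N + k * psum v N.
  by rewrite /psum big_split/= mulr_sumr.
have -> : csum u + k * csum v - (psum u N + k * psum v N) =
  (csum u - psum u N) + k * (csum v - psum v N) by ring.
apply: le_trans (cmodD _ _) _; rewrite mulrDl cmodM -[cmod k * _ * _]mulrA.
by apply: lerD; [exact: csum_approx|rewrite ler_wpM2l ?cmod_ge0//; exact: csum_approx].
Qed.

Lemma dom_ge0 u M : dom u M -> 0 <= M.
Proof. by move=> /(_ 0%N); rewrite /eps expr0 mulr1; apply: le_trans; exact: cmod_ge0. Qed.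

Lemma csum_le u M : dom u M -> cmod (csum u) <= 4 * M.
Proof.
move=> /csum_approx/(_ 0%N); rewrite /psum big_nil subr0 /eps expr0 mulr1.
exact.
Qed.

(** Separates convergence from size: [M] may be large, as it is for the derivative of a test
    function near 1, while [B] comes from the partial sums of moduli. *)
Lemma csum_bound u M B : dom u M -> (forall N, \sum_(0 <= n < N) cmod (u n) <= B) ->
  cmod (csum u) <= B.
Proof.
move=> Hu HB; have M0 := dom_ge0 Hu.
apply/ler_addgt0Pl => e e0.
have M1 : 0 < 4 * M + 1 by rewrite ltr_wpDl// mulr_ge0.
have [n Hn] := eps_small (divr_gt0 e0 M1).
have -> : csum u = (csum u - psum u n) + psum u n by ring.
apply: le_trans (cmodD _ _) _; apply: lerD.
  apply: le_trans (csum_approx Hu n) _.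
  rewrite ltr_pdivlMr// in Hn; have := eps_gt0 n; lra.
apply: le_trans (HB n).
elim: n {Hn} => [|n IH]; first by rewrite /psum !big_nil cmod0.
by rewrite psumS big_nat_recr//=; apply: le_trans (cmodD _ _) _; rewrite lerD2r.
Qed.

Lemma csum_fin u M N : dom u M -> (forall n, (N <= n)%N -> u n = 0) -> csum u = psum u N.
Proof.
move=> Hu H0; apply: eps_unique; exists (4 * M) => K.
have -> : psum u N = psum u (N + K)%N.
  elim: K => [|K IH]; first by rewrite addn0.
  by rewrite addnS psumS H0 ?leq_addr// addr0.
apply: le_trans (csum_approx Hu _) _.
by rewrite ler_wpM2l ?(mulr_ge0 (ler0n R 4) (dom_ge0 Hu))// le_eps// leq_addl.
Qed.

(* [eps n / (1 + eps n - x)] is close to 1 when [1 - x] is much smaller than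
   [eps n] and to 0 when it is much larger, so that with [v] constant the sum
   behaves like [v] times the logarithm of [1 / (1 - x)]. *)
Definition test_fun v z := csum (fun n => v n * ((eps n)%:C / (1 + (eps n)%:C - z))).
Definition test_fun_deriv v z := csum (fun n => v n * ((eps n)%:C / (1 + (eps n)%:C - z) ^+ 2)).

(** The cross term in the square of the modulus is [2 * eps n * (1 - Re z)], which is nonnegative in
    the disc. *)
Lemma den_ge n z : cmod z < 1 ->
  eps n ^+ 2 + cmod (1 - z) ^+ 2 <= cmod (1 + (eps n)%:C - z) ^+ 2.
Proof.
move=> z1; have x1 : complex.Re z <= 1.
  by apply: le_trans (ltW z1); apply: le_trans (ler_norm _) (Re_le_cmod _).
rewrite !sqr_cmod !(cReD, cImD, cReN, cImN) /=.
have e0 := eps_gt0 n.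
have : 0 <= eps n * (1 - complex.Re z) by rewrite mulr_ge0 ?(ltW e0)// subr_ge0.
lra.
Qed.

Lemma cmod_1B_gt0 z : cmod z < 1 -> 0 < cmod (1 - z).
Proof.
by move=> z1; rewrite cmod_gt0 subr_eq0; apply/eqP => E; move: z1; rewrite -E cmod1 ltxx.
Qed.

Lemma den_ge1 n z : cmod z < 1 -> cmod (1 - z) <= cmod (1 + (eps n)%:C - z).
Proof.
move=> z1; rewrite -ler_sqr ?nnegrE ?cmod_ge0//; apply: le_trans (den_ge n z1).
by rewrite lerDr sqr_ge0.
Qed.

Lemma den_neq0 n z : cmod z < 1 -> 1 + (eps n)%:C - z != 0.
Proof. by move=> z1; rewrite -cmod_gt0 (lt_le_trans (cmod_1B_gt0 z1))// den_ge1. Qed.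

Definition bounded_by c v := forall n, cmod (v n) <= c.

Lemma cmod_eps n : cmod (eps n)%:C = eps n.
Proof. by rewrite cmodR ger0_norm// ltW// eps_gt0. Qed.

Lemma dom_test_fun c v z : bounded_by c v -> cmod z < 1 ->
  dom (fun n => v n * ((eps n)%:C / (1 + (eps n)%:C - z))) (c / cmod (1 - z)).
Proof.
move=> Hv z1 n; have d0 := cmod_1B_gt0 z1.
rewrite !cmodM cmodV cmod_eps -mulrA [_^-1 * eps n]mulrC.
apply: ler_pM => //; first exact: cmod_ge0.
  by rewrite mulr_ge0 ?(ltW (eps_gt0 n))// invr_ge0 cmod_ge0.
rewrite ler_wpM2l ?(ltW (eps_gt0 n))// lef_pV2 ?posrE//; first exact: den_ge1.
exact: lt_le_trans (den_ge1 n z1).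
Qed.

Lemma dom_test_fun_deriv c v z : bounded_by c v -> cmod z < 1 ->
  dom (fun n => v n * ((eps n)%:C / (1 + (eps n)%:C - z) ^+ 2)) (c / cmod (1 - z) ^+ 2).
Proof.
move=> Hv z1 n; have d0 := cmod_1B_gt0 z1.
rewrite cmodM cmodf cmodX cmod_eps -mulrA [_^-1 * eps n]mulrC.
have k0 : 0 < cmod (1 + (eps n)%:C - z) by apply: lt_le_trans (den_ge1 n z1).
apply: ler_pM => //; first exact: cmod_ge0.
  by rewrite divr_ge0 ?(ltW (eps_gt0 n))// exprn_ge0// cmod_ge0.
rewrite ler_wpM2l ?(ltW (eps_gt0 n))// lef_pV2 ?posrE ?exprn_gt0//.
by rewrite ler_sqr ?nnegrE ?cmod_ge0// den_ge1.
Qed.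

(** Termwise differentiation with an explicit remainder: 1/(k-h) - 1/k - h/k^2 = h^2/(k^2(k-h)),
    where |k| >= d and |k-h| >= d/2 for all [n] at once, so the remainders sum to O(|h|^2). *)
Lemma test_fun_cdiff c v z : bounded_by c v -> cmod z < 1 -> cdiff (test_fun v) z (test_fun_deriv v z).
Proof.
move=> Hv z1; pose d := cmod (1 - z); have d0 : 0 < d := cmod_1B_gt0 z1.
have c0 : 0 <= c := le_trans (cmod_ge0 _) (Hv 0%N).
(* The remainders are dominated by [2 * c * cmod h ^+ 2 / d ^+ 3] times [eps], and [csum_le]
   multiplies this by 4; the summand 1 keeps [K] positive when [c = 0]. *)
move=> e e0; pose K := 8 * c / d ^+ 3 + 1.
have K0 : 0 < K.
  by apply: ltr_wpDl => //; exact: divr_ge0 (mulr_ge0 (ler0n R 8) c0) (exprn_ge0 3 (ltW d0)).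
exists (Num.min (Num.min (d / 2) (1 - cmod z)) (e / K)).
  by rewrite !lt_min !divr_gt0// subr_gt0 z1.
move=> h; rewrite !lt_min => /andP[/andP[h1 h2] h3].
have zh1 : cmod (z + h) < 1 by apply: le_lt_trans (cmodD _ _) _; lra.
have D1 := dom_test_fun Hv zh1; have D2 := dom_test_fun Hv z1; have D3 := dom_test_fun_deriv Hv z1.
pose T n := v n * ((eps n)%:C / (1 + (eps n)%:C - (z + h))) +
   -1 * (v n * ((eps n)%:C / (1 + (eps n)%:C - z)) +
         h * (v n * ((eps n)%:C / (1 + (eps n)%:C - z) ^+ 2))).
have D23 : dom (fun n => v n * ((eps n)%:C / (1 + (eps n)%:C - z)) +
         h * (v n * ((eps n)%:C / (1 + (eps n)%:C - z) ^+ 2)))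
   (c / cmod (1 - z) + cmod h * (c / cmod (1 - z) ^+ 2)).
  move=> n; apply: le_trans (cmodD _ _) _; rewrite [cmod (h * _)]cmodM mulrDl -[cmod h * _ * _]mulrA.
  exact: lerD (D2 n) (ler_wpM2l (cmod_ge0 h) (D3 n)).
have E : test_fun v (z + h) - test_fun v z - test_fun_deriv v z * h = csum T.
  rewrite /T (csum_lin _ D1 D23) (csum_lin _ D2 D3) /test_fun /test_fun_deriv.
  by ring.
have DT : dom T (2 * c * cmod h ^+ 2 / d ^+ 3).
  move=> n; set k := 1 + (eps n)%:C - z.
  have kd : d <= cmod k := den_ge1 n z1.
  have k0 : k != 0 := den_neq0 n z1.
  have kh0 : 1 + (eps n)%:C - (z + h) != 0 := den_neq0 n zh1.
  have khd : d / 2 <= cmod (k - h).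
    by have := cmodB k h; lra.
  have -> : T n = v n * ((eps n)%:C * (h ^+ 2 / (k ^+ 2 * (k - h)))).
    have kE : 1 + (eps n)%:C - (z + h) = k - h by rewrite /k; ring.
    rewrite /T kE -/k; rewrite kE in kh0; move: k0 kh0; clear.
    by move: (v n) ((eps n)%:C) => q r k0 kh0; field; rewrite k0 kh0.
  rewrite !cmodM cmodV cmodM !cmodX cmod_eps.
  have k20 : 0 < cmod k ^+ 2 * cmod (k - h).
    by rewrite mulr_gt0 ?exprn_gt0 ?(lt_le_trans d0 kd)// (lt_le_trans _ khd)// divr_gt0.
  have -> : 2 * c * cmod h ^+ 2 / d ^+ 3 * eps n = c * (eps n * (cmod h ^+ 2 * (2 / d ^+ 3))).
    by ring.
  apply: ler_pM => //; first exact: cmod_ge0.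
    by rewrite mulr_ge0 ?(ltW (eps_gt0 n))// mulr_ge0 ?sqr_ge0// invr_ge0 ltW.
  rewrite ler_wpM2l ?(ltW (eps_gt0 n))// ler_wpM2l ?sqr_ge0//.
  have -> : 2 / d ^+ 3 = (d ^+ 2 * (d / 2))^-1 by field; rewrite gt_eqF.
  rewrite lef_pV2 ?posrE//; last by rewrite mulr_gt0 ?exprn_gt0// divr_gt0.
  apply: ler_pM => //; [by rewrite sqr_ge0|by rewrite divr_ge0// ltW|].
  by rewrite ler_sqr ?nnegrE ?cmod_ge0// ltW.
rewrite E; apply: le_trans (csum_le DT) _.
have -> : 4 * (2 * c * cmod h ^+ 2 / d ^+ 3) = 8 * c / d ^+ 3 * cmod h * cmod h by ring.
rewrite ler_wpM2r ?cmod_ge0//.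
have : cmod h * K < e by rewrite -ltr_pdivlMr.
rewrite /K mulrDr mulr1 => hK.
have := cmod_ge0 h; lra.
Qed.

Lemma test_fun_hol c v : bounded_by c v -> Hol_disc (test_fun v).
Proof. by move=> Hv z z1; exact: cdiff_derivable (test_fun_cdiff Hv z1). Qed.

(** By [den_ge] a term is at most [c * eps n / (eps n ^+ 2 + d ^+ 2)], and this is at most [4 * c]
    times the increment of [(eps n + d)^-1] from [n] to [n.+1]. The sum telescopes to at most
    [4 * c / d]. *)
Lemma test_fun_deriv_bound c v z : bounded_by c v -> cmod z < 1 -> cmod (test_fun_deriv v z) * cmod (1 - z) <= 4 * c.
Proof.
move=> Hv z1; pose d := cmod (1 - z); have d0 : 0 < d := cmod_1B_gt0 z1.
have c0 : 0 <= c := le_trans (cmod_ge0 _) (Hv 0%N).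
rewrite -ler_pdivlMr//; apply: (csum_bound (dom_test_fun_deriv Hv z1)) => N.
have ed n : 0 < eps n + d by rewrite addr_gt0 ?eps_gt0.
apply: (@le_trans _ _ (4 * c * ((eps N + d)^-1 - (eps 0 + d)^-1))); last first.
  rewrite -/d ler_wpM2l ?mulr_ge0// lerBlDr.
  apply: (@le_trans _ _ d^-1); first by rewrite lef_pV2 ?posrE// lerDr ltW// eps_gt0.
  by rewrite lerDl invr_ge0 ltW.
elim: N => [|N IH]; first by rewrite big_nil subrr mulr0.
rewrite big_nat_recr//=.
have -> : 4 * c * ((eps N.+1 + d)^-1 - (eps 0 + d)^-1) =
  4 * c * ((eps N + d)^-1 - (eps 0 + d)^-1) + 4 * c * ((eps N.+1 + d)^-1 - (eps N + d)^-1).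
  by ring.
apply: lerD => //.
have e0 := eps_gt0 N; have edN := ed N; have edS := ed N.+1.
rewrite cmodM cmodf cmodX cmod_eps.
have -> : 4 * c * ((eps N.+1 + d)^-1 - (eps N + d)^-1) =
  c * (eps N * (2 / ((eps N.+1 + d) * (eps N + d)))).
  by rewrite epsS in edS *; field; rewrite !gt_eqF//; lra.
apply: ler_pM => //; first exact: cmod_ge0.
  by rewrite divr_ge0 ?(ltW e0)// sqr_ge0.
rewrite ler_wpM2l ?(ltW e0)//.
have k2 := den_ge N z1; rewrite -/d in k2.
have kk : 0 < cmod (1 + (eps N)%:C - z) ^+ 2.
  by apply: lt_le_trans k2; rewrite ltr_pwDl ?sqr_ge0// exprn_gt0.
rewrite -[leLHS]mul1r ler_pdivrMr// mulrAC ler_pdivlMr ?mulr_gt0// mul1r.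
apply: (@le_trans _ _ (2 * (eps N ^+ 2 + d ^+ 2))); last by rewrite ler_wpM2l.
have : 0 <= (eps N - d) ^+ 2 by exact: sqr_ge0.
have -> : (eps N - d) ^+ 2 = eps N ^+ 2 - 2 * (eps N * d) + d ^+ 2 by ring.
have -> : (eps N.+1 + d) * (eps N + d) =
  eps N ^+ 2 / 2 + eps N * d + eps N * d / 2 + d ^+ 2 by rewrite epsS; ring.
have : 0 <= eps N ^+ 2 by exact: sqr_ge0.
have : 0 <= d ^+ 2 by exact: sqr_ge0.
lra.
Qed.

Lemma test_fun_Q c v s : 0 < s < 1 -> bounded_by c v -> Q_space s (test_fun v).
Proof.
move=> s01 Hv; have c0 : 0 <= c := le_trans (cmod_ge0 _) (Hv 0%N).
apply: (@Q_space_log _ _ _ (4 * c) s01 (test_fun_hol Hv)); first by rewrite mulr_ge0.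
move=> z z1; rewrite (cdiff_derive1 (test_fun_cdiff Hv z1)).
exact: test_fun_deriv_bound.
Qed.

(** Continuity of the value at a fixed point [z] with respect to finite prefixes of [v]; it makes
    the bad sets in Baire's theorem open. *)
Lemma test_fun_agree c v v' z L : bounded_by c v -> bounded_by c v' -> cmod z < 1 ->
  (forall n, (n < L)%N -> v' n = v n) ->
  cmod (test_fun v' z - test_fun v z) <= 8 * (c / cmod (1 - z)) * eps L.
Proof.
move=> Hv Hv' z1 agr.
have A1 := csum_approx (dom_test_fun Hv z1) L; have A2 := csum_approx (dom_test_fun Hv' z1) L.
have E : psum (fun n => v' n * ((eps n)%:C / (1 + (eps n)%:C - z))) L =
  psum (fun n => v n * ((eps n)%:C / (1 + (eps n)%:C - z))) L.
  by apply: eq_big_nat => n /andP[_ nL]; rewrite agr.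
rewrite E in A2; rewrite -/(test_fun v z) in A1; rewrite -/(test_fun v' z) in A2.
set P := psum _ _ in A1 A2.
have -> : test_fun v' z - test_fun v z = (test_fun v' z - P) + (P - test_fun v z) by ring.
apply: le_trans (cmodD _ _) _; rewrite [cmod (P - _)]cmodBC.
have -> : 8 * (c / cmod (1 - z)) * eps L =
  4 * (c / cmod (1 - z)) * eps L + 4 * (c / cmod (1 - z)) * eps L by ring.
exact: lerD.
Qed.

End TestFunctions.

(** * Baire's theorem and necessity of the growth condition *)

(** Open sets are unions of cylinders, that is, of sets of sequences with a given prefix. If every
    cylinder met every open set [bad n], prefixes could be extended successively into [bad 0],
    [bad 1] and so on, and the limit sequence would be bad for all [n]. *)
Lemma baire_sequences (T : Type) (V : T -> Prop) (t0 : T)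
    (bad : nat -> (nat -> T) -> Prop) : V t0 ->
  (forall n v, (forall j, V (v j)) -> bad n v -> exists L, forall v',
     (forall j, V (v' j)) -> (forall j, (j < L)%N -> v' j = v j) -> bad n v') ->
  (forall v, (forall j, V (v j)) -> exists n, ~ bad n v) ->
  exists n L v, (forall j, V (v j)) /\ forall v', (forall j, V (v' j)) ->
    (forall j, (j < L)%N -> v' j = v j) -> ~ bad n v'.
Proof.
move=> V0 bad_open ex_good; apply: contrapT => H.
have next (x : nat * ((nat -> T) * nat)) : exists y : (nat -> T) * nat,
    (forall j, V (x.2.1 j)) -> [/\ forall j, V (y.1 j),
      forall j, (j < x.2.2)%N -> y.1 j = x.2.1 j, (x.2.2 < y.2)%N
    & forall v, (forall j, V (v j)) -> (forall j, (j < y.2)%N -> v j = y.1 j) -> bad x.1 v].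
  case: x => n [v L] /=.
  have [Vv|nVv] := pselect (forall j, V (v j)); last by exists (v, L).
  have [v' [Vv' agr bv']] : exists v', [/\ forall j, V (v' j),
      forall j, (j < L)%N -> v' j = v j & bad n v'].
    apply: contrapT => H'; apply: H; exists n, L, v; split => // v' Vv' agr bv'.
    by apply: H'; exists v'.
  have [L' HL'] := bad_open n v' Vv' bv'.
  (* The successor makes the prefixes grow strictly, so that every entry is eventually fixed. *)
  exists (v', (maxn L L').+1) => _; split => //=; first by rewrite ltnS leq_maxl.
  by move=> w Vw agrw; apply: HL' => // j jL'; apply: agrw; rewrite ltnS leq_max (ltnW jL') orbT.
have [g Hg] := choice next.
pose q := fix q n := if n is k.+1 then g (k, q k) else ((fun=> t0), 0%N).
have Vq n j : V ((q n).1 j).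
  by elim: n j => [//|n IH] j; have [+ _ _ _] := Hg (n, q n) IH; exact.
have step n : [/\ forall j, (j < (q n).2)%N -> (q n.+1).1 j = (q n).1 j,
    ((q n).2 < (q n.+1).2)%N & forall v, (forall j, V (v j)) ->
    (forall j, (j < (q n.+1).2)%N -> v j = (q n.+1).1 j) -> bad n v].
  by have [_ ? ? ?] := Hg (n, q n) (Vq n).
have lenq n : (n <= (q n).2)%N.
  by elim: n => // n IH; have [_ + _] := step n; exact: leq_ltn_trans.
have agr n k j : (j < (q n).2)%N -> (q (n + k)%N).1 j = (q n).1 j /\ (j < (q (n + k)%N).2)%N.
  move=> jn; elim: k => [|k [IH1 IH2]]; first by rewrite addn0.
  have [h1 h2 _] := step (n + k)%N.
  by rewrite addnS h1// IH1; split => //; exact: ltn_trans h2.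
(* The diagonal: by [lenq] the entry [j] is within the prefix of stage [j.+1] and never changes
   afterwards. *)
pose v j := (q j.+1).1 j.
have [n []] := ex_good v (fun j => Vq _ _).
have [_ _ +] := step n; apply=> [j|j jn]; first exact: Vq.
have [nj|jn'] := leqP n j.
  by have [+ _] := agr n.+1 (j - n)%N j jn; rewrite addSn subnKC.
have [+ _] := agr j.+1 (n - j)%N j (lenq _).
by rewrite addSn subnKC ?(ltnW jn').
Qed.

Section Necessity.
Variable R : realType.
Implicit Types (f phi : R[i] -> R[i]) (x y c d t r M B : R) (a z w h : R[i])
  (u v : nat -> R[i]) (n N L : nat).

Lemma eps_expR N : eps R N = expR (- (N%:R * ln 2)).
Proof.
rewrite expRN expRM_natl lnK ?posrE// /eps div1r exprVn; congr (_^-1).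
Qed.

Definition test_point N : R[i] := (1 - eps R N)%:C.

Lemma cmod_test_point N : cmod (test_point N) = 1 - eps R N.
Proof. by rewrite cmodR ger0_norm// subr_ge0 eps_le1. Qed.

Lemma test_point_disc N : cmod (test_point N) < 1.
Proof. by rewrite cmod_test_point; have := eps_gt0 R N; lra. Qed.

Lemma test_point_1B N : 1 - test_point N = (eps R N)%:C.
Proof. by rewrite /test_point rmorphB rmorph1; ring. Qed.

(** At these points the weights are real, below 1, and at least 1/2 for [j <= N], so the value can
    be steered by the coefficients. *)
Lemma test_fun_test_point c v (M N : nat) : bounded_by c v -> (forall j, (M <= j)%N -> v j = 0) ->
  test_fun v (test_point N) = \sum_(0 <= j < M) v j * (eps R j / (eps R j + eps R N))%:C.
Proof.
move=> Hv v0; have E n : (eps R n)%:C / (1 + (eps R n)%:C - test_point N) =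
    (eps R n / (eps R n + eps R N))%:C.
  by rewrite -addrA [_ - test_point N]addrC addrA test_point_1B -rmorphD/= fmorph_div [eps R N + _]addrC.
rewrite /test_fun (csum_fin (N := M) (dom_test_fun Hv (test_point_disc N))) => [|n Mn]; last by rewrite v0// mul0r.
by apply: eq_big_nat => n _; rewrite E.
Qed.

(** A sequence is bad for [n] when the growth bound with constant [n] fails at some [test_point N].
    One failure is an open condition, by continuity of [phi] and [test_fun_agree], and
    [dirichlet_growth] makes each sequence good for an [n] that depends on it. *)
Lemma uniform_growth phi s p alpha c : entire phi -> 0 < s < 1 -> 1 <= p -> 0 <= alpha ->
  p < alpha + 2 -> 0 <= c ->
  superposition phi @` Q_space s `<=` Dirichlet_space p alpha ->
  exists M L v, bounded_by c v /\ forall v', bounded_by c v' -> (forall j, (j < L)%N -> v' j = v j) ->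
    forall N, cmod (phi (test_fun v' (test_point N))) <= M * expR (N%:R * (((alpha + 2) / p - 1) * ln 2)).
Proof.
move=> ephi s01 p1 a0 pa c0 incl; set k := _ - 1.
pose bad n v := exists N, n%:R * expR (N%:R * (k * ln 2)) < cmod (phi (test_fun v (test_point N))).
have [||v Hv|n [L [v [Hv H]]]] := @baire_sequences R[i] (fun z => cmod z <= c) 0 bad.
- by rewrite cmod0.
- move=> n v Hv [N HN].
  have cphi : {for test_fun v (test_point N), continuous phi}.
    by apply: cdiff_cont; apply: derivable_cdiff; exact: ephi.
  move: (HN); rewrite -subr_gt0 => /((ccontP _ _).1 cphi)[d d0 Hd].
  pose K := 8 * (c / eps R N) + 1.
  have K0 : 0 < K.
    by apply: ltr_wpDl => //; exact: mulr_ge0 (ler0n R 8) (divr_ge0 c0 (ltW (eps_gt0 R N))).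
  have [L HL] := eps_small (divr_gt0 d0 K0).
  exists L => v' Hv' agr; exists N.
  have A := test_fun_agree Hv Hv' (test_point_disc N) agr; rewrite test_point_1B cmod_eps in A.
  have /Hd B : cmod (test_fun v' (test_point N) - test_fun v (test_point N)) < d.
    apply: le_lt_trans A _; rewrite ltr_pdivlMr// mulrC /K mulrDl mul1r in HL.
    by have := eps_gt0 R L; lra.
  by have := cmodB (phi (test_fun v (test_point N))) (phi (test_fun v (test_point N)) - phi (test_fun v' (test_point N)));
    rewrite opprB addrCA subrr addr0 [cmod (phi (test_fun v _) - _)]cmodBC; move: B; clear; lra.
- have [K K0 HK] := dirichlet_growth p1 a0 pa (incl _ (ex_intro2 _ _ _ (test_fun_Q s01 Hv) erefl)).
  exists (Num.truncn K).+1 => -[N]; apply/negP; rewrite -leNgt.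
  apply: le_trans (HK _ (test_point_disc N)) _; rewrite cmod_test_point opprB addrC subrK -/k.
  have -> : eps R N `^ (- k) = expR (N%:R * (k * ln 2)).
    by rewrite eps_expR -expRM; congr expR; ring.
  by rewrite ler_wpM2r ?expR_ge0// ltW// truncnS_gt.
exists n%:R, L, v; split => // v' Hv' agr N; rewrite leNgt; apply/negP => HN.
by apply: (H v' Hv' agr); exists N.
Qed.

Lemma necessity phi s p alpha : entire phi -> 0 < s < 1 -> 2 <= p -> p - 2 < alpha ->
  superposition phi @` Q_space s `<=` Dirichlet_space p alpha -> exp_type0 phi.
Proof.
move=> ephi s01 p2 pa incl e e0.
have p0 : 0 < p by lra.
pose k : R := ((alpha + 2) / p - 1) * ln 2.
have k0 : 0 < k by rewrite mulr_gt0 ?ln_gt0 ?ltr1n// subr_gt0 ltr_pdivlMr//; lra.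
(* Reaching [z] takes [N] about [2 * cmod z / c], so the exponent [k * N] is then about
   [e * cmod z]. *)
pose c := 2 * k / e; have c0 : 0 < c by rewrite divr_gt0// mulr_gt0.
have [|||M [L [v [Hv H]]]] := @uniform_growth phi s p alpha c ephi s01 _ _ _ (ltW c0) incl.
- lra.
- lra.
- lra.
have M0 : 0 <= M.
  have := H v Hv (fun _ _ => erefl) 0%N; rewrite mul0r expR0 mulr1; exact: le_trans (cmod_ge0 _).
(* The offset comes from [N = L + m], where [m] is at most [X + 1] and [X] is
   [2 * cmod z / c + 2 * L%:R]. *)
exists (M * expR (k * (3 * L%:R + 1))) => z.
(* The free coefficients must produce [z - sg], of modulus at most [cmod z + c * L%:R], with total
   weight [A >= m%:R / 2] and modulus at most [c]; hence [m] has to be at least [X]. *)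
pose X := 2 * (cmod z + c * L%:R) / c.
have X0 : 0 <= X by apply: divr_ge0 (ltW c0); rewrite mulr_ge0// addr_ge0 ?cmod_ge0// mulr_ge0// ltW.
pose m := (Num.truncn X).+1; pose N := (L + m)%N.
have Xm : X <= m%:R by rewrite ltW// truncnS_gt.
have mX : m%:R <= X + 1 by rewrite /m -natr1 lerD2r truncn_le.
pose w j : R := eps R j / (eps R j + eps R N).
have w01 j : 0 <= w j <= 1.
  have ej := eps_gt0 R j; have eN := eps_gt0 R N.
  by rewrite /w (divr_ge0 (ltW ej) (addr_ge0 (ltW ej) (ltW eN))) ler_pdivrMr ?addr_gt0// mul1r lerDl ltW.
pose sg := \sum_(0 <= j < L) v j * (w j)%:C.
pose A : R := \sum_(L <= j < N) w j.
have sgB : cmod sg <= c * L%:R.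
  rewrite /sg; elim: (L) => [|l IH]; first by rewrite big_nil cmod0 mulr0.
  rewrite big_nat_recr//= -natr1 mulrDr mulr1; apply: le_trans (cmodD _ _) (lerD IH _).
  have /andP[w0 w1] := w01 l; rewrite cmodM cmodR ger0_norm// -[leRHS]mulr1.
  exact: ler_pM (cmod_ge0 _) w0 (Hv l) w1.
have AB : m%:R / 2 <= A.
  have -> : m%:R / 2 = \sum_(L <= j < N) (1 / 2) :> R.
    by rewrite big_const_nat iter_addr_0 /N addKn -[RHS]mulr_natl mul1r.
  apply: ler_sum_nat => j /andP[_ jN]; have ej := eps_gt0 R j; have eN := eps_gt0 R N.
  rewrite /w ler_pdivlMr ?addr_gt0//; have := le_eps R (ltnW jN); lra.
have A0 : 0 < A by apply: lt_le_trans AB; rewrite divr_gt0// ltr0n.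
(* The common value of the coefficients from [L] to [N] that makes the test function equal to [z] at
   [test_point N]. *)
pose u := (z - sg) / A%:C.
have uc : cmod u <= c.
  rewrite cmodf cmodR (gtr0_norm A0) ler_pdivrMr//.
  apply: (@le_trans _ _ (cmod z + c * L%:R)).
    by apply: le_trans (cmodD _ _) _; rewrite cmodN lerD2l.
  have : X / 2 <= A by apply: le_trans AB; lra.
  have -> : X / 2 = (cmod z + c * L%:R) / c by rewrite /X; field; rewrite gt_eqF.
  by rewrite ler_pdivrMr// [A * c]mulrC.
pose v' j := if (j < L)%N then v j else if (j < N)%N then u else 0.
have Hv' : bounded_by c v'.
  move=> j; rewrite /v'; case: ifP => _; first exact: Hv.
  by case: ifP => _ //; rewrite cmod0 ltW.
have E : test_fun v' (test_point N) = z.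
  rewrite (@test_fun_test_point c v' N N Hv') => [|j Nj]; last first.
    by rewrite /v' ltnNge (leq_trans (leq_addr m L) Nj) ltnNge Nj.
  rewrite (@big_cat_nat _ _ _ L)//=; last exact: leq_addr.
  have -> : \sum_(0 <= j < L) v' j * (eps R j / (eps R j + eps R N))%:C = sg.
    by apply: eq_big_nat => j /andP[_ jL]; rewrite /v' jL.
  have -> : \sum_(L <= j < N) v' j * (eps R j / (eps R j + eps R N))%:C =
      \sum_(L <= j < N) u * (w j)%:C.
    by apply: eq_big_nat => j /andP[Lj jN]; rewrite /v' ltnNge Lj jN.
  rewrite -mulr_sumr -rmorph_sum /= -/A -/sg /u divfK ?subrKC//.
  by rewrite fmorph_eq0 gt_eqF.
have := H v' Hv' _ N; rewrite E => HH.
apply: le_trans (HH _) _ => [j jL|]; first by rewrite /v' jL.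
rewrite -mulrA -expRD ler_wpM2l// ler_expR -/k.
have -> : e * cmod z = k * (X - 2 * L%:R).
  by rewrite /X /c; field; rewrite !gt_eqF.
rewrite -mulrDr mulrC ler_wpM2l ?(ltW k0)// /N natrD; lra.
Qed.

End Necessity.

(** * Order and type *)

Section OrderType.
Variable R : realType.
Implicit Types (f phi : R[i] -> R[i]) (x y c d t r M B l e m : R) (a z w h : R[i])
  (g : R -> R).

Let limsup g := limf_esup (fun r => (g r)%:E) (pinfty_nbhs R).

Lemma limsup_lt g x : (limsup g < x%:E)%E ->
  exists2 l, l < x & exists M, forall r, M < r -> g r <= l.
Proof.
move=> /ereal_inf_lt[_ [V [M [_ HM]] <-]].
have gle r : M < r -> ((g r)%:E <= ereal_sup [set (g r)%:E | r in V])%E.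
  by move=> Mr; apply: ereal_sup_ubound; exists r => //; exact: HM.
case: (ereal_sup _) gle => [l|//|] gle lx.
  by exists l => //; exists M => r /gle; rewrite lee_fin.
by exists (x - 1); [lra|exists M => r /gle].
Qed.

Lemma limsup_le g x M : (forall r, M < r -> g r <= x) -> (limsup g <= x%:E)%E.
Proof.
move=> H; apply: (@le_trans _ _ (ereal_sup [set (g r)%:E | r in [set r | M < r]])).
  by apply: ereal_inf_lbound; exists [set r | M < r] => //; exists M; split => //; exact: num_real.
by apply: ge_ereal_sup => _ [r Mr <-]; rewrite lee_fin; exact: H.
Qed.

Lemma limsup_ge g x : (forall M, exists2 r, M < r & x <= g r) -> (x%:E <= limsup g)%E.
Proof.
move=> H; rewrite leNgt; apply/negP => /limsup_lt[l lx [M HM]].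
by have [r Mr] := H M; have := HM r Mr; lra.
Qed.

(** Boundedness passes from four quarters to the whole and holds near each point by continuity, so
    [halving_ind] serves as compactness of the square. *)
Lemma entire_bounded phi r : entire phi -> exists M, forall z, cmod z <= r -> cmod (phi z) <= M.
Proof.
move=> ephi; have [r0|r0] := ltP r 0.
  by exists 0 => z zr; have := cmod_ge0 z; lra.
have rr : - r <= r by lra.
suff [M HM] : exists M, forall z, inrect (- r) r (- r) r z -> cmod (phi z) <= M.
  exists M => z zr; apply: HM; rewrite /inrect -!ler_norml.
  by split; apply: le_trans zr; [exact: Re_le_cmod|exact: Im_le_cmod].
pose P (a b c d : R) := exists M, forall z, inrect a b c d z -> cmod (phi z) <= M.
apply: (@halving_ind _ P _ _ _ _ rr rr).
  move=> a b c d ab cd _ _ _ _ [M1 H1] [M2 H2] [M3 H3] [M4 H4].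
  exists (Num.max (Num.max M1 M2) (Num.max M3 M4)) => z [/andP[z1 z2] /andP[z3 z4]].
  rewrite !le_max; have [h1|h1] := leP (complex.Re z) ((a + b) / 2);
    have [h2|h2] := leP (complex.Im z) ((c + d) / 2).
  - by rewrite H1//; split; apply/andP.
  - by rewrite H3 ?orbT//; split; apply/andP; split => //; exact: ltW.
  - by rewrite H2 ?orbT//; split; apply/andP; split => //; exact: ltW.
  - by rewrite H4 ?orbT//; split; apply/andP; split => //; exact: ltW.
move=> z _; have cphi : {for z, continuous phi}.
  by apply: cdiff_cont; apply: derivable_cdiff; exact: ephi.
have [d d0 Hd] := (ccontP _ _).1 cphi 1 ltr01.
exists (d / 2) => [|a b c e n [/andP[z1 z2] /andP[z3 z4]] _ _ _ _ _ _ bad ecd].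
  by rewrite divr_gt0.
exists (cmod (phi z) + 1) => w [/andP[w1 w2] /andP[w3 w4]].
have /Hd wz : cmod (w - z) < d.
  apply: le_lt_trans (cmod_le_ReIm _) _; rewrite cReD cReN cImD cImN.
  have : `|complex.Re w - complex.Re z| < d / 2 by rewrite ltr_norml; apply/andP; split; lra.
  have : `|complex.Im w - complex.Im z| < d / 2 by rewrite ltr_norml; apply/andP; split; lra.
  lra.
have -> : phi w = phi z + (phi w - phi z) by ring.
by apply: le_trans (cmodD _ _) _; rewrite lerD2l ltW.
Qed.

Lemma le_max_modulus phi z : entire phi -> cmod (phi z) <= max_modulus phi (cmod z).
Proof.
move=> ephi; have [M HM] := entire_bounded (cmod z) ephi.
by apply: ub_le_sup; [exists M => _ [w /= wz <-]; apply: HM; rewrite wz|exists z].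
Qed.

Lemma max_modulus_le phi r M : 0 <= r -> (forall z, cmod z = r -> cmod (phi z) <= M) ->
  max_modulus phi r <= M.
Proof.
move=> r0 H; apply: ge_sup; last by move=> _ [z /= zr <-]; exact: H.
by exists (cmod (phi r%:C)), r%:C => //=; rewrite cmodR ger0_norm.
Qed.

Lemma ln_le_expR x t : ln x <= t -> x <= expR t.
Proof.
move=> xt; have [x0|x0] := leP x 0; first exact: le_trans x0 (expR_ge0 _).
by rewrite -[x]lnK ?posrE// ler_expR.
Qed.

Lemma exp_type0_eventually phi : entire phi ->
  (forall e, 0 < e -> exists M, forall r, M < r -> ln (max_modulus phi r) <= e * r) ->
  exp_type0 phi.
Proof.
move=> ephi H e e0; have [M HM] := H e e0; have [B HB] := entire_bounded M ephi.
exists (Num.max 1 B) => z; have [zM|Mz] := leP (cmod z) M.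
  apply: (@le_trans _ _ (Num.max 1 B * 1)); first by rewrite mulr1 le_max HB ?orbT.
  rewrite ler_wpM2l ?le_max ?ler01//.
  by rewrite -[leLHS]expR0 ler_expR mulr_ge0 ?cmod_ge0 ?ltW.
apply: le_trans (le_max_modulus z ephi) _.
apply: le_trans (ln_le_expR (HM _ Mz)) _.
by rewrite -[leLHS]mul1r ler_wpM2r ?expR_ge0// le_max lexx.
Qed.

Lemma order_type_exp_type0 phi : entire phi -> (entire_order phi < 1)%E \/
  (entire_order phi = 1%E /\ entire_type phi = 0%E) -> exp_type0 phi.
Proof.
move=> ephi; have [[c cphi]|ncphi] := pselect (constant_fun phi).
  move=> _ e e0; exists (cmod c) => z; rewrite cphi -[leLHS]mulr1 ler_wpM2l ?cmod_ge0//.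
  by rewrite -[leLHS]expR0 ler_expR mulr_ge0 ?cmod_ge0 ?ltW.
rewrite /entire_order asboolF// => H; apply: (exp_type0_eventually ephi) => e e0.
case: H => [/limsup_lt[l l1 [M HM]]|[ord1]].
  (* Beyond the last threshold [(1 - l) * ln r] exceeds [- ln e], so that r^l is below [e * r]. *)
  exists (Num.max (Num.max M 1) (expR ((1 - ln e) / (1 - l)))) => r.
  rewrite !gt_max => /andP[/andP[/HM Mr r1] re].
  have r0 : 0 < r by lra.
  have lr : 0 < ln r by rewrite ln_gt0.
  rewrite ler_pdivrMr// in Mr; rewrite leNgt; apply/negP => H.
  have : ln (e * r) < ln (ln (max_modulus phi r)).
    by rewrite ltr_ln ?posrE ?mulr_gt0// (lt_trans _ H)// mulr_gt0.
  rewrite lnM ?posrE// => H'.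
  have : (1 - ln e) / (1 - l) < ln r by rewrite -ltr_expR lnK.
  by rewrite ltr_pdivrMr ?subr_gt0//; lra.
rewrite /entire_type /entire_order asboolF// ord1 /= => t0.
have /limsup_lt[l le [M HM]] :
    (limsup (fun r => (ln (max_modulus phi r) / r `^ 1)%R) < e%:E)%E.
  by rewrite /limsup t0 lte_fin.
exists (Num.max M 0) => r; rewrite gt_max => /andP[/HM Mr r0].
by rewrite powRr1 ?(ltW r0)// ler_pdivrMr// in Mr; apply: le_trans Mr _; rewrite ler_wpM2r ?ltW.
Qed.

Lemma exp_type0_ln_max_modulus phi e : exp_type0 phi -> 0 < e ->
  exists2 M, 0 <= M & forall r, M < r -> ln (max_modulus phi r) <= e * r.
Proof.
move=> Hphi e0; have e20 : 0 < e / 2 by rewrite divr_gt0.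
(* Half of [e] is kept to absorb the constant [ln D] for large [r]. *)
have [C HC] := Hphi (e / 2) e20; pose D := Num.max C 1.
have D1 : 1 <= D by rewrite le_max lexx orbT.
have D0 : 0 < D := lt_le_trans ltr01 D1.
have lD : 0 <= ln D by rewrite ln_ge0.
exists (ln D / (e / 2)) => [|r]; first exact: divr_ge0 lD (ltW e20).
rewrite ltr_pdivrMr// => Hr.
have r0 : 0 < r by rewrite -(pmulr_lgt0 _ e20); exact: le_lt_trans lD Hr.
have [m0|m0] := leP (max_modulus phi r) 0; first by rewrite ln0// mulr_ge0// ltW.
have : max_modulus phi r <= D * expR (e / 2 * r).
  apply: max_modulus_le (ltW r0) _ => z <-; apply: le_trans (HC z) _.
  by rewrite ler_wpM2r ?expR_ge0// le_max lexx.
rewrite -ler_ln ?posrE ?mulr_gt0 ?expR_gt0// lnM ?posrE ?expR_gt0// expRK; lra.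
Qed.

Lemma exp_type0_order_type phi : exp_type0 phi -> (entire_order phi < 1)%E \/
  (entire_order phi = 1%E /\ entire_type phi = 0%E).
Proof.
move=> Hphi; have [cphi|ncphi] := pselect (constant_fun phi).
  by left; rewrite /entire_order asboolT// lte_fin ltr01.
have oE : entire_order phi = limsup (fun r => ln (ln (max_modulus phi r)) / ln r).
  by rewrite /entire_order asboolF.
have : (entire_order phi <= 1)%E.
  have [M M0 HM] := exp_type0_ln_max_modulus Hphi ltr01.
  rewrite oE; apply: (@limsup_le _ 1 (Num.max M 1)) => r; rewrite gt_max => /andP[/HM Mr r1].
  have lr : 0 < ln r by rewrite ln_gt0.
  rewrite ler_pdivrMr// mul1r; rewrite mul1r in Mr.
  (* When the inner logarithm is nonpositive, the outer one has the default value 0, which is below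
     [ln r]. *)
  have [m0|m0] := leP (ln (max_modulus phi r)) 0; first by rewrite ln0// ltW.
  by rewrite ler_ln ?posrE//; lra.
rewrite le_eqVlt => /predU1P[ord1|]; [right; split => //|by left].
rewrite /entire_type ord1 /=; apply/eqP; rewrite eq_le; apply/andP; split.
  apply/lee_addgt0Pr => e e0; rewrite add0e.
  have [M M0 HM] := exp_type0_ln_max_modulus Hphi e0.
  apply: (@limsup_le _ e M) => r Mr; have r0 : 0 < r := le_lt_trans M0 Mr.
  by rewrite powRr1 ?(ltW r0)// ler_pdivrMr// HM.
(* Otherwise [ln (max_modulus phi r)] would be negative for all large [r], its logarithm would take
   the default value 0, and the order would be at most 0 instead of 1. *)
apply: limsup_ge => M; apply: contrapT => H.
have : (entire_order phi <= 0)%E; last by rewrite ord1 lee_fin ler10.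
rewrite oE; apply: (@limsup_le _ 0 (Num.max M 0)) => r; rewrite gt_max => /andP[Mr r0].
rewrite [ln (ln _)]ln0 ?mul0r// leNgt; apply/negP => m0; apply: H; exists r => //.
by rewrite powRr1 ?(ltW r0)// divr_ge0 ?ltW.
Qed.

End OrderType.

Theorem theorem11 (R : realType) (phi : R[i] -> R[i]) (s p alpha : R)
    (hphi : entire phi) (hs : 0 < s < 1) (hp : 2 <= p) (halpha : -1 < alpha)
    (h : p - 2 + s < alpha < p - 1) :
  superposition phi @` Q_space s `<=` Dirichlet_space p alpha <->
  ((entire_order phi < 1)%E \/
   (entire_order phi = 1%E /\ entire_type phi = 0%E)).
Proof.
have /andP[s0 _] := hs; have /andP[pa _] := h.
split=> [incl|ot].
  apply: exp_type0_order_type; apply: (necessity hphi hs hp _ incl); lra.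
exact: sufficiency hphi s0 hp pa (order_type_exp_type0 hphi ot).
Qed.
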